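(* Let $\Gamma$ be a countably infinite discrete amenable group acting continuously on a compact metric space $X$, and let $\mathcal{M}(X)$ be the space of Borel probability measures on $X$ with the weak-$*$ topology, on which $\Gamma$ acts by push-forward $g:\mu\mapsto \mu\circ g^{-1}$. Then $$h_{top}(X,\Gamma)>0\ \Longleftrightarrow\ \mathrm{mdim}(\mathcal{M}(X),\Gamma)>0\ \Longleftrightarrow\ \mathrm{mdim}(\mathcal{M}(X),\Gamma)=\infty .$$
   Context: A Følner sequence of $\Gamma$ is a sequence $\{F_n\}_{n\in\mathbb N}$ of non-empty finite subsets of $\Gamma$ with $\lim_{n}|F_n\Delta gF_n|/|F_n|=0$ for every $g\in\Gamma$; $\Gamma$ is amenable if it admits one. For a continuous action of $\Gamma$ on a compact metric space $Y$, $h_{top}(Y,\Gamma)$ denotes its topological entropy: $h_{top}(Y,\Gamma)=\sup_{\alpha}\lim_{n}\frac{1}{|F_n|}\log N(\bigvee_{g\in F_n}g^{-1}\alpha)$, where $\alpha$ ranges over finite open covers of $Y$ and $N(\cdot)$ is the minimal cardinality of a subcover. Mean (topological) dimension: for finite open covers $\mathcal A,\mathcal B$ of $Y$, $\mathcal A\vee\mathcal B=\{U\cap V:U\in\mathcal A,V\in\mathcal B\}$; $\mathcal B\succ\mathcal A$ ($\mathcal B$ is finer than $\mathcal A$) means that every element of $\mathcal B$ is contained in an element of $\mathcal A$; $\mathrm{ord}(\mathcal A)=\sup_{y\in Y}\sum_{A\in\mathcal A}1_A(y)-1$; and $D(\mathcal A)=\min\{\mathrm{ord}(\mathcal B):\mathcal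 B \text{ a finite open cover},\ \mathcal B\succ\mathcal A\}$. Then $$\mathrm{mdim}(Y,\Gamma)=\sup_{\alpha}\lim_{n\to\infty}\frac{1}{|F_n|}D\Big(\bigvee_{g\in F_n}g^{-1}\alpha\Big),$$ where $\alpha$ ranges over finite open covers of $Y$. In both definitions the limit exists and does not depend on the Følner sequence (Ornstein–Weiss Lemma). *)

(* Defs.v *)
From HB Require Import structures.
From mathcomp Require Import all_boot all_order all_algebra finmap.
From mathcomp Require Import all_classical all_reals all_analysis.
From mathcomp Require Import measurable_realfun.

Set Implicit Arguments.
Unset Strict Implicit.
Unset Printing Implicit Defensive.

Import Order.TTheory GRing.Theory Num.Theory.
Import numFieldNormedType.Exports.

Local Open Scope classical_set_scope.
Local Open Scope ring_scope.

(* Nonempty metric spaces: measurable types are pointed, hence so must be the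
   metric spaces that carry Borel measures. *)
#[short(type="pmetricType")]
HB.structure Definition PointedMetric (K : numDomainType) :=
  { M of Pointed M & Metric K M }.

Section Folner.
Context (R : realType) (G : groupType).

Definition ltransl (g : G) (A : {fset G}) : {fset G} :=
  [fset (g * x)%g | x in A]%fset.

Definition fsymdiff (A B : {fset G}) : {fset G} :=
  ((A `\` B) `|` (B `\` A))%fset.

Definition folner (F : nat -> {fset G}) : Prop :=
  (forall n, F n != fset0) /\
  forall g : G,
    (#|` fsymdiff (F n) (ltransl g (F n))|%:R / #|` F n|%:R : R) @[n --> \oo]
      --> (0 : R).

Definition amenable : Prop := exists F, folner F.

End Folner.

(* [G] carries no topology (it is discrete), so an action is continuous when
   every group element acts by a continuous map. *)
Record contAction (G : groupType) (Y : topologicalType) := ContAction {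
  act :> G -> Y -> Y ;
  act1 : forall y, act 1%g y = y ;
  actM : forall g h y, act (g * h)%g y = act g (act h y) ;
  act_continuous : forall g, continuous (act g)
}.

Section Covers.
Context (R : realType) (Y : topologicalType).
Implicit Types A B : {fset set Y}.

Definition is_cover A : Prop := \bigcup_(U in [set` A]) U = [set: Y].

Definition open_cover A : Prop := (forall U, U \in A -> open U) /\ is_cover A.

Definition cover_join A B : {fset set Y} :=
  [fset (U `&` V)%classic | U in A, V in B]%fset.

Definition finer B A : Prop :=
  forall V, V \in B -> exists2 U, U \in A & V `<=` U.

(* If [A] is a cover, then [A] itself is among the [B] below, so the default
   value #|A| of the minimum is harmless. *)
Definition ncover A : nat :=
  \big[minn/#|` A|]_(B <- fpowerset A | `[< is_cover B >]) #|` B|.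

Definition cover_ord A : \bar R :=
  (ereal_sup [set (\sum_(U <- A) \1_U y)%:E | y in [set: Y]] - 1)%E.

(* The infimum of a nonempty set of values in {-1, 0, 1, ...} is a minimum. *)
Definition cover_dim A : \bar R :=
  ereal_inf [set cover_ord B | B in [set B | open_cover B /\ finer B A]].

End Covers.

Section Invariants.
Context (R : realType) (G : groupType) (Y : topologicalType).
Variables (a : contAction G Y) (F : nat -> {fset G}).

(* The join over g in E of the covers g^-1 A; the trivial cover {Y} is neutral
   for joins. *)
Definition cover_along (E : {fset G}) (A : {fset set Y}) : {fset set Y} :=
  \big[@cover_join Y/[fset [set: Y]]%fset]_(g <- E)
    [fset a g @^-1` U | U in A]%fset.

(* Both quantities are computed along a sequence [F], meant to be a Folner
   sequence; in that case the limits exist and do not depend on [F] by the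
   Ornstein-Weiss lemma. *)
Definition htop : \bar R :=
  ereal_sup [set limn (fun n =>
      (ln (ncover (cover_along (F n) A))%:R / #|` F n|%:R)%:E : \bar R)
    | A in @open_cover Y].

Definition mdim : \bar R :=
  ereal_sup [set limn (fun n =>
      (cover_dim R (cover_along (F n) A) * ((#|` F n|%:R)^-1)%:E)%E)
    | A in @open_cover Y].

End Invariants.

Lemma probability_eq d (T : measurableType d) (R : realType)
  (P Q : probability T R) : (P : set T -> \bar R) = Q -> P = Q.
Proof.
destruct P as [p [[a b] [c] [e] [f] [g] [h] [i]]].
destruct Q as [q [[a' b'] [c'] [e'] [f'] [g'] [h'] [i']]].
simpl => pq; subst q.
rewrite (Prop_irrelevance a a') (Prop_irrelevance b b') (Prop_irrelevance c c').
rewrite (Prop_irrelevance e e') (Prop_irrelevance f f') (Prop_irrelevance g g').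
by rewrite (Prop_irrelevance h h') (Prop_irrelevance i i').
Qed.

Lemma continuous_to_prod (S : topologicalType) (I : Type)
    (K : I -> topologicalType) (h : S -> prod_topology K) :
  (forall i, continuous (fun s => h s i)) -> continuous h.
Proof.
move=> hc s; apply/cvg_sup => i A [B [[C oC <-] Cs] sBA].
apply: (@filterS _ (nbhs (h @ s)) _ _ _ sBA).
by apply: (hc i s); exact: open_nbhs_nbhs.
Qed.

Section BorelProbabilities.
Context (R : realType) (X : pmetricType R).

Definition borel := g_sigma_algebraType (@open X).

HB.instance Definition _ := Measurable.on borel.

(* Elements of [probability] are functions on all subsets, with arbitrary
   values outside the sigma-algebra; fixing those values to 0 makes equality in
   [borelProb] the equality of Borel measures. *)
Definition borelProb : Type :=
  {mu : probability borel R | forall A : set borel, ~ measurable A -> mu A = 0%E}.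

HB.instance Definition _ := gen_eqMixin borelProb.
HB.instance Definition _ := gen_choiceMixin borelProb.

Definition integrals (mu : borelProb) :
    prod_topology (fun _ : {f : X -> R | continuous f} => R) :=
  fun f => (\int[sval mu]_x (sval f x))%R.

(* The weak-* topology: the coarsest one for which integration against each
   continuous real function on [X] is continuous. *)
HB.instance Definition _ :=
  Topological.copy borelProb (initial_topology integrals).


Lemma integral_continuous (f : {f : X -> R | continuous f}) :
  continuous (fun mu => integrals mu f).
Proof.
move=> mu; apply: (@continuous_comp borelProb _ R integrals (fun phi => phi f)).
  exact: (@initial_continuous _ _ integrals mu).
exact: (@proj_continuous {classic {f : X -> R | continuous f}} (fun=> R)
  (f : {classic _})).
Qed.

Variables (G : groupType) (a : contAction G X).

Section PushProbability.
Variables (g : G) (mu : probability borel R).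

Definition push_fun : set borel -> \bar R :=
  pushforward mu (a g : borel -> borel).

Lemma measurable_act : measurable_fun [set: borel] (a g : borel -> borel).
Proof.
apply: (@measurability _ _ borel borel setT (a g) (@open X)) => //.
move=> _ [B oB <-]; rewrite setTI; apply: sub_sigma_algebra.
by move/continuousP: (@act_continuous _ _ a g); exact.
Qed.

Let push0 : push_fun set0 = 0%E.
Proof. by rewrite /push_fun /pushforward preimage_set0 measure0. Qed.

Let push_ge0 A : (0 <= push_fun A)%E.
Proof. exact: (measure_ge0 mu). Qed.

Let push_additive : semi_sigma_additive push_fun.
Proof.
move=> B mB tB mUB.
have mpre (A : set borel) : measurable A -> measurable (a g @^-1` A : set borel).
  by move=> mA; rewrite -[_ @^-1` _]setTI; exact: measurable_act.
rewrite /push_fun /pushforward preimage_bigcup.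
apply: (@measure_semi_sigma_additive _ _ _ mu).
- by move=> n; exact: mpre.
- apply/trivIsetP => /= i j _ _ ij; rewrite -preimage_setI.
  by move/trivIsetP : tB => /(_ _ _ _ _ ij) ->//; rewrite preimage_set0.
- by rewrite -preimage_bigcup; exact: mpre.
Qed.

HB.instance Definition _ :=
  isMeasure.Build _ _ _ push_fun push0 push_ge0 push_additive.

Let push_setT : push_fun [set: borel] = 1%E.
Proof. by rewrite /push_fun /pushforward preimage_setT probability_setT. Qed.

HB.instance Definition _ := Measure_isProbability.Build _ _ _ push_fun push_setT.

Definition push_prob : probability borel R := push_fun.

End PushProbability.

Lemma push_prob_junk g (mu : borelProb) (A : set borel) :
  ~ measurable A -> push_prob g (sval mu) A = 0%E.
Proof.
move=> nA; apply: (svalP mu) => mA; apply: nA.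
have := @measurable_act g^-1%g measurableT _ mA.
rewrite setTI => mA'; suff -> : A = a g^-1%g @^-1` (a g @^-1` A) by [].
by apply/seteqP; split=> x /=; rewrite -actM mulgV act1.
Qed.

Definition push g (mu : borelProb) : borelProb :=
  exist _ (push_prob g (sval mu)) (@push_prob_junk g mu).

Lemma borelProb_eq (mu nu : borelProb) :
  (forall A : set borel, sval mu A = sval nu A) -> mu = nu.
Proof.
move: mu nu => [mu Hmu] [nu Hnu] /= mn.
have e : mu = nu by apply: probability_eq; exact/funext.
by subst nu; rewrite (Prop_irrelevance Hmu Hnu).
Qed.

Lemma push1 mu : push 1%g mu = mu.
Proof.
apply: borelProb_eq => A /=; rewrite /push_fun /pushforward.
by congr (sval mu _); apply/seteqP; split=> x /=; rewrite act1.
Qed.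

Lemma pushM g h mu : push (g * h)%g mu = push g (push h mu).
Proof.
apply: borelProb_eq => A /=; rewrite /push_fun /pushforward.
by congr (sval mu _); apply/seteqP; split=> x /=; rewrite actM.
Qed.

Lemma integrals_push g mu (f : {f : X -> R | continuous f})
    (fg : continuous (sval f \o a g)) :
  integrals (push g mu) f = integrals mu (exist _ (sval f \o a g) fg).
Proof.
have mf : measurable_fun [set: borel] (sval f : borel -> R).
  apply: (measurability _ (RGenOpens.measurableE R)) => //.
  move=> _ [_ [u [v ->] <-]]; rewrite setTI; apply: sub_sigma_algebra.
  by move/continuousP: (svalP f); apply; exact: interval_open.
have mEf : measurable_fun [set: borel]
    ((fun x => (sval f x)%:E) : borel -> \bar R).
  exact/measurable_EFinP.
have push_int (h : borel -> \bar R) : measurable_fun [set: borel] h ->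
    (forall x, 0 <= h x)%E ->
    (\int[push_prob g (sval mu)]_x h x = \int[sval mu]_x h (a g x))%E.
  move=> mh h0.
  have := @ge0_integral_pushforward _ _ _ _ _ _ (measurable_act g)
    (sval mu) setT h measurableT mh (fun x _ => h0 x).
  rewrite preimage_setT => <-.
  by apply: eq_measure_integral => [|mg A _ _] //; exact: measurable_act.
rewrite /integrals /Rintegral; congr (fine _).
rewrite integralE [RHS]integralE /=; congr (_ - _)%E.
- rewrite push_int; last by move=> x; exact: funepos_ge0.
    by apply: eq_integral => x _; rewrite !funeposE.
  exact: measurable_funepos.
- rewrite push_int; last by move=> x; exact: funeneg_ge0.
    by apply: eq_integral => x _; rewrite !funenegE.
  exact: measurable_funeneg.
Qed.

Lemma push_continuous g : continuous (push g).
Proof.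
apply/continuousP => A [B oB <-].
suff: open ((fun mu => integrals (push g mu)) @^-1` B) by [].
move: B oB; apply/continuousP.
apply: continuous_to_prod => f mu.
have fg : continuous (sval f \o a g).
  move=> x; apply: continuous_comp; first exact: (@act_continuous _ _ a g).
  exact: (svalP f).
rewrite (_ : (fun s => _) =
    (fun nu => integrals nu (exist _ (sval f \o a g) fg))); last first.
  by apply/funext => nu; exact: integrals_push.
exact: integral_continuous.
Qed.

Definition pushAction : contAction G borelProb :=
  ContAction push1 pushM push_continuous.

End BorelProbabilities.

(* Main.v *)
(** Zero entropy: by Maurey's empirical method every measure is, for most of the
    test functions moved along F_n, close to an average of m Diracs, so up to a
    small error there are only exp(o(|F_n|)) integral profiles. A counting
    argument then picks, for each test function, one of Q shifted grids of [0,1]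
    such that every profile is near a grid point in at most o(|F_n|)
    coordinates; as the join of covers by functions adds up the excesses of their
    multiplicities, the joined interval covers have dimension o(|F_n|).

    Positive entropy: by Pajor's form of the Sauer-Shelah lemma one of finitely
    many functions f takes the values 0 and 1 independently along sets
    J of F_n with |J| >= c |F_n|. Cut J into pairwise disjoint blocks inside
    translates S g with |S| = m: each carries at least 2^(c m / 4) patterns, of
    which q ~ m^2 K are used. Mixing the patterns independently over the blocks
    embeds a cube of dimension at least K |F_n| into the space of measures, with
    opposite faces separated by a cover that does not depend on n. By Lebesgue's
    covering theorem the mean dimension is at least K, for every K. *)

From HB Require Import structures.
Require Import Defs.
From mathcomp Require Import all_boot all_order fingroup perm all_algebra finmap.
From mathcomp Require Import all_classical all_reals all_analysis.
From mathcomp Require Import measurable_realfun zify ring lra.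

Set Implicit Arguments.
Unset Strict Implicit.
Unset Printing Implicit Defensive.

Import Order.TTheory GRing.Theory Num.Theory.
Import numFieldNormedType.Exports.

Local Open Scope classical_set_scope.
Local Open Scope ring_scope.

(** * The Ornstein-Weiss lemma *)

Section OrnsteinWeiss.
Context (R : realType) (G : groupType).
Implicit Types (A B K U W : {fset G}) (S : seq G) (g s : G).

(** Mixing the values 0 and 1 independently along J would only embed a cube of dimension |J|, at
    most one coordinate per element of F_n. To exceed every K, a block must yield more coordinates
    than it has elements: probability vectors over its patterns do, as their number is exponential
    in the trace of J on the block, whereas a greedy choice of disjoint blocks, which needs no
    tiling of the group, costs only a factor m^2. The test functions are products of translates of f
    by elements of S, transported by g; finitely many serve every n, hence the fixed cover.

    At zero entropy one common grid would not do: all coordinates of a measure could lie close to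
    grid points at once. An exponential moment over all choices of shifts produces one that is good
    for every profile.

    [limn] carries information only for convergent sequences, hence the Ornstein-Weiss lemma, used
    for logarithms of covering numbers and for dimensions of covers. The Riesz theorem is used
    twice: limits of measures along ultrafilters and mixtures of patterns both arise first as
    positive functionals. *)

Definition rtransl A g : {fset G} := [fset (x * g)%g | x in A]%fset.

Lemma in_ltransl g A x : (x \in ltransl g A) = ((g^-1 * x)%g \in A).
Proof.
apply/imfsetP/idP => [[y yA ->]|xA]; first by rewrite mulKg.
by exists (g^-1 * x)%g; rewrite ?mulVKg.
Qed.

Lemma in_rtransl A g x : (x \in rtransl A g) = ((x * g^-1)%g \in A).
Proof.
apply/imfsetP/idP => [[y yA ->]|xA]; first by rewrite mulgK.
by exists (x * g^-1)%g; rewrite ?mulgVK.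
Qed.

Lemma card_ltransl g A : #|` ltransl g A| = #|` A|.
Proof. by rewrite card_imfset//= => x y /mulgI. Qed.

Lemma card_rtransl A g : #|` rtransl A g| = #|` A|.
Proof. by rewrite card_imfset//= => x y /mulIg. Qed.

(** The number of pairs (s, x) with x in A and s x outside A. Counting pairs instead of boundary
    points makes it additive in the list S. *)
Definition bdry S A : nat := (\sum_(s <- S) #|` (A `\` ltransl s^-1 A)%fset|)%N.

Lemma card_fsetD_sym A B : #|` A| = #|` B| -> #|` (A `\` B)%fset| = #|` (B `\` A)%fset|.
Proof. by move=> AB; rewrite !cardfsD AB fsetIC. Qed.

Lemma bdryE S A : bdry S A = (\sum_(s <- S) #|` (ltransl s^-1 A `\` A)%fset|)%N.
Proof. by apply: eq_bigr => s _; rewrite card_fsetD_sym ?card_ltransl. Qed.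

Lemma card_fsetD_le A B C : (A `<=` B `|` C)%fset -> (#|` A| <= #|` B| + #|` C|)%N.
Proof.
move=> /fsubset_leq_card/leq_trans; apply.
by rewrite cardfsU leq_subr.
Qed.

Lemma bdryU S A B : (bdry S (A `|` B)%fset <= bdry S A + bdry S B)%N.
Proof.
rewrite /bdry -big_split/=; apply: leq_sum => s _.
apply: card_fsetD_le; apply/fsubsetP => x; rewrite !inE !in_ltransl !inE.
by do 4 case: (_ \in _).
Qed.

Lemma bdryD S A U : (bdry S (A `\` U)%fset <= bdry S A + bdry S U)%N.
Proof.
rewrite [bdry S U]bdryE /bdry -big_split/=; apply: leq_sum => s _.
apply: card_fsetD_le; apply/fsubsetP => x; rewrite !inE !in_ltransl !inE.
by do 4 case: (_ \in _).
Qed.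

Lemma bdry_rtransl S A g : bdry S (rtransl A g) = bdry S A.
Proof.
apply: eq_bigr => s _.
rewrite -(card_rtransl (A `\` _)%fset g); congr (#|` _|).
by apply/fsetP => x; rewrite !(inE, in_rtransl, in_ltransl) mulgA.
Qed.

Lemma folner_bdry (F : nat -> {fset G}) S (d : R) : folner R F -> 0 < d ->
  \forall n \near \oo, (bdry S (F n))%:R <= d * #|` F n|%:R.
Proof.
move=> [F0 Fg] d0.
have Fpos n : 0 < #|` F n|%:R :> R by rewrite ltr0n cardfs_gt0.
elim: S => [|s S IH] in d d0 *.
  by near=> n; rewrite /bdry big_nil mulr_ge0// ltW.
have d20 : 0 < d / 2 by rewrite divr_gt0.
have /cvgrPdist_le/(_ _ d20) := Fg s^-1%g.
apply: filterS2 (IH _ d20) => n H1 H2.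
rewrite /bdry big_cons natrD addrC [d]splitr mulrDl lerD// -ler_pdivrMr//.
move: H2; rewrite sub0r normrN ger0_norm ?divr_ge0//; apply: le_trans.
rewrite ler_pM2r ?invr_gt0// ler_nat fsubset_leq_card//.
by apply/fsubsetP => x; rewrite !inE => ->.
Unshelve. all: by end_near.
Qed.

Definition tile_base K U : {fset G} :=
  [fset c in U | all (fun s => (s * c)%g \in U) K]%fset.

Lemma tile_base_ge K U : (#|` U| <= #|` tile_base K U| + bdry K U)%N.
Proof.
have sub : (U `<=` tile_base K U `|` [fset c in U | ~~ all (fun s => (s * c)%g \in U) K])%fset.
  by apply/fsubsetP => x xU; rewrite !inE/= xU/= orbN.
apply: leq_trans (card_fsetD_le sub) _; rewrite leq_add2l {sub}.
rewrite /bdry; elim: (enum_fset K) => [|s S IH].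
  rewrite big_nil leqn0 cardfs_eq0; apply/eqP/fsetP => x.
  by rewrite !inE/= andbF.
rewrite big_cons; apply: leq_trans (leq_add (leqnn _) IH).
apply: card_fsetD_le; apply/fsubsetP => x; rewrite !inE/= negb_and !in_ltransl.
by rewrite invgK; do ! case: (_ \in _).
Qed.

Lemma rtransl_sub K U c : c \in tile_base K U -> (rtransl K c `<=` U)%fset.
Proof.
rewrite !inE/= => /andP[_ /allP Kc]; apply/fsubsetP => x.
by rewrite in_rtransl => /Kc; rewrite mulgVK.
Qed.

Lemma card_fset_sep (T : choiceType) (A : {fset T}) (P : pred T) :
  #|` [fset x in A | P x]%fset| = count P A.
Proof.
rewrite -size_filter; apply: perm_size; apply: uniq_perm => //.
  exact: filter_uniq.
by move=> x; rewrite mem_filter !inE/= andbC.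
Qed.

Lemma count_sum (T : Type) (P : pred T) (r : seq T) : count P r = (\sum_(x <- r) P x)%N.
Proof. by elim: r => [|x r IH]/=; rewrite ?big_nil// big_cons IH. Qed.

Lemma rtransl_count K U W :
  (\sum_(c <- W) #|` (rtransl K c `&` U)%fset| <= #|` K| * #|` U|)%N.
Proof.
under eq_bigr => c _.
  have -> : #|` (rtransl K c `&` U)%fset| = (\sum_(s <- K) ((s * c)%g \in U))%N.
    rewrite -count_sum -card_fset_sep -[RHS](card_rtransl _ c).
    congr (#|` _|); apply/fsetP => x; rewrite !inE !in_rtransl !inE/=.
    by rewrite mulgVK.
  over.
rewrite exchange_big/= (_ : #|` K| * _ = \sum_(s <- K) #|` U|)%N; last first.
  by rewrite big_const_seq count_predT iter_addn_0 mulnC.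
apply: leq_sum => s _; rewrite -count_sum -card_fset_sep -[X in (X <= _)%N](card_ltransl s).
apply: fsubset_leq_card; apply/fsubsetP => x.
by rewrite in_ltransl !inE/= mulVKg => /andP[].
Qed.

Variable h : {fset G} -> R.
Hypothesis h_ge0 : forall A, 0 <= h A.
Hypothesis h0 : h fset0 = 0.
Hypothesis hU : forall A B, h (A `|` B)%fset <= h A + h B.
Hypothesis hT : forall A g, h (rtransl A g) = h A.

(** V is a union of k almost disjoint right translates of K, of largest possible cardinality. A
    translate inside U meeting V in fewer than e |K| points could be added; so all of them meet V in
    at least e |K| points, and double counting bounds |V| from below. *)
Lemma quasi_tile K U S (e : R) : K != fset0 -> 0 < e -> e < 1 ->
  exists V k, [/\ (V `<=` U)%fset, (1 - e) * k%:R * #|` K|%:R <= #|` V|%:R,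
     h V <= k%:R * h K, (bdry S V <= k * bdry S K)%N &
     e * (#|` U|%:R - (bdry K U)%:R) <= #|` V|%:R].
Proof.
move=> K0 e0 e1.
have Kpos : 0 < #|` K|%:R :> R by rewrite ltr0n cardfs_gt0.
(* [T] keeps only the estimates satisfied by such a union, so that maximality is that of a number,
   not of a family of translates. *)
pose T V := exists k, [/\ (V `<=` U)%fset, (1 - e) * k%:R * #|` K|%:R <= #|` V|%:R,
     h V <= k%:R * h K & (bdry S V <= k * bdry S K)%N].
pose P m := `[< exists V, T V /\ #|` V| = m >].
have exP : exists m, P m.
  exists 0%N; apply/asboolP; exists fset0; split; last by rewrite cardfs0.
  exists 0%N; split; rewrite ?fsub0set ?h0 ?mulr0 ?mul0r//.
  rewrite /bdry big1// => s _; apply/eqP; rewrite cardfs_eq0.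
  by apply/eqP/fsetP => x; rewrite !inE andbF.
have ubP m : P m -> (m <= #|` U|)%N.
  by move=> /asboolP[V [[k [VU _ _ _]] <-]]; exact: fsubset_leq_card.
case: (ex_maxnP exP ubP) => m /asboolP[V [[k [VU kV hV bV]] Vm]] mmax.
exists V, k; split=> //.
have step c : c \in tile_base K U -> e * #|` K|%:R <= #|` (rtransl K c `&` V)%fset|%:R.
  move=> cb; rewrite leNgt; apply/negP => small.
  have cV : #|` (V `|` rtransl K c)%fset|%:R
      = #|` V|%:R + #|` K|%:R - #|` (rtransl K c `&` V)%fset|%:R :> R.
    rewrite -natrD -(card_rtransl K c) -cardfsUI natrD fsetIC addrK.
    by rewrite fsetUC.
  suff : T (V `|` rtransl K c)%fset.
    move=> TV; have : P #|` (V `|` rtransl K c)%fset| by apply/asboolP; eexists; split; first exact: TV.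
    move=> /mmax; rewrite -Vm -(ler_nat R) cV -addrA gerDl; nra.
  exists k.+1; split.
  - by rewrite fsubUset VU rtransl_sub.
  - rewrite cV -natr1; nra.
  - by rewrite -natr1 mulrDl mul1r (le_trans (hU _ _))// hT lerD.
  - by rewrite mulSn addnC (leq_trans (bdryU _ _ _))// bdry_rtransl leq_add.
have := rtransl_count K V (tile_base K U).
rewrite -(ler_nat R) natr_sum natrM => count.
have : \sum_(c <- tile_base K U) (e * #|` K|%:R) <= #|` K|%:R * #|` V|%:R.
  apply: le_trans count; rewrite big_seq [leRHS]big_seq.
  by apply: ler_sum => c; exact: step.
rewrite big_const_seq count_predT iter_addr_0 -[_ *+ _]mulr_natr.
rewrite mulrAC [_ * #|` V|%:R]mulrC ler_pM2r//; apply: le_trans.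
rewrite ler_pM2l// lerBlDr -natrD ler_nat; exact: tile_base_ge.
Qed.

Definition folner_bound q := exists S (d : R), 0 < d /\
  forall U, (bdry S U)%:R <= d * #|` U|%:R -> h U <= q * #|` U|%:R.

Lemma bounded_by_card : exists2 M, 0 <= M & forall A, h A <= M * #|` A|%:R.
Proof.
exists (h [fset 1%g]%fset) => // A.
elim/finSet_rect: A => A IH.
have [->|[x xA]] := fset_0Vmem A; first by rewrite h0 cardfs0 mulr0.
rewrite -(fsetD1K xA) cardfsU1 !inE eqxx/= natrD mulrDr mulr1.
apply: (le_trans (hU _ _)); rewrite lerD ?IH ?fproperD1//.
rewrite (_ : [fset x]%fset = rtransl [fset 1%g]%fset x) ?hT//.
by apply/fsetP => y; rewrite in_rtransl !inE -[RHS](inj_eq (mulIg x)) mulgVK mul1g.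
Qed.

(** Split U into the quasi-tiled part V and the rest. A rest of at most e |U| elements costs at most
    M e |U|. A larger one is still invariant enough for the bound q, and the gain comes from V,
    which fills at least e / 2 of U. *)
Lemma folner_bound_step K l0 M e q : K != fset0 -> 0 <= l0 ->
  h K <= l0 * #|` K|%:R ->
  (forall A, h A <= M * #|` A|%:R) -> 0 <= M -> 0 < e -> e < 1 ->
  forall S d, 0 < d -> (bdry S K)%:R <= (e * d * (1 - e) / 2) * #|` K|%:R ->
  (forall U, (bdry S U)%:R <= d * #|` U|%:R -> h U <= q * #|` U|%:R) ->
  l0 / (1 - e) <= q ->
  folner_bound (Num.max (l0 / (1 - e) + M * e)
    (q - (q - l0 / (1 - e)) * (e / 2))).
Proof.
move=> K0 l00 hK hM M0 e0 e1 S d d0 bK bq; set l := l0 / (1 - e) => lq.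
have e1' : 0 < 1 - e by rewrite subr_gt0.
have l_ge0 : 0 <= l by rewrite divr_ge0// ltW.
(* The 1/2 leaves half of U as base points of tiles. With e d / 2 the boundaries of U and of V
   together stay below d times a rest of more than e |U| elements. *)
exists (enum_fset K ++ S), (Num.min 2^-1 (e * d / 2)); split.
  by rewrite lt_min invr_gt0 ltr0n/= divr_gt0// mulr_gt0.
have bdry_cat U : bdry (enum_fset K ++ S) U = (bdry K U + bdry S U)%N.
  by rewrite /bdry big_cat.
move=> U; rewrite bdry_cat natrD => bU.
have [V [k [VU kV hV bV eV]]] := quasi_tile U S K0 e0 e1.
set u := #|` U|%:R in bU eV *; set v := #|` V|%:R in kV eV.
have u0 : 0 <= u by rewrite /u.
have [bU1 bU2] : (bdry K U)%:R <= 2^-1 * u /\ (bdry S U)%:R <= e * d / 2 * u.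
  have m1 : Num.min 2^-1 (e * d / 2) <= 2^-1 by rewrite ge_min lexx.
  have m2 : Num.min 2^-1 (e * d / 2) <= e * d / 2 by rewrite ge_min lexx orbT.
  have b1 : 0 <= (bdry K U)%:R :> R by [].
  have b2 : 0 <= (bdry S U)%:R :> R by [].
  by split; nra.
have hVl : h V <= l * v.
  apply: (le_trans hV); apply: (le_trans (ler_wpM2l _ hK)) => //.
  by rewrite mulrCA /l -mulrA ler_wpM2l// ler_pdivlMl// mulrA.
have hUVW : h U <= h V + h (U `\` V)%fset.
  by rewrite -{1}(fsetIidPr VU) -{1}(fsetID V U).
have cW : #|` (U `\` V)%fset|%:R = u - v by rewrite cardfsD (fsetIidPr VU) natrB// fsubset_leq_card.
have vu : v <= u by rewrite ler_nat fsubset_leq_card.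
have [small|big] := leP (u - v) (e * u).
  have : h (U `\` V)%fset <= M * (e * u) by rewrite (le_trans (hM _))// cW ler_wpM2l.
  move=> hW; have v0 : 0 <= v by rewrite /v.
  suff : h U <= (l + M * e) * u.
    by move=> /le_trans; apply; rewrite ler_wpM2r// le_max lexx.
  nra.
have : h (U `\` V)%fset <= q * (u - v).
  rewrite -cW; apply: bq; rewrite cW.
  have : (bdry S (U `\` V)%fset)%:R <= (bdry S U)%:R + (bdry S V)%:R :> R.
    by rewrite -natrD ler_nat bdryD.
  have : (bdry S V)%:R <= k%:R * (bdry S K)%:R :> R by rewrite -natrM ler_nat.
  have : k%:R * (bdry S K)%:R <= e * d / 2 * v.
    apply: (le_trans (ler_wpM2l _ bK)) => //.
    have : 0 <= e * d / 2 by rewrite divr_ge0// mulr_ge0// ltW.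
    move=> ed; have := ler_wpM2l ed kV; nra.
  have : 0 < e * d by exact: mulr_gt0.
  nra.
move=> hW; suff : h U <= (q - (q - l) * (e / 2)) * u.
  by move=> /le_trans; apply; rewrite ler_wpM2r// le_max lexx orbT.
have : e / 2 * u <= v by nra.
have : 0 <= q - l by rewrite subr_ge0.
nra.
Qed.

(** One scale of tiles is enough: were the infimum of all bounds above l + M e, a bound close to it
    would be pushed below it by a single application of [folner_bound_step]. *)
Lemma folner_bound_gt (l0 q : R) : 0 <= l0 -> l0 < q ->
  (forall S (b : R), 0 < b -> exists K, [/\ K != fset0, h K <= l0 * #|` K|%:R &
     (bdry S K)%:R <= b * #|` K|%:R]) ->
  folner_bound q.
Proof.
move=> l00 l0q HK; have [M M0 hM] := bounded_by_card.
have E0 q' : folner_bound q' -> 0 <= q'.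
  move=> [S [d [d0 Sd]]]; have [K [K0 _ bK]] := HK S d d0.
  have := le_trans (h_ge0 K) (Sd _ bK).
  by rewrite pmulr_lge0// ltr0n cardfs_gt0.
have [e [e0 e1 eq]] : exists e, [/\ 0 < e, e < 1 & l0 / (1 - e) + M * e < q].
  (* For e <= 1/2 one has 1 / (1 - e) <= 1 + 2 e, so l0 / (1 - e) + M e exceeds l0 by at most (2 l0
     + M) e, and this is below e D <= q - l0. *)
  pose D := 2 * (2 * l0 + M + 1).
  have D0 : 0 < D by rewrite /D; nra.
  pose e := Num.min 2^-1 ((q - l0) / D).
  have e0 : 0 < e by rewrite lt_min invr_gt0 ltr0n divr_gt0// subr_gt0.
  have e2 : e <= 2^-1 by rewrite ge_min lexx.
  have eD : e * D <= q - l0 by rewrite -ler_pdivlMr// ge_min lexx orbT.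
  exists e; split => //; first by lra.
  have : l0 / (1 - e) <= l0 * (1 + 2 * e).
    have : 0 <= l0 * (e * (1 - 2 * e)) by rewrite !mulr_ge0 ?(ltW e0)//; lra.
    by rewrite ler_pdivrMr ?subr_gt0; lra.
  rewrite /D in eD; nra.
set l := l0 / (1 - e) in eq.
have l_ge0 : 0 <= l by rewrite divr_ge0// subr_ge0 ltW.
pose E := [set q' | folner_bound q'].
have EM : E M by exists [::], 1; split.
have hi : has_inf E by split; [exists M|exists 0 => q' /E0].
have infE : inf E <= l + M * e.
  rewrite leNgt; apply/negP => lt.
  have Me : 0 <= M * e by rewrite mulr_ge0// ltW.
  have eta : 0 < (inf E - l) * (e / 2) by rewrite mulr_gt0 ?divr_gt0// subr_gt0; lra.
  have [q' Eq' q'lt] := inf_adherent eta hi.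
  have q'ge : inf E <= q' by apply: ge_inf => //; exact: hi.2.
  case: Eq' => S [d [d0 Sd]].
  have [K [K0 hK bK]] := HK S (e * d * (1 - e) / 2)
    ltac:(by rewrite divr_gt0// !mulr_gt0// subr_gt0).
  have lq' : l0 / (1 - e) <= q' by rewrite -/l; lra.
  have := folner_bound_step K0 l00 hK hM M0 e0 e1 d0 bK Sd lq'.
  rewrite -/l => /(ge_inf hi.2); rewrite le_max => /orP[]; nra.
have qE : 0 < q - inf E by rewrite subr_gt0; lra.
have [q' [S [d [d0 Sd]]] q'lt] := inf_adherent qE hi.
exists S, d; split=> // U /Sd /le_trans; apply.
rewrite ler_wpM2r//; lra.
Qed.

Theorem ornstein_weiss (F : nat -> {fset G}) : folner R F ->
  cvgn (fun n => h (F n) / #|` F n|%:R).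
Proof.
move=> FF; have [M M0 hM] := bounded_by_card.
have Fpos n : 0 < #|` F n|%:R :> R by rewrite ltr0n cardfs_gt0; exact: FF.1.
pose u n := h (F n) / #|` F n|%:R.
(* If the ratios return at most to l infinitely often, those F n are tiles as invariant as desired,
   and they control every sufficiently invariant set. *)
have key l q : l < q -> ~ (\forall n \near \oo, l < u n) -> \forall n \near \oo, u n <= q.
  move=> lq nl.
  have freq P : (\forall n \near \oo, P n) -> exists n, P n /\ u n <= l.
    move=> nP; apply: contrapT => /forallNP H; apply: nl.
    apply: filterS nP => n Pn; rewrite ltNge; apply/negP => ul.
    by apply: (H n).
  have l0 : 0 <= l.
    have [n [_]] := freq xpredT (nearW _ (fun=> isT)).
    by apply: le_trans; rewrite divr_ge0.
  have [S [d [d0 Sd]]] : folner_bound q.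
    apply: (folner_bound_gt l0 lq) => S b b0.
    have [n [bn un]] := freq _ (folner_bdry S FF b0).
    exists (F n); split=> //; first exact: FF.1.
    by rewrite -ler_pdivrMr.
  apply: filterS (folner_bdry S FF d0) => n /Sd.
  by rewrite /u ler_pdivrMr.
pose E := [set q | \forall n \near \oo, u n <= q].
have EM : E M by apply: nearW => n; rewrite /u ler_pdivrMr.
have hi : has_inf E.
  split; first by exists M.
  exists 0 => q [N _ /(_ N (leqnn _))]; apply: le_trans.
  by rewrite divr_ge0.
apply/cvg_ex; exists (inf E); apply/cvgrPdist_le => e e0.
have up : \forall n \near \oo, u n <= inf E + e.
  have [q Eq qlt] := inf_adherent e0 hi.
  by apply: filterS Eq => n /le_trans; apply; exact: ltW.
have lo : \forall n \near \oo, inf E - e < u n.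
  apply: contrapT => H.
  have /(key _ (inf E - e / 2))/(_ H) : inf E - e < inf E - e / 2 by lra.
  by move=> /(ge_inf hi.2); lra.
apply: filterS2 up lo => n; rewrite -/(u n) ler_distl => *; lra.
Qed.
End OrnsteinWeiss.

(** * Lebesgue's covering theorem for the cube *)

Section Sperner.
Local Open Scope nat_scope.

(** If c is onto, the only door is opposite the vertex coloured d. If d alone is missing, one colour
    occurs twice and the doors are opposite its two vertices. Otherwise a colour below d is missing
    and there is no door. *)
Lemma odd_card_doors d (c : 'I_d.+1 -> 'I_d.+1) :
  odd #|[set i | [forall m : 'I_d.+1, (m < d) ==> [exists i', (i' != i) && (c i' == m)]]]%SET|
  = `[< forall m, exists i, c i = m >].
Proof.
set A := [set i | _]%SET.
have inA i : (i \in A) = [forall m : 'I_d.+1, (m < d) ==> [exists i', (i' != i) && (c i' == m)]].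
  by rewrite inE.
have [sur|/existsNP[m0 /forallNP nm0]] := pselect (forall m, exists i, c i = m);
  last first.
  rewrite asboolF; last by move=> /(_ m0)[i ci]; exact: (nm0 i).
  have [->|/set0Pn[i0 i0A]] := eqVneq A finset.set0; first by rewrite cards0.
  have m0d : m0 = ord_max.
    apply/val_inj/eqP; rewrite eqn_leq -ltnS ltn_ord/= leqNgt.
    apply/negP => m0d; move: i0A; rewrite inA => /forallP/(_ m0).
    rewrite m0d/= => /existsP[i' /andP[_ ci']].
    by have /eqP := ci'; exact: nm0.
  have cd i : c i < d.
    rewrite ltn_neqAle -ltnS ltn_ord andbT.
    by apply/negP => /eqP h; apply: (nm0 i); apply/val_inj; rewrite m0d; exact: h.
  have cinj : {in [set~ i0]%SET &, injective c}.
    apply/imset_injP; rewrite cardsC1 card_ord/=.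
    rewrite eqn_leq; apply/andP; split.
      by rewrite (leq_trans (leq_imset_card _ _))// cardsC1 card_ord.
    have cA : #|[set m : 'I_d.+1 | m < d]%SET| = d.
      transitivity #|[set~ (ord_max : 'I_d.+1)]%SET|; last by rewrite cardsC1 card_ord.
      apply: eq_card => m; rewrite !inE -(inj_eq val_inj)/= ltn_neqAle -ltnS ltn_ord andbT.
      by [].
    rewrite -[X in X <= _]cA.
    apply: subset_leq_card; apply/fintype.subsetP => m; rewrite inE => md.
    move: i0A; rewrite inA => /forallP/(_ m); rewrite md/=.
    move=> /existsP[i' /andP[ii' /eqP <-]].
    by apply: imset_f; rewrite !inE.
  move: (i0A); rewrite inA => /forallP/(_ (c i0)); rewrite cd/=.
  move=> /existsP[i1 /andP[i10 /eqP ci1]].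
  suff -> : A = [set i0; i1]%SET by rewrite cards2 eq_sym i10.
  apply/setP => i; rewrite !inE; apply/idP/orP.
    rewrite -inA inA => /forallP/(_ (c i)); rewrite cd/= => /existsP[i' /andP[ii' /eqP ci']].
    have [->|ni0] := eqVneq i i0; [by left|right].
    have [i'0|ni'0] := eqVneq i' i0.
      by apply/eqP/cinj; rewrite ?inE// -ci' i'0 ci1.
    by move: ii'; rewrite (cinj _ _ _ _ ci') ?inE// eqxx.
  case=> /eqP ->; first by rewrite -inA.
  apply/forallP => m; apply/implyP => md.
  move: i0A; rewrite inA => /forallP/(_ m); rewrite md/= => /existsP[i' /andP[i'0 /eqP ci']].
  have [i'1|ni'1] := eqVneq i' i1; apply/existsP.
    by exists i0; rewrite eq_sym i10 -ci1 -i'1 ci' eqxx.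
  by exists i'; rewrite ni'1 ci' eqxx.
rewrite asboolT//.
have cinj : injective c.
  apply/injectiveP/negPn/negP => /injectivePn[x [y xy cxy]].
  have : #|c @: [set~ x]%SET| <= d by rewrite (leq_trans (leq_imset_card _ _))// cardsC1 card_ord.
  suff -> : (c @: [set~ x])%SET = [set: 'I_d.+1]%SET by rewrite cardsT card_ord ltnn.
  apply/setP => m; rewrite inE; apply/imsetP.
  have [z <-] := sur m.
  have [->|zx] := eqVneq z x; first by exists y; rewrite ?inE// eq_sym.
  by exists z; rewrite ?inE.
have [i0 ci0] := sur ord_max.
suff -> : A = [set i0]%SET by rewrite cards1.
apply/setP => i; rewrite inA inE; apply/forallP/eqP => [H|-> m].
  apply/eqP; apply: contraT => ii0.
  have cid : c i < d.
    rewrite ltn_neqAle -ltnS ltn_ord andbT.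
    by apply: contra ii0 => /eqP h; apply/eqP/cinj/val_inj; rewrite ci0; exact: h.
  have := H (c i); rewrite cid/= => /existsP[i' /andP[i'i /eqP /cinj h]].
  by rewrite h eqxx in i'i.
apply/implyP => md; have [k ck] := sur m.
apply/existsP; exists k; rewrite ck eqxx andbT.
by apply: contraTneq md => ki0; rewrite -ck ki0 ci0 ltnn.
Qed.


Lemma card_even_swap (T : finType) (A : {set T}) (f : T -> T) (chi : pred T) :
  involutive f -> (forall x, x \in A -> f x \in A) ->
  (forall x, chi (f x) = ~~ chi x) -> ~~ odd #|A|.
Proof.
move=> ff fA fchi; rewrite -(cardsID [set x | chi x]%SET A).
suff -> : #|A :\: [set x | chi x]%SET| = #|A :&: [set x | chi x]%SET| by rewrite oddD addbb.
rewrite -(card_imset _ (can_inj ff)); apply: eq_card => x; rewrite !inE.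
apply/imsetP/idP => [[y]|/andP[xA cx]].
  by rewrite !inE => /andP[cy yA] ->; rewrite fA//= fchi.
by exists (f x); rewrite ?ff// !inE fA// fchi cx.
Qed.

Lemma odd_sum_eq (T : finType) (f g : T -> nat) : (forall x, odd (f x) = odd (g x)) ->
  odd (\sum_x f x) = odd (\sum_x g x).
Proof.
move=> fg; apply: (big_ind2 (fun x y => odd x = odd y)) => //.
by move=> x x' y y' h h'; rewrite !oddD h h'.
Qed.

Section Kuhn.
Variables (N n' : nat) (lab : {ffun 'I_N -> nat} -> nat).
Local Notation n := n'.+1.
Hypothesis lab0 : forall (x : {ffun _ -> nat}) k, x k = 0 -> lab x <= k.
Hypothesis labn : forall (x : {ffun _ -> nat}) k, x k = n -> lab x <> k.
Hypothesis labN : forall x, lab x <= N.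

(* The pair (v, rho) encodes the Kuhn simplex with lowest vertex v whose
   vertices are obtained by raising the coordinates in the order given by rho. *)
Local Notation simplex := ({ffun 'I_N -> 'I_n} * 'S_N)%type.
Implicit Types p q : simplex.

Definition kvertex p i : {ffun 'I_N -> nat} := [ffun k => p.1 k + (p.2 k < i)].

(** The d-simplices of the face where the coordinates from d on vanish share the type of all
    simplices; freezing the order of the remaining coordinates makes their encoding unique, with
    vertices 0, ..., d. *)
Definition in_face d p := forall k : 'I_N, d <= k -> p.1 k = 0 :> nat /\ p.2 k = k.

Definition all_labels d (I : nat -> Prop) p :=
  forall m, m < d -> exists2 i, I i & lab (kvertex p i) = m.

Definition full_simplex d p := in_face d p /\ all_labels d.+1 (fun i => i <= d) p.

(** The facet opposite vertex i of a (d + 1)-simplex, seen from that simplex; the induction on d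
    counts these doors in two ways. *)
Definition door d i p :=
  in_face d.+1 p /\ all_labels d.+1 (fun j => j <= d.+1 /\ j <> i) p.

Local Notation count_simplex P := (#|[set p : simplex | `[< P p >]]%SET|).

Lemma lab_face d p i : d <= N -> in_face d p -> i <= d -> lab (kvertex p i) <= d.
Proof.
move=> dN pd id; have [dN'|Nd] := ltnP d N; last first.
  by rewrite (leq_trans (labN _)).
apply: (@lab0 _ (Ordinal dN')); rewrite ffunE/=.
have [-> ->] := pd (Ordinal dN') (leqnn _).
by rewrite /= ltnNge id.
Qed.

Lemma odd_doors d : d < N ->
  odd (\sum_(i < d.+2) count_simplex (door d i)) = odd (count_simplex (full_simplex d.+1)).
Proof.
move=> dN.
under eq_bigr => i _ do rewrite -sum1dep_card big_mkcond/=.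
rewrite exchange_big/= -[in RHS]sum1dep_card [in RHS]big_mkcond/=.
apply: odd_sum_eq => p.
have [fp|nfp] := pselect (in_face d.+1 p); last first.
  rewrite (asboolF (P := full_simplex _ _)); last by case.
  by rewrite big1// => i _; rewrite asboolF//; case.
pose c (i : 'I_d.+2) : 'I_d.+2 := inord (lab (kvertex p i)).
have cE i : c i = lab (kvertex p i) :> nat.
  by rewrite inordK// ltnS lab_face// -ltnS.
have -> : \sum_(i < d.+2) (if `[< door d i p >] then 1 else 0) =
  #|[set i | [forall m : 'I_d.+2, (m < d.+1) ==> [exists i', (i' != i) && (c i' == m)]]]%SET|.
  rewrite -sum1dep_card [RHS]big_mkcond; apply: eq_bigr => i _.
  congr (if _ then _ else _); apply/asboolP/forallP => [[_ h] m|h].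
    apply/implyP => /h[i' [i'd ii'] li'].
    apply/existsP; exists (Ordinal (i'd : i' < d.+2)).
    rewrite -!(inj_eq val_inj)/= cE/= li' eqxx andbT; exact/eqP.
  split=> // m md; have := h (Ordinal (leqW md)); rewrite /= md/=.
  move=> /existsP[i' /andP[ii' /eqP ci']]; exists i'; last by rewrite -cE ci'.
  by split; [rewrite -ltnS|move=> /val_inj/eqP; exact/negP].
rewrite odd_card_doors.
have -> : `[< full_simplex d.+1 p >] = `[< forall m, exists i, c i = m >]; last by case: asboolP.
apply: asbool_equiv_eq; split=> [[_ h] m|h].
  have [i id li] := h m (ltn_ord m); exists (Ordinal (id : i < d.+2)).
  by apply/val_inj => /=; rewrite cE.
split=> // m md; have [i ci] := h (Ordinal md).
by exists i; [rewrite -ltnS|rewrite -cE ci].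
Qed.

(** Exchanging the coordinates raised in places i - 1 and i moves vertex i only, so these doors come
    in pairs; the relative order of the two coordinates tells the partners apart. *)
Lemma even_inner_doors d i : d < N -> 0 < i -> i <= d -> ~~ odd (count_simplex (door d i)).
Proof.
move=> dN i0 id.
have aN : i.-1 < N by rewrite (leq_ltn_trans _ dN)// (leq_trans (leq_pred _)).
pose a := Ordinal aN; pose b := Ordinal (leq_ltn_trans id dN).
pose f p : simplex := (p.1, (p.2 * tperm a b)%g).
apply: (@card_even_swap _ _ f (fun p => (p.2^-1)%g a < (p.2^-1)%g b)).
- by move=> [v r]; rewrite /f/= -mulgA tperm2 mulg1.
- move=> p; rewrite !inE => -[fp h]; split.
    move=> k dk; have [h1 h2] := fp k dk; split=> //=.
    rewrite permM h2 tpermD//; apply/negP => /eqP h3; move: dk; rewrite -h3/=; lia.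
  move=> m md; have [j [jd ji] lj] := h m md; exists j => //.
  rewrite -lj; congr lab; apply/ffunP => k; rewrite !ffunE/= permM.
  by congr (_ + nat_of_bool _); case: tpermP => [->|->|]//=; lia.
- move=> p /=; rewrite !invMg tpermV !permM tpermL tpermR -leqNgt.
  rewrite ltn_neqAle (inj_eq val_inj) (inj_eq perm_inj).
  suff -> : b != a by [].
  by rewrite -(inj_eq val_inj)/=; lia.
Qed.

(** The facet opposite vertex 0 is also the facet opposite the last vertex of the neighbour obtained
    by raising the first coordinate and putting it last in the order. Doors matched in this way
    cancel modulo 2; the unmatched ones turn out to be the full simplices of the face one dimension
    lower. *)
Lemma odd_outer_doors d : d < N ->
  odd (count_simplex (door d 0) + count_simplex (door d d.+1)) =
  odd (count_simplex (full_simplex d)).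
Proof.
move=> dN; pose a := Ordinal dN; pose z : 'I_N := Ordinal (leq_ltn_trans (leq0n d) dN).
pose rotf (x : 'I_N) := insubd a (if x == 0 :> nat then d else if x <= d then x.-1 else x).
have rotE x : rotf x = (if x == 0 :> nat then d else if x <= d then x.-1 else x) :> nat.
  by rewrite val_insubd ifT//; have := ltn_ord x; do !case: ifP => ?; lia.
have rot_inj : injective rotf.
  move=> x y /(congr1 val)/=; rewrite !rotE => h; apply/val_inj => /=; move: h.
  by do !case: ifP => ?; lia.
pose rot := perm rot_inj.
have rotP x : rot x = (if x == 0 :> nat then d else if x <= d then x.-1 else x) :> nat.
  by rewrite permE rotE.
have rotz : rot z = a by apply/val_inj; rewrite /= rotP.
have rotV (k : 'I_N) : d < k -> (rot^-1)%g k = k.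
  move=> dk; apply: (@perm_inj _ rot); rewrite permKV; apply/val_inj => /=.
  by rewrite rotP; do !case: ifP => ?; lia.
pose f p : simplex := ([ffun k => inord (p.1 k + (p.2 k == z))], (p.2 * rot)%g).
pose g p : simplex := ([ffun k => inord (p.1 k - (p.2 k == a))], (p.2 * rot^-1)%g).
pose room p := forall k, p.2 k = z -> p.1 k < n'.
have f1 p k : room p -> (f p).1 k = p.1 k + (p.2 k == z) :> nat.
  move=> rp; rewrite ffunE inordK//; case: eqP => [/rp|]; first lia.
  by rewrite addn0.
have g1 p k : (g p).1 k = p.1 k - (p.2 k == a) :> nat.
  by rewrite ffunE inordK// (leq_ltn_trans (leq_subr _ _)).
have f_face p : room p -> in_face d.+1 p -> in_face d.+1 (f p).
  move=> rp fp k dk; have [h1 h2] := fp k dk; rewrite f1// h1 h2; split.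
    by case: eqP dk => // ->.
  by rewrite /f/= permM h2; apply/val_inj; rewrite /= rotP; do !case: ifP => ?; lia.
have fv p j : room p -> j <= d -> kvertex (f p) j = kvertex p j.+1.
  move=> rp jd; apply/ffunP => k; rewrite [LHS]ffunE [RHS]ffunE f1// /= permM rotP -addnA.
  congr (_ + _); rewrite -(inj_eq val_inj)/=.
  by do !case: ifP => ?; lia.
have fdoor p : room p -> in_face d.+1 p -> door d 0 p <-> door d d.+1 (f p).
  move=> rp fp; split=> -[_ h]; split; do ?[exact: f_face|exact: fp].
    move=> m md; have [[|j] [jd jn] lj] := h m md; first by case: jn.
    by exists j; [split; lia|rewrite fv].
  move=> m md; have [j [jd jn] lj] := h m md.
  have jd' : j <= d by lia.
  by exists j.+1; rewrite -?fv.
(* A neighbour leaving the grid would put the facet on x_k = n, where label k is forbidden although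
   the door requires it. *)
have door_room p : door d 0 p -> room p.
  move=> [fp h] k kz; rewrite ltn_neqAle -ltnS ltn_ord andbT; apply/eqP => vk.
  have kd : k < d.+1.
    rewrite ltnNge; apply/negP => dk; have [_] := fp k dk.
    by rewrite kz => /(congr1 val)/=; lia.
  have [[|j] [_ jn] lj] := h k kd; first by case: jn.
  apply: (@labn (kvertex p j.+1) k) => //; rewrite ffunE kz/= vk; lia.
have g2 q k : ((g q).2 k == z) = (q.2 k == a).
  by rewrite /= permM -(inj_eq (@perm_inj _ rot)) permKV rotz.
have groom q : (forall k, q.2 k = a -> 0 < q.1 k) -> room (g q).
  move=> qa k /eqP; rewrite g2 => /eqP qk; rewrite g1 qk eqxx.
  by have := qa k qk; have := ltn_ord (q.1 k); lia.
have fg q : (forall k, q.2 k = a -> 0 < q.1 k) -> f (g q) = q.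
  move=> qa; rewrite [LHS]surjective_pairing [RHS]surjective_pairing; congr pair.
    apply/ffunP => k; apply/val_inj => /=; rewrite -[LHS]/(nat_of_ord ((f (g q)).1 k)).
    rewrite f1; last exact: groom.
    rewrite g1 g2; case: eqP => [/qa|]; lia.
  by rewrite /= -mulgA mulVg mulg1.
have cardE : count_simplex (door d 0) =
    #|[set p | `[< door d d.+1 p >] & 0 < p.1 ((p.2^-1)%g a)]%SET|.
  rewrite -(@card_in_imset _ _ f); last first.
    move=> p q; rewrite !inE => /door_room rp /door_room rq fpq.
    have r2 : p.2 = q.2 by have := congr1 snd fpq; rewrite /= => /mulIg.
    case: p q rp rq fpq r2 => v r [v' r'] rp rq fpq /= r2; rewrite r2 in rp fpq *.
    congr pair; apply/ffunP => k; apply/val_inj => /=.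
    have := congr1 (fun p : simplex => nat_of_ord (p.1 k)) fpq.
    by rewrite (f1 _ _ rp) (f1 _ _ rq)/= => /addIn.
  apply: eq_card => q; rewrite !inE; apply/imsetP/andP => [[p]|[/asboolP qd q0]].
    rewrite inE => /asboolP dp -> {q}; have rp := door_room _ dp.
    split; first by apply/asboolP/(fdoor _ rp dp.1).
    rewrite f1//= invMg permM -[a]rotz permK permKV eqxx; lia.
  have gq : forall k, q.2 k = a -> 0 < q.1 k.
    by move=> k qk; move: q0; rewrite -qk permK.
  exists (g q); last by rewrite fg.
  have rg := groom q gq.
  rewrite inE; apply/asboolP/fdoor => //; last by rewrite fg.
  move=> k dk; have [h1 h2] := qd.1 k dk; rewrite g1 h1; split=> //.
  by rewrite /= permM h2 rotV.
rewrite cardE.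
rewrite -(cardsID [set p : simplex | 0 < p.1 ((p.2^-1)%g a)]%SET [set p : simplex| `[< door d d.+1 p >]]%SET).
have -> : [set p : simplex | `[< door d d.+1 p >]]%SET :&: [set p : simplex| 0 < p.1 ((p.2^-1)%g a)]%SET
   = [set p | `[< door d d.+1 p >] & 0 < p.1 ((p.2^-1)%g a)]%SET.
  by apply/setP => p; rewrite !inE.
rewrite addnA oddD addnn odd_double addFb; congr odd; apply: eq_card => p.
rewrite !inE -eqn0Ngt; apply/andP/asboolP => [[/eqP p0 /asboolP[fp h]]|[fp h]].
  have pa : p.2 ((p.2^-1)%g a) = a by rewrite permKV.
  set k := (p.2^-1)%g a in p0 pa.
  (* Coordinate k vanishes on the whole facet, so its labels are at most k; as label d occurs, d <=
     k, and k can only be d. *)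
  have [j [jd jn] lj] := h d (ltnSn d).
  have jd' : j <= d by lia.
  have dk : d <= k by rewrite -lj; apply: lab0; rewrite ffunE p0 pa/=; lia.
  have kd : k = a.
    apply/val_inj/eqP; rewrite eqn_leq dk andbT -ltnS ltnNge; apply/negP => dk'.
    by have [_] := fp k dk'; rewrite pa => ak; move: dk'; rewrite -ak/= ltnn.
  split; last by move=> m /h[i [id ii] li]; exists i => //; lia.
  move=> l; rewrite leq_eqVlt => /orP[/eqP dl|/fp//].
  have -> : l = k by rewrite kd; apply/val_inj.
  by rewrite p0 pa kd.
have [p1 p2] := fp a (leqnn _).
have pa : (p.2^-1)%g a = a by rewrite -{1}p2 permK.
split; first by rewrite pa p1.
apply/asboolP; split; first by move=> k /ltnW/fp.
by move=> m /h[i id li]; exists i => //; lia.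
Qed.

Lemma odd_full d : d <= N -> odd (count_simplex (full_simplex d)).
Proof.
elim: d => [_|d IH dN].
  suff -> : [set p | `[< full_simplex 0 p >]]%SET = [set ([ffun=> ord0], 1%g) : simplex]%SET.
    by rewrite cards1.
  apply/setP => -[v r]; rewrite !inE; apply/asboolP/eqP => [[fp _]|[-> ->]].
    congr pair; last by apply/permP => k; rewrite perm1; have [] := fp k isT.
    by apply/ffunP => k; rewrite ffunE; apply/val_inj; have [] := fp k isT.
  split; first by move=> k _; rewrite ffunE perm1.
  move=> [|//] _; exists 0 => //; apply/eqP; rewrite -leqn0.
  apply: (@lab_face 0) => //.
  by move=> k _; rewrite ffunE perm1.
rewrite -odd_doors// big_ord_recl big_ord_recr/= addnCA oddD.
rewrite odd_outer_doors// IH ?(ltnW dN)// addbT.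
elim/big_ind : _ => // [x y|i _]; first by rewrite oddD => /negbTE -> /negbTE ->.
by apply: even_inner_doors => //; rewrite /bump/=; have := ltn_ord i; lia.
Qed.

Lemma kuhn_sperner : exists p : simplex,
  forall m, m <= N -> exists2 i, i <= N & lab (kvertex p i) = m.
Proof.
have : 0 < count_simplex (full_simplex N) by rewrite odd_gt0// odd_full.
rewrite card_gt0 => /set0Pn[p]; rewrite inE => /asboolP[_ h].
by exists p => m mN; have [i] := h m mN; exists i.
Qed.
End Kuhn.
End Sperner.

Section LebesgueCovering.
Context (R : realType) (N : nat).
Implicit Types t : 'rV[R]_N.

Definition in_cube t := forall k, 0 <= t ord0 k <= 1.

Lemma compact_cube : compact [set t | in_cube t].
Proof.
have := @rV_compact R N (fun=> [set x : R | 0 <= x <= 1]).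
apply=> _; rewrite (_ : [set x | _] = `[0, 1]%classic); first exact: segment_compact.
by apply/seteqP; split=> x /=; rewrite in_itv.
Qed.

Lemma cube_lebesgue_number (I : finType) (U : I -> set 'rV[R]_N) :
  (forall i, open (U i)) -> (forall t, in_cube t -> exists i, U i t) ->
  exists n : nat, forall t, in_cube t -> exists i, ball t n.+1%:R^-1 `<=` U i.
Proof.
move=> oU cU.
have nc := (compact_near_coveringP [set t | in_cube t]).1 compact_cube.
have H : forall t, in_cube t -> \forall t' \near t & n \near \oo,
    exists i, ball t' n.+1%:R^-1 `<=` U i.
  move=> t /cU[i Uit].
  have /nbhs_ballP[e /= e0 be] : nbhs t (U i) by exact: open_nbhs_nbhs.
  have e20 : 0 < e / 2 by rewrite divr_gt0.
  exists (ball t (e / 2), [set n | n.+1%:R^-1 < e / 2]); first split => /=.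
  - exact: nbhsx_ballx.
  - exact: (near_infty_natSinv_lt (PosNum e20)).
  move=> [t' n] [/= tt' nn]; exists i => s ts; apply: be.
  rewrite [e]splitr; apply: (ball_triangle tt').
  by apply: le_ball ts; exact: ltW.
have [n _ /(_ n (leqnn n)) h] := nc _ _ _ _ H.
by exists n => t /h.
Qed.

(** Each grid point is labelled by the group of a cover member that contains a whole ball around it;
    the condition on opposite faces yields the boundary condition on labels. A vertex of a fully
    labelled simplex lies in all the members chosen at its vertices, and N + 1 of these are in
    different groups. *)
Theorem lebesgue_covering (I : finType) (U : I -> set 'rV[R]_N) :
  (forall i, open (U i)) -> (forall t, in_cube t -> exists i, U i t) ->
  (forall i k t t', in_cube t -> in_cube t' -> U i t -> U i t' ->
     t ord0 k = 0 -> t' ord0 k = 1 -> False) ->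
  exists2 t, in_cube t & (N < #|[pred i | `[< U i t >]]|)%N.
Proof.
move=> oU cU sep.
have [n hn] := cube_lebesgue_number oU cU.
(* The mesh 1 / (n + 2) is below the Lebesgue number 1 / (n + 1). Capping at n + 2 keeps [pt] inside
   the cube for every integer point. *)
pose M : R := n.+2%:R.
have M0 : 0 < M by [].
pose pt (x : {ffun 'I_N -> nat}) : 'rV[R]_N := \row_k ((minn (x k) n.+2)%:R / M).
have pt_cube x : in_cube (pt x).
  move=> k; rewrite mxE divr_ge0//= ler_pdivrMr// mul1r ler_nat; exact: geq_minr.
have [c hc] := choice (fun x => hn _ (pt_cube x)).
have Uc x : U (c x) (pt x) by apply: hc; exact: ballxx.
(* The cover is grouped into N + 1 families: the k-th one consists of the
   members that meet the face t_k = 0 but no face t_l = 0 with l < k. *)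
pose meets i (k : 'I_N) := `[< exists t, [/\ in_cube t, U i t & t ord0 k = 0] >].
pose grp i := find (meets i) (enum 'I_N).
have grp_lt i (k : 'I_N) : grp i = k -> meets i k.
  move=> gk; have : has (meets i) (enum 'I_N) by rewrite has_find -/(grp i) gk size_enum_ord.
  move=> /(nth_find k); rewrite -/(grp i) gk; congr (meets i _).
  by apply/val_inj; rewrite /= nth_enum_ord.
have grp_le i (k : 'I_N) : meets i k -> (grp i <= k)%N.
  move=> mk; rewrite leqNgt; apply/negP => /(before_find k).
  by rewrite (_ : nth _ _ _ = k) ?mk//; apply/val_inj; rewrite /= nth_enum_ord.
have [] := @kuhn_sperner N n.+1 (fun x => grp (c x)).
- move=> x k xk; apply: grp_le; apply/asboolP; exists (pt x); split=> //.
  by rewrite mxE xk min0n mul0r.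
- move=> x k xk /grp_lt/asboolP[t [bt Ut t0]].
  apply: (sep _ k _ _ bt (pt_cube x) Ut (Uc x) t0).
  by rewrite mxE xk minnn divff// gt_eqF.
- by move=> x; rewrite /grp -[X in (_ <= X)%N](size_enum_ord N); exact: find_size.
move=> p hp; exists (pt (kvertex p 0)); first exact: pt_cube.
have /choice[j hj] : forall m : 'I_N.+1, exists i, grp (c (kvertex p i)) = m.
  by move=> m; have [i _ ?] := hp m (ltn_ord m); exists i.
have jinj : injective (fun m => c (kvertex p (j m))).
  by move=> m m' /(congr1 grp); rewrite !hj => /val_inj.
rewrite -[N.+1]card_ord -(card_codom jinj).
apply: subset_leq_card; apply/fintype.subsetP => i /codomP[m ->].
rewrite -topredE/=; apply/asboolP; apply: (hc _ (pt (kvertex p 0))).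
split=> [|r k]; first by rewrite invr_gt0.
rewrite /ball/= !mxE !ffunE ltn0 addn0 -mulrBl normrM.
rewrite (@ger0_norm _ M^-1) ?invr_ge0 ?(ltW M0)// ltr_pdivrMr//.
apply: (@le_lt_trans _ _ 1); last first.
  by rewrite ltr_pdivlMl// mulr1 ltr_nat.
rewrite ler_norml; set b := (_ < _)%N.
have : (minn (p.1 k + b) n.+2 <= minn (p.1 k) n.+2 + 1)%N by case: b; lia.
have : (minn (p.1 k) n.+2 <= minn (p.1 k + b) n.+2)%N by case: b; lia.
rewrite -(ler_nat R) => h1; rewrite -(ler_nat R) natrD => h2.
by apply/andP; split; lra.
Qed.
End LebesgueCovering.

(** * Positive functionals and Borel probability measures *)

Section Expectation.
Context (R : realType) (X : pmetricType R).
Hypothesis cX : compact [set: X].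
Implicit Types (mu : probability (borel X) R) (f g : X -> R).

Definition expect mu f : R := (\int[mu]_x (f : borel X -> R) x)%R.

Lemma continuous_borel_measurable f : continuous f ->
  measurable_fun [set: borel X] (f : borel X -> R).
Proof.
move=> cf; apply: (measurability _ (RGenOpens.measurableE R)) => //.
move=> _ [_ [u [v ->] <-]]; rewrite setTI; apply: sub_sigma_algebra.
by move/continuousP: cf; apply; exact: interval_open.
Qed.

Lemma continuous_bounded f : continuous f -> exists M, forall x, `|f x| <= M.
Proof.
move=> cf; have : compact (f @` [set: X]).
  by apply: continuous_compact => //; exact: continuous_subspaceT.
move=> /compact_bounded[M [_ h]]; exists (M + 1) => x.
by apply: (h (M + 1)); rewrite ?ltrDl//; exists x.
Qed.

Lemma continuous_integrable mu f : continuous f ->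
  mu.-integrable [set: borel X] (EFin \o (f : borel X -> R)).
Proof.
move=> cf; apply: measurable_bounded_integrable => //.
- exact: le_lt_trans (probability_le1 mu measurableT) (ltry 1).
- exact: continuous_borel_measurable.
have [M h] := continuous_bounded cf.
exists M; split; rewrite ?num_real// => x Mx y _ /=.
exact: le_trans (h y) (ltW Mx).
Qed.

Lemma expectD mu f g : continuous f -> continuous g ->
  expect mu (fun x => f x + g x) = expect mu f + expect mu g.
Proof. by move=> cf cg; rewrite /expect RintegralD//; exact: continuous_integrable. Qed.

Lemma expectZ mu f r : continuous f -> expect mu (fun x => r * f x) = r * expect mu f.
Proof. by move=> cf; rewrite /expect RintegralZl//; exact: continuous_integrable. Qed.

Lemma expect_cst mu r : expect mu (fun=> r) = r.
Proof.
rewrite /expect Rintegral_cst//= (_ : fine _ = 1) ?mulr1//.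
by have := @probability_setT _ _ _ mu; rewrite /= => ->.
Qed.

Lemma expect_le mu f g : continuous f -> continuous g -> (forall x, f x <= g x) ->
  expect mu f <= expect mu g.
Proof. by move=> cf cg fg; apply: le_Rintegral => //; exact: continuous_integrable. Qed.

Record pos_linear (L : (X -> R) -> R) : Prop := PosLinear {
  plD : forall f g, continuous f -> continuous g -> L (fun x => f x + g x) = L f + L g ;
  plZ : forall r f, continuous f -> L (fun x => r * f x) = r * L f ;
  plle : forall f g, continuous f -> continuous g -> (forall x, f x <= g x) -> L f <= L g ;
  pl1 : L (fun=> 1) = 1 }.

Lemma pos_linear_expect mu : pos_linear (expect mu).
Proof.
split.
- exact: expectD.
- by move=> r f; exact: expectZ.
- exact: expect_le.
- exact: expect_cst.
Qed.

Lemma continuous_cst (r : R) : continuous (fun _ : X => r).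
Proof. by move=> x; exact: cvg_cst. Qed.

Lemma continuous_sum (I : Type) (s : seq I) (F : I -> X -> R) :
  (forall i, continuous (F i)) -> continuous (fun x => \sum_(i <- s) F i x).
Proof.
move=> cF; elim: s => [|i s IH].
  by under eq_fun do rewrite big_nil; exact: continuous_cst.
under eq_fun do rewrite big_cons.
by move=> x; apply: cvgD; [exact: cF|exact: IH].
Qed.

Section PosLinearTheory.
Variables (L : (X -> R) -> R) (pL : pos_linear L).

Lemma pl_cst r : L (fun=> r) = r.
Proof.
rewrite -[RHS]mulr1 -(pl1 pL) -(plZ pL)//; last exact: continuous_cst.
by congr L; apply/funext => x; rewrite mulr1.
Qed.

Lemma plB f g : continuous f -> continuous g -> L (fun x => f x - g x) = L f - L g.
Proof.
move=> cf cg; rewrite -mulN1r -(plZ pL)// -(plD pL)//.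
  by congr L; apply/funext => x; rewrite mulN1r.
by move=> x; apply: cvgM; [exact: cvg_cst|exact: cg].
Qed.

Lemma pl_sum (I : Type) (s : seq I) (F : I -> X -> R) :
  (forall i, continuous (F i)) ->
  L (fun x => \sum_(i <- s) F i x) = \sum_(i <- s) L (F i).
Proof.
move=> cF; elim: s => [|i s IH].
  by under eq_fun do rewrite big_nil; rewrite big_nil pl_cst.
under eq_fun do rewrite big_cons; rewrite big_cons (plD pL)// ?IH//.
exact: continuous_sum.
Qed.

End PosLinearTheory.
End Expectation.

Section OpenPositivity.
Context (R : realType) (X : metricType R).

Definition dist_to (C : set X) (x : X) : R := inf [set mdist x y | y in C].

Lemma dist_to_lip (C : set X) x x' : C !=set0 -> dist_to C x <= mdist x x' + dist_to C x'.
Proof.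
move=> [c Cc]; rewrite -lerBlDl; apply: lb_le_inf; first by exists (mdist x' c), c.
move=> _ [y Cy <-]; rewrite lerBlDl.
have hi : has_lbound [set mdist x y | y in C] by exists 0 => _ [z _ <-]; exact: mdist_ge0.
apply: (@le_trans _ _ (mdist x y)); last exact: metric_triangle.
by apply: ge_inf => //; exists y.
Qed.

Lemma open_positivity (U : set X) : open U ->
  exists u : X -> R, [/\ continuous u, forall x, 0 <= u x <= 1 & forall x, U x <-> 0 < u x].
Proof.
move=> oU; have [UT|/existsNP[c Uc]] := pselect (forall x, U x).
  by exists (fun=> 1); split=> //; [move=> x; exact: cvg_cst|rewrite ler01 lexx].
pose C := ~` U; have C0 : C !=set0 by exists c.
have d_ge0 x : 0 <= dist_to C x.
  by apply: lb_le_inf; [exists (mdist x c), c|move=> _ [y _ <-]; exact: mdist_ge0].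
exists (fun x => Num.min 1 (dist_to C x)); split.
- move=> x; apply: continuous_min; first exact: cvg_cst.
  apply/cvgrPdist_lt => e e0; near=> y.
  have xy : mdist x y < e.
    by near: y; have := nbhsx_ballx x e e0; rewrite ballEmdist.
  rewrite ltr_norml; have := dist_to_lip x y C0; have := dist_to_lip y x C0.
  rewrite (metric_sym y x) => *; apply/andP; split; lra.
- by move=> x; rewrite le_min ler01 d_ge0 ge_min lexx.
- move=> x; rewrite lt_min ltr01/=; split => [Ux|].
    have : nbhs x U by exact: open_nbhs_nbhs.
    move=> /nbhs_ballP[e /= e0]; rewrite ballEmdist => be.
    apply: (lt_le_trans e0); apply: lb_le_inf; first by exists (mdist x c), c.
    by move=> _ [y Cy <-]; rewrite leNgt; apply/negP => /be.
  apply: contraPP => Ux; apply/negP; rewrite -leNgt.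
  apply: ge_inf; first by exists 0 => _ [y _ <-]; exact: mdist_ge0.
  by exists x => //; exact: mdistxx.
Unshelve. all: by end_near.
Qed.
End OpenPositivity.

Lemma continuous_minr (R : realType) (T : topologicalType) (f g : T -> R) :
  continuous f -> continuous g -> continuous (fun x => Num.min (f x) (g x)).
Proof. by move=> cf cg x; apply: continuous_min; [exact: cf|exact: cg]. Qed.

Lemma continuous_maxr (R : realType) (T : topologicalType) (f g : T -> R) :
  continuous f -> continuous g -> continuous (fun x => Num.max (f x) (g x)).
Proof. by move=> cf cg x; apply: continuous_max; [exact: cf|exact: cg]. Qed.

Lemma continuous_mulr (R : realType) (T : topologicalType) (f g : T -> R) :
  continuous f -> continuous g -> continuous (fun x => f x * g x).
Proof. by move=> cf cg x; apply: cvgM; [exact: cf|exact: cg]. Qed.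

Lemma continuous_addr (R : realType) (T : topologicalType) (f g : T -> R) :
  continuous f -> continuous g -> continuous (fun x => f x + g x).
Proof. by move=> cf cg x; apply: cvgD; [exact: cf|exact: cg]. Qed.

Lemma continuous_subr (R : realType) (T : topologicalType) (f g : T -> R) :
  continuous f -> continuous g -> continuous (fun x => f x - g x).
Proof. by move=> cf cg x; apply: cvgB; [exact: cf|exact: cg]. Qed.

Lemma continuous_const (R : realType) (T : topologicalType) (r : R) : continuous (fun _ : T => r).
Proof. by move=> x; exact: cvg_cst. Qed.

(** * The Riesz representation theorem on a compact metric space *)

Section Riesz.
Context (R : realType) (X : pmetricType R).
Hypothesis cX : compact [set: X].
Variables (L : (X -> R) -> R) (pL : pos_linear L).
Implicit Types (A B U : set X).

(* Increasing sequences of continuous functions play the role of open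
   neighbourhoods; no regularity of the space is then needed for countable
   subadditivity. *)
Definition dominates (g : nat -> X -> R) (s : R) A :=
  [/\ forall n, continuous (g n), forall n x, 0 <= g n x,
      forall n x, g n x <= g n.+1 x, forall n, L (g n) <= s &
      forall x, A x -> forall e, 0 < e -> exists n, 1 - e < g n x].

Definition omass A : R := inf [set s | exists g, dominates g s A].

Lemma dominates_ge0 g s A : dominates g s A -> 0 <= s.
Proof.
move=> [cg g0 _ gs _]; apply: le_trans (gs 0%N); rewrite -(pl_cst pL 0).
by apply: (plle pL) => //; exact: continuous_cst.
Qed.

Lemma dominates1 A : dominates (fun=> fun=> 1) 1 A.
Proof.
split=> // [n|n|x _ e e0]; first exact: continuous_cst.
  by rewrite (pl1 pL).
by exists 0%N; rewrite ltrBlDr ltrDl.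
Qed.

Lemma dominatesS g s A B : A `<=` B -> dominates g s B -> dominates g s A.
Proof. by move=> AB [? ? ? ? h]; split=> // x /AB; exact: h. Qed.

Lemma has_inf_omass A : has_inf [set s | exists g, dominates g s A].
Proof.
split; first by exists 1, (fun=> fun=> 1); exact: dominates1.
by exists 0 => s [g /dominates_ge0].
Qed.

Lemma omass_le g s A : dominates g s A -> omass A <= s.
Proof. by move=> gA; apply: ge_inf; [exact: (has_inf_omass A).2|exists g]. Qed.

Lemma omass_ge0 A : 0 <= omass A.
Proof. by apply: lb_le_inf; [exact: (has_inf_omass A).1|move=> s [g /dominates_ge0]]. Qed.

Lemma omassS A B : A `<=` B -> omass A <= omass B.
Proof.
move=> AB; apply: lb_le_inf; first exact: (has_inf_omass B).1.
by move=> s [g /(dominatesS AB)/omass_le].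
Qed.

Lemma omass0 : omass set0 = 0.
Proof.
apply/eqP; rewrite eq_le omass_ge0 andbT; apply: (@omass_le (fun=> fun=> 0)).
by split=> // [n|n]; [exact: continuous_cst|rewrite pl_cst].
Qed.

Definition outer A : \bar R := (omass A)%:E.

Lemma dominates_bigcup (g : nat -> nat -> X -> R) (s : nat -> R) (t : R) (A : nat -> set X) :
  (forall k, dominates (g k) (s k) (A k)) ->
  (forall n, \sum_(k < n) s k <= t) ->
  dominates (fun n x => \sum_(k < n.+1) g k n x) t (\bigcup_k A k).
Proof.
move=> gA st.
have cg k n : continuous (g k n) by have [] := gA k.
have g0 k n x : 0 <= g k n x by have [] := gA k.
have gS k n x : g k n x <= g k n.+1 x by have [] := gA k.
split.
- by move=> n; exact: continuous_sum.
- by move=> n x; exact: sumr_ge0.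
- move=> n x; rewrite [leRHS]big_ord_recr/= ler_wpDr// ler_sum// => k _.
- move=> n; rewrite pl_sum//; apply: le_trans (st n.+1); apply: ler_sum => k _.
  by have [_ _ _ + _] := gA k; apply.
- move=> x [k _ Akx] e e0; have [_ _ _ _ /(_ x Akx e e0)[m gm]] := gA k.
  exists (maxn k m); apply: (lt_le_trans gm).
  have km : (k < (maxn k m).+1)%N by rewrite ltnS leq_maxl.
  rewrite (bigD1 (Ordinal km))//= ler_wpDr ?sumr_ge0//.
  have ge := @homo_leq _ (fun n => g k n x) <=%R (@lexx _ _) (@le_trans _ _) (fun n => gS k n x).
  exact: ge (leq_maxr _ _).
Qed.

Lemma outer_sigma_subadditive : sigma_subadditive outer.
Proof.
move=> A; apply/lee_addgt0Pr => e e0.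
have out0 i : (0 <= outer (A i))%E by rewrite lee_fin omass_ge0.
have [S0|Sfin] := eqVneq (\sum_(i <oo) outer (A i))%E +oo%E.
  by rewrite S0 addye ?leey.
have Sr : (\sum_(i <oo) outer (A i))%E \is a fin_num.
  by rewrite ge0_fin_numE ?lt_neqAle ?Sfin ?leey// nneseries_ge0.
rewrite -(fineK Sr) -EFinD lee_fin.
have H k : exists gs : (nat -> X -> R) * R,
    dominates gs.1 gs.2 (A k) /\ gs.2 <= omass (A k) + e * 2^-1 ^+ k.+1.
  have ek : 0 < e * 2^-1 ^+ k.+1 by rewrite mulr_gt0// exprn_gt0.
  have [s [g gs] lt] := inf_adherent ek (has_inf_omass (A k)).
  by exists (g, s); split=> //; exact: ltW.
have [gs hgs] := choice H.
apply: omass_le (dominates_bigcup (fun k => (hgs k).1) _) => n.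
apply: (@le_trans _ _ (\sum_(k < n) (omass (A k) + e * 2^-1 ^+ k.+1))).
  by apply: ler_sum => k _; exact: (hgs k).2.
rewrite big_split/= lerD//.
  have := @nneseries_lim_ge R (outer \o A) xpredT 0 n (fun k _ _ => out0 k).
  by rewrite big_mkord sumEFin -lee_fin fineK.
rewrite -mulr_sumr ler_piMr ?(ltW e0)//.
suff -> : \sum_(k < n) 2^-1 ^+ k.+1 = 1 - 2^-1 ^+ n :> R.
  by rewrite lerBlDr lerDl exprn_ge0.
elim: n => [|n IH]; first by rewrite big_ord0 expr0 subrr.
by rewrite big_ord_recr/= IH exprS; lra.
Qed.

HB.instance Definition _ := isOuterMeasure.Build R X outer
  (congr1 EFin omass0) (fun A => omass_ge0 A) (fun A B => @omassS A B) outer_sigma_subadditive.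

(** The functions min(1, n u) increase to the indicator of U. They cut a dominating sequence of B
    into one for the part in U and, with the cut-off frozen at a late index m, one for the part
    outside U. *)
Lemma omass_split U B : open U -> omass (B `&` U) + omass (B `&` ~` U) <= omass B.
Proof.
move=> /open_positivity[u [cu u01 Uu]]; apply/ler_addgt0Pr => e e0.
have e20 : 0 < e / 2 by rewrite divr_gt0.
have [s [g [cg g0 gS gs gB]] slt] := inf_adherent e20 (has_inf_omass B).
pose v n x := Num.min 1 (n%:R * u x).
have cv n : continuous (v n).
  apply: continuous_minr; first exact: continuous_const.
  by apply: continuous_mulr => //; exact: continuous_const.
have v01 n x : 0 <= v n x <= 1.
  by rewrite le_min ler01 mulr_ge0 ?ge_min ?lexx//; case/andP: (u01 x).
have vS n m x : (n <= m)%N -> v n x <= v m x.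
  move=> nm; rewrite le_min ge_min lexx/= ge_min [X in _ || X]ler_wpM2r ?orbT ?ler_nat//.
  by case/andP: (u01 x).
have gM n m x : (n <= m)%N -> g n x <= g m x.
  by move=> nm; exact: (@homo_leq _ (fun n => g n x) <=%R (@lexx _ _) (@le_trans _ _) (fun n => gS n x)).
pose E := [set L (fun x => g n x * v n x) | n in [set: nat]].
have hE : has_sup E.
  split; first by eexists; exists 0%N.
  exists s => _ [n _ <-]; apply: le_trans (gs n); apply: (plle pL) => //.
    exact: continuous_mulr.
  by move=> x; rewrite ler_piMr//; case/andP: (v01 n x).
have hU : omass (B `&` U) <= sup E.
  apply: (@omass_le (fun n x => g n x * v n x)); split.
  - by move=> n; exact: continuous_mulr.
  - by move=> n x; rewrite mulr_ge0//; case/andP: (v01 n x).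
  - move=> n x; rewrite ler_pM ?vS//; by case/andP: (v01 n x).
  - by move=> n; apply: ub_le_sup; [exact: hE.2|exists n].
  - move=> x [Bx /Uu ux] d d0; have [n gn] := gB x Bx d d0.
    pose m := (maxn n (Num.truncn (u x)^-1).+1).
    exists m; suff -> : v m x = 1.
      by rewrite mulr1 (lt_le_trans gn)// gM// leq_maxl.
    apply/eqP; rewrite eq_le; case/andP: (v01 m x) => _ -> /=.
    rewrite le_min lexx -ler_pdivrMr// div1r.
    apply: (@le_trans _ _ (Num.truncn (u x)^-1).+1%:R); first exact/ltW/truncnS_gt.
    by rewrite ler_nat leq_maxr.
have [_ [m _ <-] mlt] := sup_adherent e20 hE.
have hC : omass (B `&` ~` U) <= s - L (fun x => g m x * v m x).
  apply: (@omass_le (fun n x => g (n + m)%N x * (1 - v m x))).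
  have c1 : continuous (fun x => 1 - v m x).
    by apply: continuous_subr => //; exact: continuous_const.
  have v1 x : 0 <= 1 - v m x by rewrite subr_ge0; case/andP: (v01 m x).
  split.
  - by move=> n; exact: continuous_mulr.
  - by move=> n x; rewrite mulr_ge0.
  - by move=> n x; rewrite ler_wpM2r// addSn.
  - move=> n; rewrite lerBrDr; apply: le_trans (gs (n + m)%N).
    rewrite -(plD pL); [|exact: continuous_mulr..].
    apply: (plle pL) => //; first by apply: continuous_addr; exact: continuous_mulr.
    move=> x; have := gM m (n + m)%N x (leq_addl _ _); case/andP: (v01 m x); nra.
  - move=> x [Bx Ux] d d0; have [n gn] := gB x Bx d d0.
    exists n; have -> : v m x = 0.
      have : ~ (0 < u x) by move=> /Uu.
      move=> /negP; rewrite /v -leNgt => u0; have -> : u x = 0.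
        by apply/eqP; rewrite eq_le u0; case/andP: (u01 x).
      by rewrite mulr0; apply/min_idPr.
    by rewrite subr0 mulr1 (lt_le_trans gn)// gM// leq_addr.
lra.
Qed.


Lemma borel_caratheodory (A : set (borel X)) : measurable A ->
  caratheodory_measurable outer A.
Proof.
have sub : <<s @open X >> `<=` (outer.-cara.-measurable : set (set X)).
  apply: smallest_sub; first exact: sigma_algebra_measurable.
  move=> U oU; apply: le_caratheodory_measurable => B.
  by rewrite -EFinD lee_fin; exact: omass_split.
by move=> mA; exact: sub.
Qed.

(** The value 0 off the sigma-algebra is the normalisation required by [borelProb]. *)
Definition riesz_fun (A : set (borel X)) : \bar R :=
  if `[< measurable A >] then outer A else 0%E.

Lemma riesz_funE (A : set (borel X)) : measurable A -> riesz_fun A = outer A.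
Proof. by move=> mA; rewrite /riesz_fun asboolT. Qed.

Let riesz0 : riesz_fun set0 = 0%E.
Proof. by rewrite riesz_funE//= /outer omass0. Qed.

Let riesz_ge0 A : (0 <= riesz_fun A)%E.
Proof. by rewrite /riesz_fun; case: ifP => // _; rewrite lee_fin omass_ge0. Qed.

Let riesz_additive : semi_sigma_additive riesz_fun.
Proof.
move=> A mA tA mUA.
have := @caratheodory_measure_sigma_additive R X outer A
  (fun n => borel_caratheodory (mA n)) tA (borel_caratheodory mUA).
rewrite riesz_funE//; apply: cvg_trans; apply: near_eq_cvg; apply: nearW => n.
by apply: eq_bigr => k _; rewrite riesz_funE.
Qed.

HB.instance Definition _ :=
  isMeasure.Build _ _ _ riesz_fun riesz0 riesz_ge0 riesz_additive.

(** As in Dini's theorem, compactness makes a single g n exceed 1 - e everywhere, and L is then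
    evaluated at that function. *)
Lemma omassT : omass [set: X] = 1.
Proof.
apply/eqP; rewrite eq_le (omass_le (dominates1 _))/=.
apply: lb_le_inf; first exact: (has_inf_omass _).1.
move=> s [g [cg g0 gS gs gT]]; apply/ler_addgt0Pr => e e0.
have nc := (compact_near_coveringP [set: X]).1 cX.
have H x : [set: X] x -> \forall x' \near x & n \near \oo, 1 - e < g n x'.
  move=> _; have [n gn] := gT x Logic.I e e0.
  exists ([set x' | 1 - e < g n x'], [set m | (n <= m)%N]).
    split => /=; last by exists n.
    exact: (cvgr_gt _ (cg n x) _ gn).
  move=> [x' m] [/= gx' nm]; apply: lt_le_trans gx' _.
  exact: (@homo_leq _ (fun n => g n x') <=%R (@lexx _ _) (@le_trans _ _) (fun n => gS n x')).
have [n _ /(_ n (leqnn n)) h] := nc _ _ _ _ H.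
rewrite -lerBlDr -(pl_cst pL (1 - e)); apply: le_trans (gs n).
by apply: (plle pL) => //[|x]; [exact: continuous_cst|exact/ltW/h].
Qed.

Let rieszT : riesz_fun [set: borel X] = 1%E.
Proof. by rewrite riesz_funE// /outer omassT. Qed.

HB.instance Definition _ := Measure_isProbability.Build _ _ _ riesz_fun rieszT.

Definition riesz_prob : probability (borel X) R := riesz_fun.

Definition clamp (y : R) : R := Num.min 1 (Num.max 0 y).

Lemma clamp_sum (y : R) n : 0 <= y -> \sum_(j < n) clamp (y - j%:R) = Num.min y n%:R.
Proof.
move=> y0; elim: n => [|n IH]; first by rewrite big_ord0; apply/esym/min_idPr.
rewrite big_ord_recr/= IH /clamp -natr1.
have [yn|ny] := leP y n%:R.
  by rewrite (max_idPl _) ?subr_le0// (min_idPr _)// (min_idPl _); lra.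
rewrite (max_idPr _) ?subr_ge0 ?(ltW ny)//.
have [yn|ny'] := leP y (n%:R + 1).
  by rewrite (min_idPr _); lra.
by rewrite (min_idPl _); lra.
Qed.

Lemma omass_level (f : X -> R) r : continuous f ->
  omass [set x | r + 1 <= f x] <= L (fun x => clamp (f x - r)).
Proof.
move=> cf; have cc : continuous (fun x => clamp (f x - r)).
  apply: continuous_minr; first exact: continuous_const.
  apply: continuous_maxr; first exact: continuous_const.
  by apply: continuous_subr => //; exact: continuous_const.
apply: (@omass_le (fun=> fun x => clamp (f x - r))); split=> //.
  by move=> _ x; rewrite /clamp le_min ler01 le_max lexx.
move=> x /= rx e e0; exists 0%N; rewrite /clamp (max_idPr _) ?(min_idPl _); lra.
Qed.

(** Layer cake: f is at most 1 / N plus 1 / N times the number of levels [A j] reached. The mass of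
    a level is at most L of a clamped slice of N f, and the slices add up to N f. *)
Lemma riesz_expect_le01 (f : X -> R) : continuous f -> (forall x, 0 <= f x <= 1) ->
  expect riesz_prob f <= L f.
Proof.
move=> cf f01; apply/ler_addgt0Pr => e e0.
have [N N0 Ne] : exists2 N : nat, (0 < N)%N & N%:R^-1 <= e.
  exists (Num.truncn e^-1).+1 => //; rewrite -[leRHS]invrK lef_pV2 ?posrE ?invr_gt0//.
  exact/ltW/truncnS_gt.
have NR : 0 < N%:R :> R by rewrite ltr0n.
pose A j : set (borel X) := [set x | j%:R + 1 <= N%:R * f x].
have cN : continuous (fun x => N%:R * f x).
  by apply: continuous_mulr => //; exact: continuous_const.
have mA j : measurable (A j).
  rewrite -[A j]setTI (_ : A j = (fun x => N%:R * f x) @^-1` `[j%:R + 1, +oo[%classic).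
    exact: (continuous_borel_measurable cN).
  by apply/seteqP; split=> x /=; rewrite in_itv/= andbT.
pose S m (x : borel X) : R := N%:R^-1 + \sum_(j < m) N%:R^-1 * \1_(A j) x.
have intS m : riesz_prob.-integrable [set: borel X] (EFin \o S m) /\
    (\int[riesz_prob]_x S m x)%R = N%:R^-1 + \sum_(j < m) N%:R^-1 * omass (A j).
  elim: m => [|m [IH1 IH2]].
    rewrite (_ : S 0%N = fun=> N%:R^-1); last by apply/funext => x; rewrite /S big_ord0 addr0.
    split; last by rewrite big_ord0 addr0; exact: expect_cst.
    exact: (@continuous_integrable R X cX riesz_prob (fun=> N%:R^-1) (@continuous_const R X _)).
  have i1 : riesz_prob.-integrable [set: borel X] (EFin \o (\1_(A m) : borel X -> R)).
    exact: integrable_indic.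
  have i2 : riesz_prob.-integrable [set: borel X] (EFin \o (fun x => N%:R^-1 * \1_(A m) x)).
    have := integrableZl measurableT N%:R^-1 i1; apply: eq_integrable => // x _.
  have SE : S m.+1 = (fun x => S m x + N%:R^-1 * \1_(A m) x).
    by apply/funext => x; rewrite /S big_ord_recr/= addrA.
  split.
    have := integrableD measurableT IH1 i2; apply: eq_integrable => // x _.
    by rewrite SE.
  rewrite SE RintegralD// IH2 big_ord_recr/= addrA; congr (_ + _).
  rewrite RintegralZl//; congr (_ * _).
  rewrite /Rintegral integral_indic// setIT.
  by transitivity (fine (outer (A m))) => //; congr fine; exact: riesz_funE.
have fS x : f x <= S N x.
  rewrite /S -mulr_sumr -{1}[N%:R^-1]mulr1 -mulrDr ler_pdivlMl//.
  apply: (@le_trans _ _ (1 + \sum_(j < N) clamp (N%:R * f x - j.+1%:R))).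
    have y0 : 0 <= N%:R * f x by rewrite mulr_ge0//; case/andP: (f01 x).
    have := @clamp_sum _ N.+1 y0; rewrite big_ord_recl /= => h.
    have yN : N%:R * f x <= N.+1%:R.
      rewrite -natr1; case/andP: (f01 x) => _ f1.
      have : N%:R * f x <= N%:R * 1 by rewrite ler_wpM2l.
      lra.
    rewrite (min_idPl _)// in h; rewrite -{1}h lerD//.
    by rewrite /clamp ge_min lexx.
  rewrite lerD2l ler_sum// => j _; rewrite indicE.
  have [/set_mem Aj|nAj] := boolP (x \in A j); first by rewrite /clamp ge_min lexx.
  move: nAj; rewrite notin_setE /A/= => /negP; rewrite -ltNge => lt.
  by rewrite /clamp ge_min ge_max lexx subr_le0 -natr1 (ltW lt) orbT.
apply: (@le_trans _ _ (N%:R^-1 + \sum_(j < N) N%:R^-1 * omass (A j))).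
  rewrite -(intS N).2; apply: le_Rintegral => //.
  - exact: continuous_integrable.
  - by have [] := intS N.
rewrite addrC lerD// -mulr_sumr ler_pdivrMl//.
have cc (j : nat) : continuous (fun x => clamp (N%:R * f x - j%:R)).
  apply: continuous_minr; first exact: continuous_const.
  apply: continuous_maxr; first exact: continuous_const.
  by apply: continuous_subr => //; exact: continuous_const.
rewrite -(plZ pL)//.
have -> : (fun x => N%:R * f x) = (fun x => \sum_(j < N) clamp (N%:R * f x - j%:R)).
  apply/funext => x; rewrite clamp_sum; last by rewrite mulr_ge0//; case/andP: (f01 x).
  by rewrite (min_idPl _)// ler_piMr//; case/andP: (f01 x).
rewrite (pl_sum pL)//; apply: ler_sum => j _; exact: omass_level.
Qed.

Lemma riesz_expect_le (f : X -> R) : continuous f -> expect riesz_prob f <= L f.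
Proof.
move=> cf; have [M hM] := continuous_bounded cX cf.
pose K := M + 1; have K0 : 0 < K.
  by rewrite /K; have := le_trans (normr_ge0 _) (hM point); lra.
pose h x := (2 * K)^-1 * f x + 2^-1.
have ch : continuous h.
  apply: continuous_addr; last exact: continuous_const.
  by apply: continuous_mulr => //; exact: continuous_const.
have h01 x : 0 <= h x <= 1.
  have := hM x; rewrite ler_norml => /andP[h1 h2].
  have K2 : 0 < 2 * K by rewrite mulr_gt0.
  have : - 2^-1 <= (2 * K)^-1 * f x <= 2^-1.
    by rewrite ler_pdivlMl// ler_pdivrMl// /K; apply/andP; split; lra.
  by rewrite /h; lra.
have fh : f = fun x => 2 * K * h x + - K.
  by apply/funext => x; rewrite /h; field; rewrite gt_eqF.
have ch' : continuous (fun x => 2 * K * h x).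
  by apply: continuous_mulr => //; exact: continuous_const.
rewrite fh expectD//; last exact: continuous_const.
rewrite (plD pL)//; last exact: continuous_const.
rewrite expect_cst pl_cst// lerD2r expectZ// (plZ pL)// ler_wpM2l//.
  by rewrite mulr_ge0// ltW.
exact: riesz_expect_le01.
Qed.

Lemma riesz_expect (f : X -> R) : continuous f -> expect riesz_prob f = L f.
Proof.
move=> cf; apply/eqP; rewrite eq_le riesz_expect_le//=.
have := riesz_expect_le (f := fun x => -1 * f x).
rewrite expectZ// (plZ pL)// !mulN1r lerN2; apply.
by apply: continuous_mulr => //; exact: continuous_const.
Qed.

Theorem riesz_representation : exists mu : borelProb X,
  forall f, continuous f -> expect (sval mu) f = L f.
Proof.
have junk (A : set (borel X)) : ~ measurable A -> riesz_prob A = 0%E.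
  by move=> nA; rewrite /riesz_prob/= /riesz_fun asboolF.
by exists (exist _ riesz_prob junk); exact: riesz_expect.
Qed.

End Riesz.

Section UltraBounded.
Context (R : realType) (T : Type) (F : set_system T) (UF : UltraFilter F).

Lemma ultra_fmap (U : Type) (u : T -> U) : UltraFilter (u @ F).
Proof.
split; first exact: fmap_proper_filter.
move=> H PH FH; apply/seteqP; split; last exact: FH.
move=> A HA; have [//|nA] := in_ultra_setVsetC (u @^-1` A) UF.
have : H (A `&` ~` A) by apply: filterI => //; exact: FH.
by rewrite setICr => /filter_not_empty.
Qed.

Lemma ultra_bounded_cvg (u : T -> R) M : (forall t, `|u t| <= M) -> cvg (u @ F).
Proof.
move=> uM; have := @segment_compact R (- M) M.
rewrite compact_ultra => /(_ (u @ F) (ultra_fmap u)).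
case; last by move=> l [_ ul]; apply/cvg_ex; exists l.
suff : \forall t \near F, u t \in `[- M, M] by [].
by apply: nearW => t; rewrite in_itv/= -ler_norml.
Qed.
End UltraBounded.

Lemma continuous_normr (R : realType) (T : topologicalType) (f : T -> R) :
  continuous f -> continuous (fun x => `|f x|).
Proof.
move=> cf x; apply: (@continuous_comp _ _ _ f (fun y : R => `|y|)); first exact: cf.
exact: (@norm_continuous R R^o).
Qed.

(** * Compactness and function covers of the space of measures *)

Section BorelProbTopology.
Context (R : realType) (X : pmetricType R).
Hypothesis cX : compact [set: X].
Local Notation M := (borelProb X).
Implicit Types (mu nu : M) (f : X -> R).

Definition bexpect f mu : R := expect (sval mu) f.

Lemma bexpect_continuous f : continuous f -> continuous (bexpect f).
Proof.
move=> cf; have : bexpect f = fun mu => integrals mu (exist _ f cf) by [].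
by move=> ->; exact: integral_continuous.
Qed.

Lemma borelProb_cvg (F : set_system M) (FF : Filter F) mu :
  (forall f, continuous f -> bexpect f nu @[nu --> F] --> bexpect f mu) -> F --> mu.
Proof.
move=> H A; rewrite nbhsE => -[B [[C oC <-] Cmu] BA].
apply: (filterS BA).
suff : (@integrals R X @ F) --> integrals mu by apply; exact: open_nbhs_nbhs.
apply/cvg_sup => i V [B' [[C' oC' <-] C's] sB].
apply: (filterS sB); apply: (H _ (svalP i)).
exact: open_nbhs_nbhs.
Qed.

(** Along an ultrafilter all expectations, being bounded, converge; the limits form a positive
    functional, which Riesz turns into the limit measure. *)
Theorem compact_borelProb : compact [set: M].
Proof.
rewrite compact_ultra => F UF _.
have cv f : continuous f -> cvg (bexpect f nu @[nu --> F]).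
  move=> cf; have [K fK] := continuous_bounded cX cf.
  apply: (@ultra_bounded_cvg _ _ _ _ _ K) => nu; rewrite ler_norml.
  rewrite -(expect_cst (sval nu) (- K)) -[X in _ && (_ <= X)](expect_cst (sval nu) K).
  apply/andP; split; apply: expect_le => //; try exact: continuous_cst.
    by move=> x; have := fK x; rewrite ler_norml => /andP[].
  by move=> x; have := fK x; rewrite ler_norml => /andP[].
pose L f := lim (bexpect f nu @[nu --> F]).
have pL : pos_linear L.
  split.
  - move=> f g cf cg; apply: cvg_lim => //.
    rewrite (_ : bexpect _ = fun nu => bexpect f nu + bexpect g nu); last first.
      by apply/funext => nu; exact: expectD.
    by apply: cvgD; exact: cv.
  - move=> r f cf; apply: cvg_lim => //.
    rewrite (_ : bexpect _ = fun nu => r * bexpect f nu); last first.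
      by apply/funext => nu; exact: expectZ.
    by apply: cvgM; [exact: cvg_cst|exact: cv].
  - move=> f g cf cg fg; apply: ler_lim; [exact: cv|exact: cv|].
    by apply: filterS filterT => nu _; exact: expect_le.
  - apply: cvg_lim => //; rewrite (_ : bexpect _ = fun=> 1); first exact: cvg_cst.
    by apply/funext => nu; exact: expect_cst.
have [mu muL] := riesz_representation cX pL.
exists mu; split=> //; apply: borelProb_cvg => f cf.
by rewrite /bexpect muL//; exact: cv.
Qed.

Definition close_on n (f : nat -> X -> R) (e : R) mu nu :=
  forall k, (k < n)%N -> `|bexpect (f k) nu - bexpect (f k) mu| < e.

Lemma borelProb_nbhs mu (U : set M) : nbhs mu U ->
  exists n (f : nat -> X -> R) (e : R), [/\ forall k, continuous (f k), 0 < e & close_on n f e mu `<=` U].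
Proof.
pose F : set_system M := [set A | exists n (f : nat -> X -> R) (e : R),
  [/\ forall k, continuous (f k), 0 < e & close_on n f e mu `<=` A]].
suff : F --> mu by move=> h /h.
have FF : Filter F.
  split.
  - by exists 0%N, (fun=> fun=> 0), 1; split=> // k; exact: continuous_cst.
  - move=> A B [n [f [e [cf e0 fA]]]] [m [g [d [cg d0 gB]]]].
    exists (n + m)%N, (fun k => if (k < n)%N then f k else g (k - n)%N), (Num.min e d); split.
    + by move=> k; case: ifP.
    + by rewrite lt_min e0.
    + move=> nu h; split; [apply: fA|apply: gB] => k kn.
        have := h k (ltn_addr _ kn); rewrite kn lt_min; by case/andP.
      have := h (n + k)%N; rewrite ltn_add2l => /(_ kn).
      by rewrite ltnNge leq_addr addKn/= lt_min => /andP[].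
  - move=> A B AB [n [f [e [cf e0 fA]]]]; exists n, f, e; split=> //.
    exact: subset_trans AB.
apply: borelProb_cvg => f cf; apply/cvgrPdist_lt => e e0.
exists 1%N, (fun=> f), e; split=> // nu /(_ 0%N isT).
by rewrite distrC.
Qed.

Lemma close_on_nbhs n (f : nat -> X -> R) e mu : (forall k, continuous (f k)) -> 0 < e ->
  nbhs mu (close_on n f e mu).
Proof.
move=> cf e0; elim: n => [|n IH]; first by apply: filterS filterT.
have : nbhs mu [set nu | `|bexpect (f n) nu - bexpect (f n) mu| < e].
  have /cvgrPdist_lt/(_ _ e0) := @bexpect_continuous _ (cf n) mu.
  by apply: filterS => nu /=; rewrite distrC.
apply: filterS2 IH => nu h1 h2 k; rewrite ltnS leq_eqVlt => /orP[/eqP ->//|]; exact: h1.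
Qed.

Lemma borelProb_lebesgue_number (A : {fset set M}) : open_cover A ->
  exists n (f : nat -> X -> R) (e : R), [/\ forall k, continuous (f k), 0 < e &
    forall mu, exists2 U, U \in A & close_on n f e mu `<=` U].
Proof.
move=> [oA cA].
pose basic (C : M -> set M) := exists n (f : nat -> X -> R) (e : R),
  [/\ forall k, continuous (f k), 0 < e & C = close_on n f e].
(* The relations [close_on n f e] play the role of the radii of a metric: [F] expresses that a
   property holds for all sufficiently fine ones. *)
pose F : set_system (M -> set M) := [set P | exists2 C0, basic C0 &
   forall C, basic C -> (forall mu, C mu `<=` C0 mu) -> P C].
have FF : Filter F.
  split.
  - exists (close_on 0 (fun=> fun=> 0) 1) => //.
    by exists 0%N, (fun=> fun=> 0), 1; split=> // k; exact: continuous_cst.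
  - move=> P Q [C0 [n [f [e [cf e0 fC]]]] CP] [C1 [m [g [d [cg d0 gC]]]] CQ].
    pose h k := if (k < n)%N then f k else g (k - n)%N.
    exists (close_on (n + m)%N h (Num.min e d)).
      exists (n + m)%N, h, (Num.min e d); split=> //; last by rewrite lt_min e0.
      by move=> k; rewrite /h; case: ifP.
    have hf mu : close_on (n + m)%N h (Num.min e d) mu `<=` C0 mu.
      rewrite fC => nu hh k kn; have := hh k (ltn_addr _ kn).
      by rewrite /h kn lt_min; case/andP.
    have hg mu : close_on (n + m)%N h (Num.min e d) mu `<=` C1 mu.
      rewrite gC => nu hh k kn; have := hh (n + k)%N.
      rewrite /h ltn_add2l => /(_ kn).
      by rewrite ltnNge leq_addr addKn/= lt_min => /andP[].
    move=> C bC Ch; split; [apply: CP|apply: CQ] => // mu.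
      exact: subset_trans (hf mu).
    exact: subset_trans (hg mu).
  - by move=> P Q PQ [C0 bC0 CP]; exists C0 => // C bC CC0; apply: PQ; exact: CP.
have nc := (compact_near_coveringP [set: M]).1 compact_borelProb.
have H mu : [set: M] mu -> \forall nu \near mu & C \near F,
    exists2 U, U \in A & C nu `<=` U.
  move=> _; have : (\bigcup_(U in [set` A]) U) mu by rewrite cA.
  move=> [U /= UA Umu]; have := @open_nbhs_nbhs _ mu U (conj (oA _ UA) Umu).
  move=> /borelProb_nbhs[n [f [e [cf e0 fU]]]].
  have e20 : 0 < e / 2 by rewrite divr_gt0.
  exists (close_on n f (e / 2) mu, [set C | forall nu, C nu `<=` close_on n f (e / 2) nu]).
    split=> /=; first exact: close_on_nbhs.
    by exists (close_on n f (e / 2)) => //; exists n, f, (e / 2).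
  move=> [nu C] [/= h1 h2]; exists U => // nu' /h2 h3; apply: fU => k kn.
  have := h1 k kn; have := h3 k kn => a b.
  rewrite (_ : bexpect (f k) nu' - bexpect (f k) mu = (bexpect (f k) nu' - bexpect (f k) nu) + (bexpect (f k) nu - bexpect (f k) mu)); last by ring.
  by rewrite (le_lt_trans (ler_normD _ _))// [e]splitr ltrD.
have [C0 bC0 h] := nc _ _ _ FF H.
have [n [f [e [cf e0 fC]]]] := bC0.
exists n, f, e; split=> // mu; rewrite -fC.
exact: (h C0 bC0 (fun=> @subset_refl _ _) mu Logic.I).
Qed.

Lemma borelProb_lebesgue_number01 (A : {fset set M}) : open_cover A ->
  exists n (f : nat -> X -> R) (e : R), [/\ forall k, continuous (f k), forall k x, 0 <= f k x <= 1, 0 < e &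
    forall mu, exists2 U, U \in A & close_on n f e mu `<=` U].
Proof.
move=> /borelProb_lebesgue_number[n [f [e [cf e0 H]]]].
have /choice[K hK] := fun k => continuous_bounded cX (cf k).
have K0 k : 0 <= K k by exact: le_trans (normr_ge0 _) (hK k point).
pose B := \sum_(k < n) K k + 1.
have B0 : 0 < B by rewrite ltr_wpDl// sumr_ge0.
have BK k : (k < n)%N -> K k <= B.
  move=> kn; rewrite /B (bigD1 (Ordinal kn))//= -addrA lerDl addr_ge0// sumr_ge0//.
(* For k < n the argument already lies in [0, 1]; the clamp only tames the functions with k >= n,
   whose bounds do not enter B. *)
pose g k x := clamp ((2 * B)^-1 * f k x + 2^-1).
have cg k : continuous (g k).
  apply: continuous_minr; first exact: continuous_const.
  apply: continuous_maxr; first exact: continuous_const.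
  apply: continuous_addr; last exact: continuous_const.
  by apply: continuous_mulr => //; exact: continuous_const.
have gE k nu : (k < n)%N -> bexpect (g k) nu = (2 * B)^-1 * bexpect (f k) nu + 2^-1.
  move=> kn; have -> : g k = fun x => (2 * B)^-1 * f k x + 2^-1.
    apply/funext => x; have := hK k x; rewrite ler_norml => /andP[h1 h2].
    have := BK k kn => h3; have B20 : 0 < 2 * B by rewrite mulr_gt0.
    have : - 2^-1 <= (2 * B)^-1 * f k x <= 2^-1.
      by rewrite ler_pdivlMl// ler_pdivrMl//; apply/andP; split; lra.
    move=> /andP[h4 h5]; rewrite /g /clamp (max_idPr _) ?(min_idPr _)//; lra.
  rewrite /bexpect expectD//; last 2 first.
  - by apply: continuous_mulr => //; exact: continuous_const.
  - exact: continuous_const.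
  by rewrite expectZ// expect_cst.
exists n, g, ((2 * B)^-1 * e); split=> //.
- by move=> k x; rewrite /g /clamp le_min ler01 le_max lexx ge_min lexx.
- by rewrite mulr_gt0// invr_gt0 mulr_gt0.
move=> mu; have [U UA fU] := H mu; exists U => // nu h; apply: fU => k kn.
have := h k kn; rewrite !gE// opprD addrACA subrr addr0 -mulrBr normrM.
by rewrite ger0_norm ?invr_ge0 ?mulr_ge0 ?(ltW B0)// ltr_pM2l// invr_gt0 mulr_gt0.
Qed.

(** An unnormalised partition of unity, with one function per member of A, so that passing from open
    sets to functions cannot increase multiplicities. *)
Lemma subordinate_functions (A : {fset set M}) : open_cover A ->
  exists phi : A -> M -> R, [/\ forall U, continuous (phi U),
    forall U mu, 0 < phi U mu -> (val U) mu & forall mu, exists U, 0 < phi U mu].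
Proof.
move=> [oA cA].
have H mu : exists Uu : A * (M -> R), [/\ continuous Uu.2, 0 < Uu.2 mu &
    forall nu, 0 < Uu.2 nu -> (val Uu.1) nu].
  have : (\bigcup_(U in [set` A]) U) mu by rewrite cA.
  move=> [U /= UA Umu]; have := @open_nbhs_nbhs _ mu U (conj (oA _ UA) Umu).
  move=> /borelProb_nbhs[n [f [e [cf e0 fU]]]].
  exists ([` UA]%fset, fun nu => e - \sum_(k < n) `|bexpect (f k) nu - bexpect (f k) mu|).
  split=> /=.
  - apply: continuous_subr; first exact: continuous_const.
    elim: (n) => [|m IH].
      by under eq_fun do rewrite big_ord0; exact: continuous_const.
    under eq_fun do rewrite big_ord_recr/=.
    apply: continuous_addr => //; apply: continuous_normr.
    by apply: continuous_subr; [exact: bexpect_continuous|exact: continuous_const].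
  - by rewrite big1 ?subr0// => k _; rewrite subrr normr0.
  - move=> nu; rewrite subr_gt0 => h; apply: fU => k kn; apply: le_lt_trans h.
    by rewrite (bigD1 (Ordinal kn))//= lerDl sumr_ge0.
have [Uu hU] := choice H.
(* Compactness in near-covering form, applied to the filter of large finite sets, gives a finite
   subcover. *)
pose F : set_system {fset M} := [set P | exists D0, forall D, (D0 `<=` D)%fset -> P D].
have FF : Filter F.
  split; first by exists fset0.
  - move=> P Q [D0 h0] [D1 h1]; exists (D0 `|` D1)%fset => D.
    by rewrite fsubUset => /andP[/h0 ? /h1].
  - by move=> P Q PQ [D0 h0]; exists D0 => D /h0 /PQ.
have nc := (compact_near_coveringP [set: M]).1 compact_borelProb.
have [|D0 /(_ D0 (fsubset_refl _)) cD] :=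
    nc _ _ (fun (D : {fset M}) nu => exists2 mu, mu \in D & 0 < (Uu mu).2 nu) FF.
  move=> mu _; have [cu u0 _] := hU mu.
  exists ([set nu | 0 < (Uu mu).2 nu], [set D : {fset M} | mu \in D]).
    split => /=; first exact: (cvgr_gt _ (cu mu) _ u0).
    by exists [fset mu]%fset => D; rewrite fsub1set.
  by move=> [nu D] [/= h1 h2]; exists mu.
set D := D0 in cD.
pose phi (U : A) nu := \sum_(mu <- D | (Uu mu).1 == U) Num.max 0 ((Uu mu).2 nu).
exists phi; split.
- move=> U; rewrite /phi; elim: (enum_fset D) => [|mu s IH].
    by under eq_fun do rewrite big_nil; exact: continuous_const.
  under eq_fun do rewrite big_cons.
  have [_|//] := boolP ((Uu mu).1 == U).
  apply: continuous_addr => //; apply: continuous_maxr; first exact: continuous_const.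
  by have [] := hU mu.
- move=> U nu; rewrite /phi => phi_gt0.
  apply: contrapT => nU; move: phi_gt0; rewrite big1 ?ltxx// => mu /eqP Umu.
  apply/max_idPl; rewrite leNgt; apply/negP => /(let: And3 _ _ h := hU mu in h _).
  by rewrite Umu.
- move=> nu; have [mu muD nu0] := cD nu Logic.I.
  exists (Uu mu).1; rewrite /phi big_seq_cond.
  have -> : \sum_(i <- D | (i \in D) && ((Uu i).1 == (Uu mu).1)) Num.max 0 ((Uu i).2 nu) =
    \sum_(i <- D | (Uu i).1 == (Uu mu).1) Num.max 0 ((Uu i).2 nu) by rewrite -big_seq_cond.
  rewrite (big_rem mu)//= eqxx ltr_pwDl ?sumr_ge0//; first by rewrite lt_max nu0 orbT.
  by move=> i _; rewrite le_max lexx.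
Qed.

End BorelProbTopology.

(** * Entropy and dimension of covers along a Folner sequence *)

Section CoverAlong.
Context (R : realType) (G : groupType) (Y : topologicalType) (a : contAction G Y).
Implicit Types (A B : {fset set Y}) (E : {fset G}) (g : G).

Lemma in_cover_join A B W :
  reflect (exists U V, [/\ U \in A, V \in B & W = (U `&` V)]) (W \in cover_join A B).
Proof.
apply: (iffP idP) => [/imfset2P[U /= UA [V /= VB ->]]|[U [V [UA VB ->]]]].
  by exists U, V.
by apply/imfset2P; exists U => //; exists V.
Qed.

Lemma is_coverP A : is_cover A <-> forall y, exists2 U, U \in A & U y.
Proof.
split=> [cA y|H]; last by apply/seteqP; split=> // y _; have [U UA Uy] := H y; exists U.
have : [set: Y] y by [].
by rewrite -cA => -[U UA Uy]; exists U.
Qed.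

Lemma open_cover_join A B : open_cover A -> open_cover B -> open_cover (cover_join A B).
Proof.
move=> [oA cA] [oB cB]; split.
  by move=> _ /in_cover_join[U [V [UA VB ->]]]; apply: openI; [exact: oA|exact: oB].
apply/is_coverP => y; have [U UA Uy] := (is_coverP A).1 cA y.
have [V VB Vy] := (is_coverP B).1 cB y.
by exists (U `&` V); [apply/in_cover_join; exists U, V|].
Qed.

Lemma open_cover_pre A g : open_cover A -> open_cover [fset a g @^-1` U | U in A]%fset.
Proof.
move=> [oA cA]; split.
  move=> _ /imfsetP[U /= UA ->]; have /continuousP := @act_continuous _ _ a g.
  by apply; exact: oA.
apply/is_coverP => y; have [U UA Uy] := (is_coverP A).1 cA (a g y).
by exists (a g @^-1` U) => //; apply/imfsetP; exists U.
Qed.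

Lemma open_cover_along E A : open_cover A -> open_cover (cover_along a E A).
Proof.
move=> oA; rewrite /cover_along; elim: (enum_fset E) => [|g s IH].
  rewrite big_nil; split; first by move=> U; rewrite inE => /eqP ->; exact: openT.
  by apply/is_coverP => y; exists setT; rewrite ?inE.
by rewrite big_cons; apply: open_cover_join => //; exact: open_cover_pre.
Qed.

Definition along_small E A (V : set Y) :=
  forall g, g \in E -> exists2 U, U \in A & V `<=` a g @^-1` U.

Lemma cover_alongP E A (V : set Y) :
  (exists2 W, W \in cover_along a E A & V `<=` W) <-> along_small E A V.
Proof.
rewrite /cover_along /along_small.
rewrite (_ : (forall g, g \in E -> _) <-> (forall g, g \in enum_fset E -> exists2 U, U \in A & V `<=` a g @^-1` U))//.
elim: (enum_fset E) => [|g s IH].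
  by rewrite big_nil; split=> // _; exists setT; rewrite ?inE.
rewrite big_cons; split.
  move=> [_ /in_cover_join[U [W [/imfsetP[U' /= UA ->] Ws ->]]] VU] g'.
  rewrite inE => /orP[/eqP ->|g's].
    by exists U' => //; exact: subset_trans VU (@subIsetl _ _ _).
  by apply: IH.1 => //; exists W => //; exact: subset_trans VU (@subIsetr _ _ _).
move=> H; have [U UA VU] := H g (mem_head _ _).
have [|W Ws VW] := IH.2; first by move=> g' g's; apply: H; rewrite inE g's orbT.
exists (a g @^-1` U `&` W); last by rewrite subsetI.
by apply/in_cover_join; exists (a g @^-1` U), W; split=> //; apply/imfsetP; exists U.
Qed.

Lemma finer_along E A B : finer B (cover_along a E A) <-> forall V, V \in B -> along_small E A V.
Proof. by split=> H V /H/cover_alongP. Qed.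

Lemma along_smallU E E' A V W : along_small E A V -> along_small E' A W ->
  along_small (E `|` E')%fset A (V `&` W).
Proof.
move=> h h' g; rewrite inE => /orP[/h|/h'] [U UA VU]; exists U => //.
  by apply: subset_trans VU; exact: subIsetl.
by apply: subset_trans VU; exact: subIsetr.
Qed.

Lemma along_smallS E A V W : V `<=` W -> along_small E A W -> along_small E A V.
Proof. by move=> VW h g /h[U UA WU]; exists U => //; exact: subset_trans WU. Qed.

Lemma along_small_rtransl E A V g : along_small E A V ->
  along_small (rtransl E g) A (a g @^-1` V).
Proof.
move=> h x; rewrite in_rtransl => /h[U UA VU]; exists U => // y /= /VU /=.
by rewrite -actM mulgVK.
Qed.

End CoverAlong.

Section BigMin.
Lemma bigmin_seq_le (T : eqType) (s : seq T) (P : pred T) (f : T -> nat) m x :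
  x \in s -> P x -> (\big[minn/m]_(i <- s | P i) f i <= f x)%N.
Proof.
elim: s => [//|y s IH]; rewrite inE big_cons => /orP[/eqP <-{y} Px|xs Px].
  by rewrite Px geq_minl.
by case: ifP => _; [rewrite geq_min IH ?orbT|exact: IH].
Qed.

Lemma bigmin_seq_eq (T : eqType) (s : seq T) (P : pred T) (f : T -> nat) m :
  (\big[minn/m]_(i <- s | P i) f i = m) \/
  exists2 x, x \in s & P x && (\big[minn/m]_(i <- s | P i) f i == f x).
Proof.
elim: s => [|y s IH]; first by left; rewrite big_nil.
rewrite big_cons; have [Py|nPy] := boolP (P y); last first.
  by case: IH => [->|[x xs h]]; [left|right; exists x; rewrite ?inE ?xs ?orbT].
rewrite /minn; case: ltnP => _.
  by right; exists y; rewrite ?mem_head// Py eqxx.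
by case: IH => [->|[x xs h]]; [left|right; exists x; rewrite ?inE ?xs ?orbT].
Qed.
End BigMin.

Section CoveringNumber.
Context (Y : topologicalType).
Implicit Types A B : {fset set Y}.

Lemma ncover_attained A : is_cover A ->
  exists B, [/\ (B `<=` A)%fset, is_cover B & #|` B| = ncover A].
Proof.
move=> cA; rewrite /ncover.
have [->|[B]] := bigmin_seq_eq (fpowerset A) (fun B => `[< is_cover B >]) (fun B => #|` B|) #|` A|.
  by exists A.
rewrite fpowersetE => BA /andP[/asboolP cB /eqP ->].
by exists B.
Qed.

Lemma ncover_finer A B : is_cover B -> finer B A -> (ncover A <= #|` B|)%N.
Proof.
move=> cB BA.
have /choice[f hf] : forall V, exists U, V \in B -> U \in A /\ V `<=` U.
  move=> V; have [VB|nVB] := boolP (V \in B); last by exists set0.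
  by have [U UA VU] := BA V VB; exists U.
pose C := [fset f V | V in B]%fset.
apply: (@leq_trans #|` C|).
  apply: (bigmin_seq_le (fun B : {fset set Y} => #|` B|) #|` A|).
    rewrite fpowersetE; apply/fsubsetP => _ /imfsetP[V /= VB ->].
    by have [] := hf V VB.
  apply/asboolP/is_coverP => y; have [V VB Vy] := (is_coverP B).1 cB y.
  by exists (f V); [apply/imfsetP; exists V|apply: (hf V VB).2].
exact: leq_imfset_card.
Qed.

Lemma ncover_gt0 A : (exists y : Y, True) -> is_cover A -> (0 < ncover A)%N.
Proof.
move=> [y _] cA; have [B [_ cB <-]] := ncover_attained cA.
have [U UB _] := (is_coverP B).1 cB y.
by rewrite cardfs_gt0; apply/fset0Pn; exists U.
Qed.

End CoveringNumber.

Section EntropyLimit.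
Context (R : realType) (G : groupType) (Y : topologicalType) (a : contAction G Y).
Hypothesis Y0 : exists y : Y, True.
Variables (A : {fset set Y}) (oA : open_cover A).
Implicit Types (E : {fset G}) (g : G).

Definition logcov E : R := ln (ncover (cover_along a E A))%:R.

Let cA E : is_cover (cover_along a E A). Proof. exact: (open_cover_along _ _ oA).2. Qed.

Let n0 E : 0 < (ncover (cover_along a E A))%:R :> R.
Proof. by rewrite ltr0n ncover_gt0. Qed.

Lemma logcov_ge0 E : 0 <= logcov E.
Proof. by rewrite ln_ge0// ler1n ncover_gt0. Qed.

Lemma logcov_bound E (B : {fset set Y}) : is_cover B ->
  (forall V, V \in B -> along_small a E A V) -> (ncover (cover_along a E A) <= #|` B|)%N.
Proof. by move=> cB sB; apply: ncover_finer => //; exact/finer_along. Qed.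

Lemma ncover_along_attained E : exists B, [/\ is_cover B,
  (forall V, V \in B -> along_small a E A V) & #|` B| = ncover (cover_along a E A)].
Proof.
have [B [BA cB Bn]] := ncover_attained (cA E).
exists B; split=> // V VB; apply/cover_alongP.
by exists V => //; exact: (fsubsetP BA).
Qed.

Lemma logcov0 : logcov fset0 = 0.
Proof.
suff : (ncover (cover_along a fset0 A) <= 1)%N.
  by rewrite -(ler_nat R) => h; apply/eqP; rewrite eq_le ln_le0// logcov_ge0.
rewrite -(cardfs1 [set: Y]); apply: logcov_bound.
  by apply/is_coverP => y; exists setT; rewrite ?inE.
by move=> V _ g; rewrite inE.
Qed.

Lemma logcovU E E' : logcov (E `|` E')%fset <= logcov E + logcov E'.
Proof.
rewrite /logcov -lnM ?posrE// ler_ln ?posrE//; last by rewrite mulr_gt0.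
have [B [cB sB <-]] := ncover_along_attained E.
have [B' [cB' sB' <-]] := ncover_along_attained E'.
rewrite -natrM ler_nat; apply: (@leq_trans #|` cover_join B B'|).
  apply: logcov_bound.
    apply/is_coverP => y; have [U UB Uy] := (is_coverP B).1 cB y.
    have [V VB Vy] := (is_coverP B').1 cB' y.
    by exists (U `&` V); [apply/in_cover_join; exists U, V|].
  by move=> _ /in_cover_join[U [V [/sB sU /sB' sV ->]]]; exact: along_smallU.
rewrite -(size_allpairs (fun U V : set Y => U `&` V)).
apply: uniq_leq_size => // _ /in_cover_join[U [V [UB VB ->]]].
by apply/allpairsP; exists (U, V).
Qed.

Lemma logcov_rtransl_le E g : logcov (rtransl E g) <= logcov E.
Proof.
rewrite /logcov ler_ln ?posrE// ler_nat.
have [B [cB sB <-]] := ncover_along_attained E.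
apply: (@leq_trans #|` [fset a g @^-1` V | V in B]%fset|); last exact: leq_imfset_card.
apply: logcov_bound.
  apply/is_coverP => y; have [U UB Uy] := (is_coverP B).1 cB (a g y).
  by exists (a g @^-1` U) => //; apply/imfsetP; exists U.
by move=> _ /imfsetP[V /= /sB sV ->]; exact: along_small_rtransl.
Qed.

Lemma rtranslK E g : rtransl (rtransl E g) g^-1 = E.
Proof. by apply/fsetP => x; rewrite !in_rtransl invgK mulgK. Qed.

Lemma logcov_rtransl E g : logcov (rtransl E g) = logcov E.
Proof.
apply/eqP; rewrite eq_le logcov_rtransl_le/=.
by rewrite -{1}(rtranslK E g) logcov_rtransl_le.
Qed.

Lemma logcov_cvg (F : nat -> {fset G}) : folner R F ->
  cvgn (fun n => logcov (F n) / #|` F n|%:R).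
Proof.
exact: (ornstein_weiss logcov_ge0 logcov0 logcovU logcov_rtransl).
Qed.

End EntropyLimit.

(** * Joins of covers given by functions *)

Section Staircase.
Local Open Scope nat_scope.

(* Pairs forming a staircase: at most p + q - 1 of them fit in a p x q grid. *)
Lemma staircase_card (I J : finType) (r : I -> nat) (s : J -> nat)
    (P : pred I) (Q : pred J) (T : pred (I * J)) :
  injective r -> injective s ->
  (forall i j, T (i, j) -> P i /\ Q j) ->
  (forall i j i' j', T (i, j) -> T (i', j') -> r i < r i' -> s j <= s j') ->
  0 < #|P| + #|Q| -> #|T| < #|P| + #|Q|.
Proof.
move=> rinj sinj TPQ stair PQ0.
(* Ranks within P and within Q. Along a staircase the sum of the two ranks is injective, and it
   takes at most |P| + |Q| - 1 values. *)
pose rho i := #|[pred k | P k & r k < r i]|.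
pose sig j := #|[pred k | Q k & s k < s j]|.
have rho_lt i i' : P i -> r i < r i' -> rho i < rho i'.
  move=> Pi rii; apply: proper_card; apply/properP; split.
    by apply/fintype.subsetP => k; rewrite !inE => /andP[-> /ltn_trans]; apply.
  by exists i; rewrite !inE Pi ?ltnn.
have sig_lt j j' : Q j -> s j < s j' -> sig j < sig j'.
  move=> Qj sjj; apply: proper_card; apply/properP; split.
    by apply/fintype.subsetP => k; rewrite !inE => /andP[-> /ltn_trans]; apply.
  by exists j; rewrite !inE Qj ?ltnn.
have sig_le j j' : Q j -> s j <= s j' -> sig j <= sig j'.
  move=> Qj; rewrite leq_eqVlt => /orP[/eqP/sinj ->//|/(sig_lt _ _ Qj)/ltnW//].
have rhoP i : P i -> rho i < #|P|.
  move=> Pi; apply: proper_card; apply/properP; split.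
    by apply/fintype.subsetP => k; rewrite !inE => /andP[].
  by exists i; rewrite ?inE ?ltnn ?andbF.
have sigQ j : Q j -> sig j < #|Q|.
  move=> Qj; apply: proper_card; apply/properP; split.
    by apply/fintype.subsetP => k; rewrite !inE => /andP[].
  by exists j; rewrite ?inE ?ltnn ?andbF.
pose h (x : I * J) : 'I_(#|P| + #|Q|).-1.+1 := inord (rho x.1 + sig x.2).
have hE x : T x -> h x = rho x.1 + sig x.2 :> nat /\ h x < (#|P| + #|Q|).-1.
  case: x => i j /TPQ[/rhoP Pi /sigQ Qj].
  by rewrite /h/= inordK; [split=> //; lia|lia].
have hinj : {in T &, injective h}.
  move=> [i j] [i' j'] Tij Tij' /(congr1 val)/=.
  rewrite (hE _ Tij).1 (hE _ Tij').1 /= => e.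
  have [Pi Qj] := TPQ _ _ Tij; have [Pi' Qj'] := TPQ _ _ Tij'.
  case: (ltngtP (r i) (r i')) => [lt|lt|/rinj ii].
  - have := rho_lt _ _ Pi lt; have := sig_le _ _ Qj (stair _ _ _ _ Tij Tij' lt); lia.
  - have := rho_lt _ _ Pi' lt; have := sig_le _ _ Qj' (stair _ _ _ _ Tij' Tij lt); lia.
  - subst i'; congr pair; apply/sinj.
    case: (ltngtP (s j) (s j')) => // lt.
      by have := sig_lt _ _ Qj lt; lia.
    by have := sig_lt _ _ Qj' lt; lia.
rewrite -(card_in_image hinj) -[ltnRHS]prednK//.
have : #|[set x in [seq h x | x in T]]%SET| <= #|[set~ (ord_max : 'I_(#|P| + #|Q|).-1.+1)]%SET|.
  apply: subset_leq_card; apply/fintype.subsetP => x; rewrite inE.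
  move=> /mapP[y]; rewrite mem_enum => Ty ->.
  rewrite !inE; apply/negP => /eqP/(congr1 val) e.
  by have := (hE _ Ty).2; rewrite e ltnn.
by rewrite cardsC1 card_ord cardsE ltnS.
Qed.

End Staircase.

Section FunctionCovers.
Context (R : realType) (Y : topologicalType).

Definition fun_cover (I : finType) (phi : I -> Y -> R) :=
  (forall i, continuous (phi i)) /\ forall y, exists i, 0 < phi i y.

Definition fmult (I : finType) (phi : I -> Y -> R) y := #|[pred i | 0 < phi i y]|.

Lemma fmult_gt0 (I : finType) (phi : I -> Y -> R) y : fun_cover phi -> (0 < fmult phi y)%N.
Proof. by move=> [_ /(_ y)[i iy]]; apply/card_gt0P; exists i. Qed.

Section Join.
Variables (I J : finType) (phi : I -> Y -> R) (psi : J -> Y -> R).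
Hypotheses (cphi : fun_cover phi) (cpsi : fun_cover psi).

Definition flo (K : finType) (f : K -> Y -> R) (k : K) y :=
  \sum_(l | (enum_rank l < enum_rank k)%N) Num.max 0 (f l y).
Definition fhi (K : finType) (f : K -> Y -> R) (k : K) y := flo f k y + Num.max 0 (f k y).

(* Placing the values of phi (resp. psi) end to end gives a subdivision of a
   segment at every point; the join is read off the common refinement. *)
Definition fjoin (x : I * J) y :=
  Num.min (fhi phi x.1 y) (fhi psi x.2 y) - Num.max (flo phi x.1 y) (flo psi x.2 y).

Lemma continuous_bigsum (K : Type) (s : seq K) (P : pred K) (F : K -> Y -> R) :
  (forall i, continuous (F i)) -> continuous (fun x => \sum_(i <- s | P i) F i x).
Proof.
move=> cF; elim: s => [|i s IH].
  by under eq_fun do rewrite big_nil; exact: continuous_const.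
under eq_fun do rewrite big_cons.
by have [_|//] := boolP (P i); exact: continuous_addr.
Qed.

Lemma continuous_flo (K : finType) (f : K -> Y -> R) k :
  (forall k, continuous (f k)) -> continuous (flo f k).
Proof.
move=> cf; apply: continuous_bigsum => l.
by apply: continuous_maxr => //; exact: continuous_const.
Qed.

Lemma fhi_flo (K : finType) (f : K -> Y -> R) (k l : K) y :
  (enum_rank k < enum_rank l)%N -> fhi f k y <= flo f l y.
Proof.
move=> kl; rewrite /fhi /flo [leRHS](bigD1 k)//= [leLHS]addrC lerD2l.
rewrite [leRHS]big_mkcond [leLHS]big_mkcond/=; apply: ler_sum => m _.
have m0 : 0 <= Num.max 0 (f m y) by rewrite le_max lexx.
case: ifP => mk; last by case: ifP.
rewrite (ltn_trans mk kl) /=; case: eqP mk => // ->; by rewrite ltnn.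
Qed.

Lemma fhi_gt_flo (K : finType) (f : K -> Y -> R) k y : flo f k y < fhi f k y -> 0 < f k y.
Proof. by rewrite /fhi ltrDl lt_max ltxx. Qed.

Lemma flo_first (K : finType) (f : K -> Y -> R) y : (exists k, 0 < f k y) ->
  exists k, flo f k y = 0 /\ 0 < fhi f k y.
Proof.
move=> [k0 k0y].
case: (@arg_minnP _ k0 (fun k => 0 < f k y) (fun k => enum_rank k : nat) k0y) => k ky kmin.
have lo0 : flo f k y = 0.
  rewrite /flo big1// => l lk; apply/max_idPl; rewrite leNgt; apply/negP => /kmin.
  by rewrite leqNgt lk.
by exists k; split=> //; rewrite /fhi lo0 add0r lt_max ky orbT.
Qed.

Lemma fjoin_gt0 i j y : 0 < fjoin (i, j) y -> [/\ flo phi i y < fhi phi i y,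
  flo phi i y < fhi psi j y, flo psi j y < fhi phi i y & flo psi j y < fhi psi j y].
Proof. by rewrite /fjoin subr_gt0 /= lt_min !gt_max => /andP[/andP[-> ->] /andP[-> ->]]. Qed.

Lemma fjoin_sub i j y : 0 < fjoin (i, j) y -> 0 < phi i y /\ 0 < psi j y.
Proof. by move=> /fjoin_gt0[/fhi_gt_flo ? _ _ /fhi_gt_flo]. Qed.

(** The two segments may have different lengths, but the first nonempty intervals of both
    subdivisions start at 0 and therefore overlap. *)
Lemma fjoin_cover : fun_cover fjoin.
Proof.
split.
  move=> [i j]; apply: continuous_subr.
    by apply: continuous_minr; apply: continuous_addr;
      [exact/continuous_flo/cphi.1|apply: continuous_maxr; [exact: continuous_const|exact: cphi.1]|
       exact/continuous_flo/cpsi.1|apply: continuous_maxr; [exact: continuous_const|exact: cpsi.1]].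
  by apply: continuous_maxr; [exact/continuous_flo/cphi.1|exact/continuous_flo/cpsi.1].
move=> y; have [i [i0 i1]] := flo_first (cphi.2 y).
have [j [j0 j1]] := flo_first (cpsi.2 y).
by exists (i, j); rewrite /fjoin /= i0 j0 subr_gt0 lt_min !gt_max i1 j1.
Qed.

(** Overlapping intervals of two subdivisions form a staircase: advancing in one never goes back in
    the other. Hence multiplicity minus one is subadditive. *)
Lemma fmult_fjoin y : (fmult fjoin y < fmult phi y + fmult psi y)%N.
Proof.
apply: (@staircase_card _ _ (fun i => enum_rank i : nat) (fun j => enum_rank j : nat)).
- by move=> i i' /val_inj/enum_rank_inj.
- by move=> j j' /val_inj/enum_rank_inj.
- by move=> i j /= /fjoin_sub.
- move=> i j i' j' /= /fjoin_gt0[_ _ h1 _] /fjoin_gt0[_ h2 _ _] ii'.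
  rewrite leqNgt; apply/negP => jj'.
  have := fhi_flo phi y ii'; have := fhi_flo psi y jj'; lra.
- by rewrite addn_gt0 fmult_gt0.
Qed.
End Join.
End FunctionCovers.

Section CoverDimension.
Context (R : realType) (Y : topologicalType).
Implicit Types (A B : {fset set Y}) (d : nat).

Definition cover_mult B (y : Y) : nat := count (fun U => `[< U y >]) (enum_fset B).

Lemma sum_indic_mult B y : \sum_(U <- B) \1_U y = (cover_mult B y)%:R :> R.
Proof.
rewrite /cover_mult; elim: (enum_fset B) => [|U s IH]; first by rewrite big_nil.
by rewrite big_cons IH /= natrD; congr (_ + _); rewrite indicE.
Qed.

Definition dim_le A d := exists B,
  [/\ open_cover B, finer B A & forall y, (cover_mult B y <= d.+1)%N].

Lemma dim_le_open_cover A : open_cover A -> dim_le A #|` A|.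
Proof.
move=> oA; exists A; split=> //; first by move=> V VA; exists V.
by move=> y; apply: leqW; exact: count_size.
Qed.

Lemma dim_le_fun A d (I : finType) (phi : I -> Y -> R) : fun_cover phi ->
  (forall i, exists2 U, U \in A & [set y | 0 < phi i y] `<=` U) ->
  (forall y, (fmult phi y <= d.+1)%N) -> dim_le A d.
Proof.
move=> [cphi phi0] sphi mphi.
exists [fset [set y | (0 < phi i y)%R] | i in I]%fset; split.
- split; last first.
    apply/is_coverP => y; have [i iy] := phi0 y.
    by exists [set y | 0 < phi i y] => //; apply/imfsetP; exists i.
  move=> _ /imfsetP[i _ ->]; move/continuousP: (cphi i) => /(_ [set r | 0 < r]).
  by apply; exact: open_gt.
- by move=> _ /imfsetP[i _ ->]; exact: sphi.
- move=> y; apply: leq_trans (mphi y); rewrite /cover_mult -size_filter /fmult.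
  rewrite cardE -(size_map (fun i => [set y | 0 < phi i y])).
  apply: uniq_leq_size; first exact: filter_uniq (fset_uniq _).
  move=> U; rewrite mem_filter => /andP[/asboolP Uy /imfsetP[i _ Ui]].
  by apply/mapP; exists i => //; rewrite mem_enum inE; move: Uy; rewrite Ui.
Qed.

Lemma cover_dimE A : (exists y : Y, True) -> open_cover A ->
  exists d, [/\ cover_dim R A = (d%:R)%:E, dim_le A d & forall d', dim_le A d' -> (d <= d')%N].
Proof.
move=> [y0 _] oA.
have ex : exists d, `[< dim_le A d >] by exists #|` A|; apply/asboolP; exact: dim_le_open_cover.
case: (ex_minnP ex) => d /asboolP Ad dmin.
exists d; split=> //; last by move=> d' /asboolP; exact: dmin.
apply/eqP; rewrite eq_le; apply/andP; split.
  have [B [oB BA mB]] := Ad.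
  apply: (@le_trans _ _ (cover_ord R B)); first by apply: ereal_inf_lbound; exists B.
  rewrite /cover_ord leeBlDr// -EFinD natr1; apply: ge_ereal_sup => _ [y _ <-].
  by rewrite sum_indic_mult lee_fin ler_nat.
apply: le_ereal_inf_tmp => _ [B [oB BA] <-]; rewrite /cover_ord leeBrDr// -EFinD natr1.
(* For d = 0 minimality says nothing; the order is nonnegative because [y0] lies in some member of
   the cover. *)
case: d Ad dmin => [|d] Ad dmin.
  apply: (le_trans _ (ereal_sup_ubound _)); last by exists y0.
  rewrite sum_indic_mult lee_fin ler_nat -has_count.
  have [U UB Uy] := (is_coverP B).1 oB.2 y0.
  by apply/hasP; exists U => //; apply/asboolP.
have [mB|/existsNP[y /negP]] := pselect (forall y, (cover_mult B y <= d.+1)%N).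
  have : dim_le A d by exists B.
  by move=> /asboolP/dmin; rewrite ltnn.
rewrite -ltnNge => my; apply: (le_trans _ (ereal_sup_ubound _)); last by exists y.
by rewrite sum_indic_mult lee_fin ler_nat.
Qed.

End CoverDimension.

Section DimensionLimit.
Context (R : realType) (G : groupType) (Y : topologicalType) (a : contAction G Y).
Hypothesis Y0 : exists y : Y, True.
Hypothesis subord : forall A : {fset set Y}, open_cover A ->
  exists phi : A -> Y -> R, [/\ forall U, continuous (phi U),
    forall U y, 0 < phi U y -> (val U) y & forall y, exists U, 0 < phi U y].
Variables (A : {fset set Y}) (oA : open_cover A).
Implicit Types (E : {fset G}) (g : G) (d : nat).

(** The dimension is phrased with functions because that is the form in which joins add up;
    [along_dim_leP] shows that the value is unchanged. *)
Definition along_dim_le E d := exists (I : finType) (phi : I -> Y -> R),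
  [/\ fun_cover phi, forall i, along_small a E A [set y | 0 < phi i y] &
      forall y, (fmult phi y <= d.+1)%N].

Lemma along_dim_leP E d : along_dim_le E d <-> dim_le (cover_along a E A) d.
Proof.
split=> [[I [phi [cphi sphi mphi]]]|[B [oB BA mB]]].
  by apply: dim_le_fun cphi _ mphi => i; exact/cover_alongP.
have [phi [cphi sphi phi0]] := subord oB.
exists B, phi; split=> //.
  move=> U; have := (finer_along _ _ _ _).1 BA _ (valP U); apply: along_smallS => y.
  exact: sphi.
move=> y; apply: leq_trans (mB y); rewrite /fmult /cover_mult -size_filter.
rewrite cardE -(size_map val); apply: uniq_leq_size.
  by rewrite map_inj_uniq ?enum_uniq//; exact: val_inj.
move=> _ /mapP[U /[!mem_enum] /= Uy ->]; rewrite mem_filter.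
by apply/andP; split; [apply/asboolP; exact: sphi|exact: valP].
Qed.

Lemma along_dimP E : exists d, [/\ cover_dim R (cover_along a E A) = (d%:R)%:E, along_dim_le E d &
  forall d', along_dim_le E d' -> (d <= d')%N].
Proof.
have [d [h1 h2 h3]] := cover_dimE R Y0 (open_cover_along a E oA).
by exists d; split=> //; [exact/along_dim_leP|move=> d' /along_dim_leP; exact: h3].
Qed.

Definition along_dim E : nat := sval (cid (along_dimP E)).

Lemma cover_dim_along E : cover_dim R (cover_along a E A) = ((along_dim E)%:R)%:E.
Proof. by rewrite /along_dim; case: cid => d /= []. Qed.

Lemma along_dim_le_dim E : along_dim_le E (along_dim E).
Proof. by rewrite /along_dim; case: cid => d /= []. Qed.

Lemma along_dim_min E d : along_dim_le E d -> (along_dim E <= d)%N.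
Proof. by rewrite /along_dim; case: cid => d' /= [_ _]; apply. Qed.

Lemma along_dim0 : along_dim fset0 = 0%N.
Proof.
apply/eqP; rewrite -leqn0; apply: along_dim_min.
exists unit, (fun=> fun=> 1); split=> //.
- by split=> [i|y]; [exact: continuous_const|exists tt].
- by move=> y; rewrite (leq_trans (max_card _))// card_unit.
Qed.

Lemma along_dimU E E' : (along_dim (E `|` E')%fset <= along_dim E + along_dim E')%N.
Proof.
apply: along_dim_min; have [I [phi [cphi sphi mphi]]] := along_dim_le_dim E.
have [J [psi [cpsi spsi mpsi]]] := along_dim_le_dim E'.
exists (I * J)%type, (fjoin phi psi); split.
- exact: fjoin_cover.
- move=> [i j]; apply: along_smallS (along_smallU (sphi i) (spsi j)) => y /=.
  by move=> /fjoin_sub.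
- move=> y; rewrite -ltnS; apply: (leq_trans (fmult_fjoin psi cphi y)).
  by have := mphi y; have := mpsi y; lia.
Qed.

Lemma along_dim_rtransl_le E g : (along_dim (rtransl E g) <= along_dim E)%N.
Proof.
apply: along_dim_min; have [I [phi [cphi sphi mphi]]] := along_dim_le_dim E.
exists I, (fun i y => phi i (a g y)); split.
- split=> [i y|y]; last exact: cphi.2.
  by apply: continuous_comp; [exact: act_continuous|exact: cphi.1].
- by move=> i; exact: (along_small_rtransl (g := g) (sphi i)).
- by move=> y; exact: mphi.
Qed.

Lemma along_dim_rtransl E g : along_dim (rtransl E g) = along_dim E.
Proof.
apply/eqP; rewrite eqn_leq along_dim_rtransl_le/=.
by rewrite -{1}(rtranslK E g) along_dim_rtransl_le.
Qed.

Lemma along_dim_cvg (F : nat -> {fset G}) : folner R F ->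
  cvgn (fun n => (along_dim (F n))%:R / #|` F n|%:R : R).
Proof.
apply: (@ornstein_weiss R G (fun E => (along_dim E)%:R)) => //.
- by rewrite along_dim0.
- by move=> E E'; rewrite -natrD ler_nat along_dimU.
- by move=> E g; rewrite along_dim_rtransl.
Qed.

End DimensionLimit.

Section Limits.
Context (R : realType) (G : groupType) (Y : topologicalType) (a : contAction G Y).
Hypothesis Y0 : exists y : Y, True.
Variables (F : nat -> {fset G}) (FF : folner R F).

Lemma htop_term A : open_cover A ->
  limn (fun n => (ln (ncover (cover_along a (F n) A))%:R / #|` F n|%:R)%:E : \bar R)
  = (limn (fun n => logcov R a A (F n) / #|` F n|%:R))%:E.
Proof. by move=> oA; rewrite -EFin_lim//; exact: logcov_cvg. Qed.

Lemma htop_ge A : open_cover A ->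
  ((limn (fun n => logcov R a A (F n) / #|` F n|%:R))%:E <= htop R a F)%E.
Proof. by move=> oA; apply: ereal_sup_ubound; exists A => //; exact: htop_term. Qed.

Lemma htop_gt0 : (0 < htop R a F)%E ->
  exists A, open_cover A /\ 0 < limn (fun n => logcov R a A (F n) / #|` F n|%:R).
Proof.
move=> /ereal_sup_gt[_ [A oA <-]]; rewrite htop_term// lte_fin => h.
by exists A.
Qed.

Hypothesis subord : forall A : {fset set Y}, open_cover A ->
  exists phi : A -> Y -> R, [/\ forall U, continuous (phi U),
    forall U y, 0 < phi U y -> (val U) y & forall y, exists U, 0 < phi U y].

Lemma mdim_term A (oA : open_cover A) :
  limn (fun n => (cover_dim R (cover_along a (F n) A) * ((#|` F n|%:R)^-1)%:E)%E)
  = (limn (fun n => (along_dim a Y0 subord oA (F n))%:R / #|` F n|%:R : R))%:E.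
Proof.
rewrite -EFin_lim; last exact: along_dim_cvg.
by congr (limn _); apply/funext => n /=; rewrite cover_dim_along.
Qed.

Lemma mdim_ge A (oA : open_cover A) :
  ((limn (fun n => (along_dim a Y0 subord oA (F n))%:R / #|` F n|%:R : R))%:E <= mdim R a F)%E.
Proof. by apply: ereal_sup_ubound; exists A => //; exact: mdim_term. Qed.

Lemma mdim_gt0 : (0 < mdim R a F)%E ->
  exists A (oA : open_cover A),
    0 < limn (fun n => (along_dim a Y0 subord oA (F n))%:R / #|` F n|%:R : R).
Proof.
move=> /ereal_sup_gt[_ [A oA <-]]; rewrite (mdim_term oA) lte_fin => h.
by exists A, oA.
Qed.
End Limits.

(** * Zero entropy implies zero mean dimension of measures *)

Section SmallOscillation.
Context (R : realType) (Y : topologicalType) (K : finType) (u : K -> Y -> R).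

Lemma small_oscillation_cover01 (e : R) :
  (forall k, continuous (u k)) -> (forall k y, 0 <= u k y <= 1) -> 0 < e ->
  exists A : {fset set Y}, open_cover A /\
    forall V, V \in A -> forall x y, V x -> V y -> forall k, `|u k x - u k y| < e.
Proof.
move=> cu u01 e0; pose d := e / 2; have d0 : 0 < d by rewrite divr_gt0.
pose N := (Num.truncn d^-1).+1.
pose V (z : {ffun K -> 'I_N}) := [set y | forall k, `|u k y - (z k)%:R * d| < d].
exists [fset V z | z in {ffun K -> 'I_N}]%fset; split; last first.
  move=> _ /imfsetP[z _ ->] x y Vx Vy k.
  have := Vx k; have := Vy k; move: (u k x) (u k y) => p q.
  rewrite !ltr_norml [e]splitr -/d => /andP[? ?] /andP[? ?]; apply/andP; split; lra.
split.
  move=> _ /imfsetP[z _ ->].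
  pose w k y := d - `|u k y - (z k)%:R * d|.
  have cw k : continuous (w k).
    apply: continuous_subr; first exact: continuous_const.
    apply: continuous_normr; apply: continuous_subr => //; exact: continuous_const.
  rewrite openE => y Vy; apply: filter_forall => k.
  have : nbhs y (w k @^-1` [set t | 0 < t]).
    apply: open_nbhs_nbhs; split; last by rewrite /= /w subr_gt0; exact: Vy.
    by have /continuousP := cw k; apply; exact: open_gt.
  by apply: filterS => y'; rewrite /= /w subr_gt0.
apply/is_coverP => y.
have zlt k : (Num.truncn (u k y / d) < N)%N.
  rewrite ltnS; apply: le_truncn; have /andP[_ u1] := u01 k y.
  by rewrite ler_pdivrMr// mulVf ?gt_eqF.
exists (V [ffun k => Ordinal (zlt k)]); first by apply/imfsetP; exists [ffun k => Ordinal (zlt k)].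
move=> k; rewrite ffunE/=; have /andP[u0 _] := u01 k y.
have : 0 <= u k y / d by rewrite divr_ge0// ltW.
move=> /truncn_itv; rewrite -natr1 ler_pdivlMr// ltr_pdivrMr// => /andP[h1 h2].
by rewrite ltr_norml; apply/andP; split; lra.
Qed.

End SmallOscillation.

(** * Choice of grid shifts by counting *)

Section ThresholdChoice.
Local Open Scope nat_scope.

(** Exponential moment: for fixed c, the sum over all th of Q to the number of near coordinates is a
    product over k, with factors at most 2 Q since at most one q is near. If every th were bad for
    some c, the sum over c would be at least Q^|K| Q^s. *)
Lemma threshold_choice (C K : finType) (Q s : nat) (nr : C -> K -> 'I_Q -> bool) :
  (forall c k, #|[pred q | nr c k q]| <= 1) ->
  #|C| * (2 * Q) ^ #|K| < Q ^ #|K| * Q ^ s ->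
  exists th : {ffun K -> 'I_Q}, forall c, #|[pred k | nr c k (th k)]| < s.
Proof.
move=> nr1; apply: contraPP => /forallNP H; apply/negP; rewrite -leqNgt.
have Hc (th : {ffun K -> 'I_Q}) : exists c, s <= #|[pred k | nr c k (th k)]|.
  by have /existsNP[c /negP] := H th; rewrite -leqNgt => ?; exists c.
have [Q0|Q0] := posnP Q.
  have [K0|K0] := posnP #|K|.
    have th : {ffun K -> 'I_Q} by apply: finfun => k; have := card0_eq K0 k; rewrite !inE.
    have [c hc] := Hc th; rewrite K0 !expn0 muln1 mul1n.
    have -> : s = 0 by apply/eqP; rewrite -leqn0 (leq_trans hc)// (leq_trans (max_card _))// K0.
    by rewrite expn0; apply/card_gt0P; exists c.
  by rewrite Q0 (exp0n K0) mul0n.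
have E (c : C) : \sum_(th : {ffun K -> 'I_Q}) Q ^ #|[pred k | nr c k (th k)]| <= (2 * Q) ^ #|K|.
  rewrite (eq_bigr (fun th : {ffun K -> 'I_Q} => \prod_k Q ^ nr c k (th k))); last first.
    move=> th _; rewrite -expn_sum; congr (_ ^ _).
    rewrite -sum1_card [LHS]big_mkcond; apply: eq_bigr => k _.
    by rewrite unfold_in /=; case: (nr _ _ _).
  rewrite -(bigA_distr_bigA (fun k q => Q ^ nr c k q)).
  have -> : (2 * Q) ^ #|K| = \prod_(k : K) (2 * Q) by rewrite prod_nat_const.
  apply: leq_prod => k _.
  apply: (@leq_trans (\sum_(q < Q) (1 + Q * nr c k q))).
    by apply: leq_sum => q _; case: (nr c k q); rewrite ?expn1 ?expn0; lia.
  rewrite big_split/= sum1_card card_ord -big_distrr/= mul2n -addnn leq_add2l.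
  rewrite -[leqRHS]muln1 leq_mul2l; apply/orP; right.
  by apply: leq_trans (nr1 c k); rewrite -sum1_card [leqRHS]big_mkcond/=; apply: leq_sum => q _; rewrite unfold_in /=; case: (nr _ _ _).
apply: (@leq_trans (\sum_(th : {ffun K -> 'I_Q}) \sum_(c : C) Q ^ #|[pred k | nr c k (th k)]|)).
  rewrite -{1}[Q]card_ord -card_ffun -[#|{: _}|]sum1_card big_distrl/=.
  apply: leq_sum => th _; rewrite mul1n; have [c hc] := Hc th.
  by rewrite (bigD1 c)//= (leq_trans _ (leq_addr _ _))// leq_pexp2l.
rewrite exchange_big/= -sum_nat_const.
by apply: leq_sum => c _; exact: E.
Qed.

End ThresholdChoice.

(** * Empirical approximation of measures *)

Section Maurey.
Context (R : realType) (X : pmetricType R).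
Hypothesis cX : compact [set: X].
Variables (K : finType) (v : K -> X -> R) (mu : probability (borel X) R).
Hypothesis cv : forall k, continuous (v k).
Hypothesis v01 : forall k x, 0 <= v k x <= 1.

Lemma expect01 k : 0 <= expect mu (v k) <= 1.
Proof.
rewrite -{1}(expect_cst mu 0) -[X in _ && (_ <= X)](expect_cst mu 1).
by apply/andP; split; apply: expect_le => //; do ?[exact: continuous_cst];
  move=> x; case/andP: (v01 k x).
Qed.

(** Integrate over mu: the cross terms vanish and each variance is at most 1. The constant 2, where
    the mean gives 1, makes up for the strictness lost when the negated inequality is integrated. *)
Lemma maurey_step (S : K -> R) : exists y,
  \sum_k (S k + (v k y - expect mu (v k))) ^+ 2 <= \sum_k S k ^+ 2 + 2 * #|K|%:R.
Proof.
have [K0|K0] := posnP #|K|.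
  exists point; rewrite !big1 ?addr0 ?mulr_ge0// => k _; by have := card0_eq K0 k; rewrite !inE.
apply: contrapT => /forallNP H.
set E := fun k => expect mu (v k).
pose w x := \sum_k (S k ^+ 2 + (2 * S k * (v k x - E k) + (v k x - E k) ^+ 2)).
have wE x : w x = \sum_k (S k + (v k x - E k)) ^+ 2.
  by apply: eq_bigr => k _; rewrite sqrrD; ring.
have c1 k : continuous (fun x => v k x - E k).
  by apply: continuous_subr => //; exact: continuous_const.
have c2 k : continuous (fun x => 2 * S k * (v k x - E k)).
  by apply: continuous_mulr => //; exact: continuous_const.
have c3 k : continuous (fun x => (v k x - E k) ^+ 2).
  by under eq_fun do rewrite expr2; exact: continuous_mulr.
have c4 k : continuous (fun x => 2 * S k * (v k x - E k) + (v k x - E k) ^+ 2).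
  exact: continuous_addr.
have c5 k : continuous (fun x => S k ^+ 2 + (2 * S k * (v k x - E k) + (v k x - E k) ^+ 2)).
  by apply: continuous_addr => //; exact: continuous_const.
have cw : continuous w by apply: continuous_bigsum.
have lo : \sum_k S k ^+ 2 + 2 * #|K|%:R <= expect mu w.
  rewrite -[leLHS](expect_cst mu); apply: expect_le => //; first exact: continuous_cst.
  by move=> x; rewrite wE ltW// ltNge; apply/negP; exact: H.
have hi : expect mu w <= \sum_k S k ^+ 2 + #|K|%:R.
  rewrite (pl_sum (pos_linear_expect cX mu))//.
  have -> : #|K|%:R = \sum_(k : K) (1 : R) by rewrite sumr_const.
  rewrite -big_split/=; apply: ler_sum => k _.
  rewrite expectD//; last exact: continuous_const.
  rewrite expect_cst lerD2l expectD// expectZ//.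
  rewrite (plB (pos_linear_expect cX mu))//; last exact: continuous_const.
  rewrite expect_cst subrr mulr0 add0r -(expect_cst mu 1).
  apply: expect_le => //; first exact: continuous_cst.
  move=> x; have := v01 k x; have := expect01 k; rewrite -/(E k); nra.
have := le_trans lo hi; rewrite lerD2l; have : 0 < #|K|%:R :> R by rewrite ltr0n.
lra.
Qed.

(* Empirical approximation a la Maurey, without product measures: the sample
   points are chosen one at a time. *)
Lemma maurey m : exists y : nat -> X,
  \sum_k (\sum_(l < m) (v k (y l) - expect mu (v k))) ^+ 2 <= 2 * m%:R * #|K|%:R.
Proof.
elim: m => [|m [y IH]].
  exists (fun=> point); rewrite mulr0 mul0r big1// => k _.
  by rewrite big_ord0 expr0n.
have [z hz] := maurey_step (fun k => \sum_(l < m) (v k (y l) - expect mu (v k))).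
exists (fun l => if (l < m)%N then y l else z).
under eq_bigr => k _.
  rewrite big_ord_recr/= ltnn.
  under eq_bigr => l _ do rewrite ltn_ord.
  over.
apply: (le_trans hz); apply: (le_trans (lerD IH (lexx _))).
by rewrite -natr1; lra.
Qed.

(** Chebyshev's inequality for the counting measure on K. *)
Lemma maurey_count m (t : R) : (0 < m)%N -> 0 < t -> exists y : nat -> X,
  #|[pred k | t < `|m%:R^-1 * \sum_(l < m) v k (y l) - expect mu (v k)|]|%:R
   <= 2 * #|K|%:R / (m%:R * t ^+ 2).
Proof.
move=> m0 t0; have [y hy] := maurey m; exists y.
have mR : 0 < m%:R :> R by rewrite ltr0n.
rewrite ler_pdivlMr ?mulr_gt0 ?exprn_gt0//.
rewrite -(ler_pM2l mR).
apply: (@le_trans _ _ (2 * m%:R * #|K|%:R)); last by rewrite le_eqVlt; apply/orP; left; apply/eqP; ring.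
apply: le_trans hy.
rewrite -sum1_card natr_sum mulr_suml mulr_sumr big_mkcond/=.
apply: ler_sum => k _; rewrite inE; case: ifP => [lt|_]; last exact: sqr_ge0.
have -> : \sum_(l < m) (v k (y l) - expect mu (v k)) =
   m%:R * (m%:R^-1 * \sum_(l < m) v k (y l) - expect mu (v k)).
  rewrite sumrB sumr_const card_ord mulrBr mulrA divff ?gt_eqF// mul1r.
  by rewrite mulr_natl.
rewrite mul1r exprMn -[X in _ <= _ * X]real_normK ?num_real// mulrA -expr2 ler_wpM2l ?sqr_ge0//.
by rewrite ler_pXn2r ?nnegrE ?(ltW t0) ?(ltW lt).
Qed.

End Maurey.

Section IteratedJoin.
Context (R : realType) (Y : topologicalType).

Lemma iterated_join (K : eqType) (I : finType) (phi : K -> I -> Y -> R) (s : seq K) :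
  (forall k, fun_cover (phi k)) ->
  exists (J : finType) (psi : J -> Y -> R), [/\ fun_cover psi,
    forall j k, k \in s -> exists i, forall y, 0 < psi j y -> 0 < phi k i y &
    forall y, (fmult psi y <= 1 + \sum_(k <- s) (fmult (phi k) y - 1))%N].
Proof.
move=> cphi; elim: s => [|k s [J [psi [cpsi sub mpsi]]]].
  exists unit, (fun=> fun=> 1); split=> //.
    by split=> [i|y]; [exact: continuous_const|exists tt].
  by move=> y; rewrite big_nil (leq_trans (max_card _))// card_unit.
exists (I * J)%type, (fjoin (phi k) psi); split.
- exact: fjoin_cover.
- move=> [i j] k'; rewrite inE => /orP[/eqP ->|k's].
    by exists i => y /fjoin_sub[].
  by have [i' hi'] := sub j k' k's; exists i' => y /fjoin_sub[_ /hi'].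
- move=> y; rewrite -ltnS; apply: (leq_trans (fmult_fjoin psi (cphi k) y)).
  have := mpsi y; have := fmult_gt0 y (cphi k); rewrite big_cons; lia.
Qed.

End IteratedJoin.

(* The intervals of the q-th cover of [0, 1] have their ends on the grid
   q eta + eps Z. The Q grids are eta apart, so a number can be close to an end,
   and hence be covered twice, for at most one q. *)
Section ShiftedIntervals.
Context (R : realType).
Variables (Q : nat) (eta eps : R).
Hypotheses (Q0 : (0 < Q)%N) (eta0 : 0 < eta) (epsE : eps = Q%:R * eta).

Let eps0 : 0 < eps. Proof. by rewrite epsE mulr_gt0// ltr0n. Qed.
Let eta_eps : eta <= eps. Proof. by rewrite epsE ler_peMl ?ler1n// ltW. Qed.

Definition threshold (q j : nat) : R := (q + j * Q)%:R * eta.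

Lemma thresholdE q j : threshold q j = q%:R * eta + j%:R * eps.
Proof. by rewrite /threshold natrD natrM epsE; ring. Qed.

Definition near_threshold (t : R) (q : nat) (u : R) := exists j, `|u - threshold q j| < t.

Lemma near_threshold_unique (t : R) (c : R) : t <= eta / 2 ->
  (#|[pred q : 'I_Q | `[< near_threshold t q c >]]| <= 1)%N.
Proof.
move=> te; apply/card_le1P => q; rewrite unfold_in /= => /asboolP[j hj] q'.
rewrite unfold_in /=; apply/asboolP/idP => [[j' hj']|/eqP ->]; last by exists j.
have : `|threshold q j - threshold q' j'| < eta.
  rewrite (_ : _ - _ = (c - threshold q' j') - (c - threshold q j)); last by ring.
  by apply: le_lt_trans (ler_normB _ _) _; lra.
rewrite /threshold -mulrBl normrM (gtr0_norm eta0) -[ltRHS]mul1r ltr_pM2r//.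
rewrite ltr_norml => /andP[h1 h2].
have e1 : (q' + j' * Q < (q + j * Q).+1)%N by rewrite -(ltr_nat R) -natr1; lra.
have e2 : (q + j * Q < (q' + j' * Q).+1)%N by rewrite -(ltr_nat R) -natr1; lra.
have e : (q + j * Q = q' + j' * Q)%N by lia.
have := congr1 (modn ^~ Q) e; rewrite /= ![(_ + _ * Q)%N]addnC !modnMDl !modn_small// => qq.
by apply/eqP/val_inj.
Qed.

(** Interval 0 catches the numbers below the first threshold q eta; those above it need indices up
    to 1 + 1 / eps, rounded down. *)
Definition nbumps : nat := (Num.truncn (eps^-1)).+2.

Definition bump (q : nat) (z : 'I_nbumps) (u : R) : R :=
  eps / 2 + eta / 8 - `|u - (q%:R * eta + z%:R * eps - eps / 2)|.

Lemma bump_gt0 q z (u : R) : (0 < bump q z u) =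
  (q%:R * eta + z%:R * eps - eps - eta / 8 < u) && (u < q%:R * eta + z%:R * eps + eta / 8).
Proof.
rewrite /bump; move: (q%:R * eta) (z%:R * eps) (eps) (eta) => v w p t.
by rewrite subr_gt0 ltr_norml; apply/andP/andP => -[h1 h2]; split; lra.
Qed.

Lemma bump_cover q (u : R) : (q < Q)%N -> 0 <= u <= 1 -> exists z, 0 < bump q z u.
Proof.
have e1 := eta0; have e2 := eps0; have e3 := eta_eps.
move=> qQ /andP[u0 u1]; have q0 : 0 <= q%:R * eta by rewrite mulr_ge0// ltW.
have qe : q%:R * eta <= eps by rewrite epsE ler_pM2r// ler_nat ltnW.
have [lt|ge] := ltP u (q%:R * eta).
  by exists ord0; rewrite bump_gt0 mul0r; apply/andP; split; lra.
have w0 : 0 <= (u - q%:R * eta) / eps by rewrite divr_ge0 ?subr_ge0// ltW.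
have zlt : ((Num.truncn ((u - q%:R * eta) / eps)).+1 < nbumps)%N.
  rewrite /nbumps !ltnS; apply: le_truncn.
  by rewrite ler_pdivrMr// mulVf ?gt_eqF//; lra.
exists (Ordinal zlt); rewrite bump_gt0/= -natr1.
have := truncn_itv w0; rewrite -natr1 ler_pdivlMr// ltr_pdivrMr// => /andP[h1 h2].
apply/andP; split; lra.
Qed.

Lemma bump_mult q (u : R) :
  (#|[pred z | (0 < bump q z u)%R]| <= 1 + `[< near_threshold (eta / 8) q u >])%N.
Proof.
have e1 := eta0; have e2 := eps0; have e3 := eta_eps.
have [[z0 z0u]|no] := pselect (exists z, 0 < bump q z u); last first.
  rewrite eq_card0// => z; rewrite unfold_in/=; apply/negP => zu.
  by apply: no; exists z.
case: (@arg_minnP _ z0 (fun z => 0 < bump q z u) (fun z => z : nat) z0u) => {z0u}z1 z1u zmin.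
have key z : 0 < bump q z u -> (z == z1) || ((z == z1.+1 :> nat) && `[< near_threshold (eta / 8) q u >]).
  move=> zu; have := zmin _ zu; rewrite leq_eqVlt => /orP[/eqP/val_inj ->|lt].
    by rewrite eqxx.
  apply/orP; right; move: z1u zu; rewrite !bump_gt0 => /andP[a1 a2] /andP[b1 b2].
  have zz : z1.+1%:R * eps <= z%:R * eps by rewrite ler_pM2r// ler_nat.
  rewrite -natr1 in zz; apply/andP; split; last first.
    by apply/asboolP; exists z1; rewrite thresholdE ltr_norml; apply/andP; split; lra.
  rewrite eqn_leq lt andbT leqNgt; apply/negP => lt2.
  have : z1.+2%:R * eps <= z%:R * eps by rewrite ler_pM2r// ler_nat.
  rewrite -[z1.+2%:R]natr1 -natr1; lra.
rewrite cardE -(size_map val).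
apply: (@leq_trans (size (if `[< near_threshold (eta / 8) q u >] then [:: val z1; (val z1).+1] else [:: val z1]))); last by case: ifP.
apply: uniq_leq_size; first by rewrite map_inj_uniq ?enum_uniq//; exact: val_inj.
move=> _ /mapP[z + ->]; rewrite mem_enum unfold_in/= => /key/orP[/eqP ->|/andP[/eqP zz ->]].
  by case: ifP => _; rewrite mem_head.
by rewrite !inE; apply/orP; right; rewrite zz.
Qed.

Lemma bump_width q z (u u' : R) : 0 < bump q z u -> 0 < bump q z u' ->
  `|u - u'| < eps + eta / 4.
Proof.
rewrite !bump_gt0 => /andP[? ?] /andP[? ?].
by rewrite ltr_norml; apply/andP; split; lra.
Qed.

Lemma continuous_bump (T : topologicalType) q z (u : T -> R) : continuous u ->
  continuous (fun x => bump q z (u x)).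
Proof.
move=> cu; apply: continuous_subr; first exact: continuous_const.
by apply: continuous_normr; apply: continuous_subr => //; exact: continuous_const.
Qed.

End ShiftedIntervals.

Section ZeroEntropy.
Context (R : realType) (G : groupType) (X : pmetricType R) (a : contAction G X).
Hypothesis cX : compact [set: X].
Variables (F : nat -> {fset G}) (FF : folner R F).
Local Notation M := (borelProb X).

Lemma bexpect_push g (f : X -> R) (mu : M) : continuous f ->
  bexpect f (push a g mu) = bexpect (f \o a g) mu.
Proof.
move=> cf; have cfg : continuous (f \o a g).
  by move=> x; apply: continuous_comp; [exact: act_continuous|exact: cf].
exact: (@integrals_push R X G a g mu (exist _ f cf) cfg).
Qed.

Lemma borelProb_inhabited : exists mu : M, True.
Proof.
have pL : pos_linear (fun f : X -> R => f point) by split.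
by have [mu _] := riesz_representation cX pL; exists mu.
Qed.

Hypothesis zero : forall A : {fset set X}, open_cover A ->
  limn (fun n => logcov R a A (F n) / #|` F n|%:R) <= 0.

Lemma zero_entropy_dim (A : {fset set M}) (oA : open_cover A) (d : R) : 0 < d ->
  \forall n \near \oo,
    (along_dim (pushAction a) borelProb_inhabited (subordinate_functions cX) oA (F n))%:R
    <= d * #|` F n|%:R.
Proof.
move=> d0.
have [r [f [e [cf f01 e0 HA]]]] := borelProb_lebesgue_number01 cX oA.
(* Q is so large that s ln Q, with s > d |F_n| / 2, exceeds |F_n| + r |F_n|: the first term bounds
   the logarithm of the number of profiles, the second the factor 2^|K| in [threshold_choice]. *)
have [Q Q0 lnQ] : exists2 Q : nat, (0 < Q)%N & 2 * (2 + r%:R) / d <= ln Q%:R :> R.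
  exists (Num.truncn (expR (2 * (2 + r%:R) / d))).+1 => //.
  rewrite -ler_expR lnK ?posrE//; exact/ltW/truncnS_gt.
have QR : 1 <= Q%:R :> R by rewrite ler1n.
pose eta : R := e / 2 / Q%:R.
have Q0' : 0 < Q%:R :> R by rewrite ltr0n.
have eta0 : 0 < eta by rewrite !divr_gt0.
have Qeta : Q%:R * eta = e / 2 by rewrite /eta mulrC divfK// gt_eqF.
have eta_le : eta <= e / 2 by rewrite ler_pdivrMr// ler_peMr// divr_ge0// ltW.
(* Sampling, replacement by centres and closeness to a threshold cost tau each, and 3 tau < 4 tau =
   eta / 2, the radius within which the Q grids do not interfere. *)
pose tau := eta / 8; have tau0 : 0 < tau by rewrite divr_gt0.
(* With m sample points Maurey's estimate fails for at most d |F_n| / 2 of the r |F_n| functions. *)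
pose m := (Num.truncn (4 * r%:R / (d * tau ^+ 2))).+1.
have m_ge : 2 * r%:R / (m%:R * tau ^+ 2) <= d / 2.
  have : 4 * r%:R / (d * tau ^+ 2) <= m%:R by exact/ltW/truncnS_gt.
  have dt : 0 < d * tau ^+ 2 by rewrite mulr_gt0// exprn_gt0.
  have t2 : 0 < tau ^+ 2 by rewrite exprn_gt0.
  have mt : 0 < m%:R * tau ^+ 2 by rewrite mulr_gt0// ltr0n.
  rewrite ler_pdivrMr// => h; rewrite ler_pdivrMr//.
  have -> : d / 2 * (m%:R * tau ^+ 2) = (m%:R * (d * tau ^+ 2)) / 2 by ring.
  rewrite ler_pdivlMr//; apply: le_trans h.
  by have -> : 2 * r%:R * 2 = 4 * r%:R :> R by ring.
have [B [oB oscB]] := small_oscillation_cover01 (fun i : 'I_r => cf i) (fun i => f01 i) tau0.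
have lz : \forall n \near \oo, logcov R a B (F n) / #|` F n|%:R < m%:R^-1.
  have /cvg_ex[l lB] := @logcov_cvg R G X a (ex_intro _ point Logic.I) B oB F FF.
  have l0 : l <= 0 by have := zero oB; rewrite (cvg_lim _ lB).
  by apply: (cvgr_lt l lB); rewrite (le_lt_trans l0)// invr_gt0.
apply: filterS lz => n hn.
have n0 : 0 < #|` F n|%:R :> R by rewrite ltr0n cardfs_gt0; exact: FF.1.
set E := F n in hn n0 *.
have [C [cC sC Cn]] := ncover_along_attained a oB E.
pose K := ('I_r * E)%type.
have cardK : #|{: K}| = (r * #|` E|)%N by rewrite card_prod card_ord cardfE.
pose v (k : K) x := f k.1 (a (val k.2) x).
have cv k : continuous (v k).
  by move=> x; apply: continuous_comp; [exact: act_continuous|exact: cf].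
have v01 k x : 0 <= v k x <= 1 by exact: f01.
(* Each sample point is replaced by a representative of a member of C containing it; this leaves at
   most |C|^m profiles, independently of mu. *)
have /choice[ctr hctr] : forall V : C, exists x : X, (val V !=set0 -> val V x).
  move=> V; have [[x Vx]|nV] := pselect (val V !=set0); first by exists x.
  by exists point.
pose center (w : {ffun 'I_m -> C}) k := m%:R^-1 * \sum_(l < m) v k (ctr (w l)).
pose s := (Num.truncn (d * #|` E|%:R / 2)).+1.
have dn0 : 0 <= d * #|` E|%:R / 2 by rewrite divr_ge0// mulr_ge0// ltW.
have [th hth] : exists th : {ffun K -> 'I_Q}, forall w : {ffun 'I_m -> C},
    (#|[pred k | `[< near_threshold Q eta (eta / 2) (th k) (center w k) >]]| < s)%N.
  apply: (@threshold_choice _ _ _ s (fun w k q => `[< near_threshold Q eta (eta / 2) q (center w k) >])).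
    by move=> w k; exact: near_threshold_unique.
  rewrite card_ffun card_ord -cardfE Cn expnMn mulnA [ltnLHS]mulnC ltn_pmul2l ?expn_gt0 ?Q0//.
  set N := ncover _ in hn *; have N0 : (0 < N)%N.
    by apply: ncover_gt0; [exists point|exact: (open_cover_along _ _ oB).2].
  rewrite -(ltr_nat R) natrM !natrX -ltr_ln ?posrE ?mulr_gt0 ?exprn_gt0 ?ltr0n//.
  rewrite lnM ?posrE ?exprn_gt0 ?ltr0n// !lnXn ?ltr0n//.
  have h1 : ln (N%:R : R) *+ m <= #|` E|%:R :> R.
    move: hn; rewrite /logcov -/N ltr_pdivrMr// => hn.
    have mR : 0 < m%:R :> R by rewrite ltr0n.
    have -> : ln (N%:R : R) *+ m = m%:R * ln (N%:R : R) :> R by rewrite mulr_natl.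
    by have := ltW hn; rewrite -(ler_pM2l mR) mulrA divff ?gt_eqF// mul1r.
  have h2 : ln (2%:R : R) *+ #|{: K}| <= r%:R * #|` E|%:R :> R.
    have -> : ln (2%:R : R) *+ #|{: K}| = ln (2%:R : R) * #|{: K}|%:R by rewrite mulr_natr.
    rewrite cardK natrM ler_piMl ?mulr_ge0//.
    by rewrite -[leRHS]expRK ler_ln ?posrE ?expR_gt0//; have := @expR_ge1Dx R 1; lra.
  have h3 : (2 + r%:R) * #|` E|%:R <= ln (Q%:R : R) *+ s :> R.
    have -> : ln (Q%:R : R) *+ s = ln (Q%:R : R) * s%:R :> R by rewrite mulr_natr.
    have s_ge : d * #|` E|%:R / 2 <= s%:R by exact/ltW/truncnS_gt.
    have lnQ0 : 0 <= ln Q%:R :> R by exact: ln_ge0.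
    apply: le_trans (ler_wpM2l lnQ0 s_ge).
    have := lnQ; rewrite ler_pdivrMr// => lnQ'.
    nra.
  lra.
pose phi (k : K) z (mu : M) := bump eta (eps := e / 2) (th k) z (bexpect (v k) mu).
have cphi k : fun_cover (phi k).
  split; first by move=> z; apply: continuous_bump; exact: bexpect_continuous.
  move=> mu; apply: (bump_cover Q0 eta0 (esym Qeta)) => //; exact: expect01.
have [J [psi [cpsi sub mpsi]]] := iterated_join (enum {: K}) cphi.
rewrite -truncn_ge_nat; last by rewrite mulr_ge0// ltW.
apply: along_dim_min; exists J, psi; split=> //.
- move=> j g gE.
  have [[mu0 mu0j]|no] := pselect (exists mu, 0 < psi j mu); last first.
    have [mu _] := borelProb_inhabited; have [U UA _] := HA mu.
    by exists U => // nu nuj; exfalso; apply: no; exists nu.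
  have [U UA hU] := HA (push a g mu0); exists U => // mu muj; apply: hU => i ir.
  rewrite !bexpect_push//.
  have [z hz] := sub j (Ordinal ir, [` gE]%fset) (mem_enum _ _).
  have := bump_width (hz _ mu0j) (hz _ muj); rewrite distrC => h.
  apply: lt_le_trans h _; rewrite /=; lra.
- move=> mu; apply: leq_trans (mpsi mu) _; rewrite add1n ltnS.
  apply: (@leq_trans #|[pred k | `[< near_threshold Q eta tau (th k) (bexpect (v k) mu) >]]|).
    rewrite -sum1_card [leqRHS]big_mkcond/= big_enum/=; apply: leq_sum => k _.
    rewrite leq_subLR; apply: leq_trans (bump_mult Q0 eta0 (esym Qeta) (th k) (bexpect (v k) mu)) _.
    by rewrite leq_add2l unfold_in/= -/tau; case: asboolP.
  rewrite truncn_ge_nat; last by rewrite mulr_ge0// ltW.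
  have [y hy] := @maurey_count R X cX K v (sval mu) cv v01 m tau (ltn0Sn _) tau0.
  have /choice[w hw] : forall l : 'I_m, exists V : C, (val V) (y l).
    move=> l; have [V VC Vy] := (is_coverP C).1 cC (y l).
    by exists [` VC]%fset.
  have wc k : `|center (finfun w) k - m%:R^-1 * \sum_(l < m) v k (y l)| <= tau.
    have mR : 0 < m%:R :> R by rewrite ltr0n.
    rewrite /center -mulrBr -sumrB normrM ger0_norm ?invr_ge0//.
    rewrite ler_pdivrMl//; apply: le_trans (ler_norm_sum _ _ _) _.
    have -> : m%:R * tau = \sum_(l < m) tau by rewrite sumr_const card_ord mulr_natl.
    apply: ler_sum => l _; rewrite ffunE.
    have VC := valP (w l); have [U UB VU] := sC _ VC _ (valP k.2).
    apply/ltW/(oscB U UB); apply: VU; last exact: hw.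
    by apply: hctr; exists (y l); exact: hw.
  pose bad k := tau < `|m%:R^-1 * \sum_(l < m) v k (y l) - bexpect (v k) mu|.
  pose nearc k := `[< near_threshold Q eta (eta / 2) (th k) (center (finfun w) k) >].
  (* Off the badly sampled coordinates the mean under mu, the sample mean and the centre differ by
     at most tau each, so closeness to a threshold passes from the measure to its profile. *)
  have le1 : (#|[pred k | `[< near_threshold Q eta tau (th k) (bexpect (v k) mu) >]]| <=
              #|[pred k | bad k]| + #|[pred k | nearc k]|)%N.
    rewrite -cardUI; apply: leq_trans (leq_addr _ _); apply: subset_leq_card.
    apply/fintype.subsetP => k; rewrite !unfold_in/= => /asboolP[j hj].
    have [//|nb] := boolP (bad k); apply/asboolP; exists j.
    move: nb; rewrite -leNgt => nb; have wk := wc k.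
    rewrite (_ : _ - _ = (center (finfun w) k - m%:R^-1 * \sum_(l < m) v k (y l)) +
      ((m%:R^-1 * \sum_(l < m) v k (y l) - bexpect (v k) mu) +
       (bexpect (v k) mu - threshold Q eta (th k) j))); last by ring.
    apply: le_lt_trans (ler_normD _ _) _.
    have h2 := ler_normD (m%:R^-1 * \sum_(l < m) v k (y l) - bexpect (v k) mu)
       (bexpect (v k) mu - threshold Q eta (th k) j).
    have : eta / 2 = 4 * tau by rewrite /tau; field.
    move: h2 wk nb hj tau0; clear; move: (tau) => t; lra.
  apply: (@le_trans _ _ (#|[pred k | bad k]|%:R + #|[pred k | nearc k]|%:R)).
    by rewrite -natrD ler_nat.
  have b1 : #|[pred k | bad k]|%:R <= d / 2 * #|` E|%:R.
    apply: (le_trans hy); rewrite cardK natrM mulrA mulrAC ler_wpM2r//.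
  have b2 : #|[pred k | nearc k]|%:R <= d * #|` E|%:R / 2.
    by rewrite -truncn_ge_nat// -ltnS; exact: hth.
  lra.
Qed.

Lemma zero_entropy_mdim (A : {fset set M}) (oA : open_cover A) :
  limn (fun n => (along_dim (pushAction a) borelProb_inhabited
    (subordinate_functions cX) oA (F n))%:R / #|` F n|%:R : R) <= 0.
Proof.
apply/ler_addgt0Pr => d d0; rewrite add0r; apply: limr_le.
  exact: along_dim_cvg.
apply: filterS (zero_entropy_dim oA d0) => n; rewrite ler_pdivrMr//.
by rewrite ltr0n cardfs_gt0; exact: FF.1.
Qed.

End ZeroEntropy.

(** * Independence from positive entropy *)

Section SparseCount.
Local Open Scope nat_scope.

(** Give [None] the weight L and each value the weight 1: all maps together weigh (L + |V|)^|K|, and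
    a sparse one weighs at least L^(|K| - s). *)
Lemma sparse_count (K V : finType) (L s : nat) : 0 < L ->
  #|[set w : {ffun K -> option V} | #|[pred k | isSome (w k)]| <= s]%SET| * L ^ #|K|
  <= L ^ s * (L + #|V|) ^ #|K|.
Proof.
move=> L0.
have -> : (L + #|V|) ^ #|K| =
    \sum_(w : {ffun K -> option V}) \prod_k (if isSome (w k) then 1 else L).
  rewrite -(bigA_distr_bigA (fun (k : K) (v : option V) => if isSome v then 1 else L)).
  rewrite -prod_nat_const; apply: eq_bigr => k _.
  rewrite (bigD1 None)//=; congr addn.
  rewrite (eq_bigr (fun=> 1)); last by case.
  by rewrite sum1_card (cardC1 (None : option V)) card_option.
have PE (w : {ffun K -> option V}) :
    \prod_k (if isSome (w k) then 1 else L) = L ^ (#|K| - #|[pred k | isSome (w k)]|).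
  rewrite (eq_bigr (fun k => L ^ ~~ isSome (w k))); last first.
    by move=> k _; case: (w k).
  rewrite -expn_sum; congr (_ ^ _).
  have -> : #|[pred k | isSome (w k)]| = \sum_k isSome (w k).
    by rewrite -sum1_card [LHS]big_mkcond; apply: eq_bigr => k _; rewrite unfold_in/=; case: (w k).
  have -> : #|K| = \sum_k (isSome (w k) + ~~ isSome (w k)).
    by rewrite -sum1_card; apply: eq_bigr => k _; case: (w k).
  by rewrite big_split/= addKn.
rewrite -sum1_card big_distrl/= big_distrr/= [leqRHS](bigID [pred w : {ffun K -> option V} | #|[pred k | isSome (w k)]| <= s])/=.
apply: leq_trans (leq_addr _ _).
rewrite (eq_bigl [pred w : {ffun K -> option V} | #|[pred k | isSome (w k)]| <= s]); last first.
  by move=> w; rewrite !inE /=.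
apply: leq_sum => w /= ws; rewrite PE mul1n -expnD leq_pexp2l//.
by rewrite addnC -leq_subLR subKn ?max_card.
Qed.

Lemma sparse_count_set (K : finType) (L s : nat) : 0 < L ->
  #|[set J : {set K} | #|J| <= s]%SET| * L ^ #|K| <= L ^ s * L.+1 ^ #|K|.
Proof.
move=> L0; have := @sparse_count K unit L s L0; rewrite card_unit addn1.
apply: leq_trans; rewrite leq_mul2r; apply/orP; right.
pose h (J : {set K}) : {ffun K -> option unit} := [ffun k => if k \in J then Some tt else None].
have hinj : injective h.
  move=> J J' /ffunP e; apply/setP => k; have := e k; rewrite !ffunE.
  by do 2 case: (_ \in _).
rewrite -(card_imset _ hinj); apply: subset_leq_card; apply/fintype.subsetP => _ /imsetP[J + ->].
rewrite !inE; apply: leq_trans; apply: subset_leq_card; apply/fintype.subsetP => k.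
by rewrite unfold_in/= ffunE; case: (k \in J).
Qed.

End SparseCount.

(** * Shattering by partially defined patterns *)

Section Shattering.
Local Open Scope nat_scope.
Variables (K T : finType) (p0 p1 : T -> K -> bool).
Hypothesis excl : forall x k, ~~ (p0 x k && p1 x k).
Implicit Types (P : {set T}) (J S : {set K}).

Definition conflicts x y := [pred k | p0 x k && p1 y k || p1 x k && p0 y k].

Definition shatters P J :=
  [forall S : {set K}, exists x in P, forall k in J, if k \in S then p1 x k else p0 x k].

Definition shattered P := [set J | shatters P J]%SET.

Lemma shattersP P J : reflect
  (forall S : {set K}, exists2 x, x \in P & forall k, k \in J -> if k \in S then p1 x k else p0 x k)
  (shatters P J).
Proof.
apply: (iffP forallP) => h S.
  by have /existsP[x /andP[xP /forall_inP]] := h S; exists x.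
by have [x xP hx] := h S; apply/existsP; exists x; rewrite xP; apply/forall_inP.
Qed.

Lemma shatteredS P P' : P \subset P' -> shattered P \subset shattered P'.
Proof.
move=> PP; apply/fintype.subsetP => J; rewrite !inE => /shattersP h.
by apply/shattersP => S; have [x xP hx] := h S; exists x => //; exact: (fintype.subsetP PP).
Qed.

(* Pajor: if both halves shatter J then P shatters J and k |: J. *)
Lemma shattered_split P k :
  #|shattered [set x in P | p0 x k]%SET| + #|shattered [set x in P | p1 x k]%SET| <= #|shattered P|.
Proof.
set P0 := [set x in P | p0 x k]%SET; set P1 := [set x in P | p1 x k]%SET.
have sub0 : P0 \subset P by apply/fintype.subsetP => x; rewrite inE => /andP[].
have sub1 : P1 \subset P by apply/fintype.subsetP => x; rewrite inE => /andP[].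
have nk0 J : J \in shattered P0 -> k \notin J.
  rewrite inE => /shattersP/(_ [set: K]%SET)[x]; rewrite inE => /andP[_ x0] h.
  by apply/negP => /h; rewrite inE => x1; have := excl x k; rewrite x0 x1.
have nk1 J : J \in shattered P1 -> k \notin J.
  rewrite inE => /shattersP/(_ finset.set0)[x]; rewrite inE => /andP[_ x1] h.
  by apply/negP => /h; rewrite inE => x0; have := excl x k; rewrite x0 x1.
rewrite -cardsUI -(@card_in_imset _ _ (fun J => (k |: J)%SET) (shattered P0 :&: shattered P1)%SET); last first.
  move=> J J' /setIP[/nk0 kJ _] /setIP[/nk0 kJ' _] e.
  by rewrite -(setU1K kJ) e setU1K.
rewrite -cardsUI.
have -> : (shattered P0 :|: shattered P1) :&: [set k |: J | J in shattered P0 :&: shattered P1]%SET = finset.set0.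
  apply/setP => J; rewrite !inE; apply/negP => /andP[J01 /imsetP[J' _ e]].
  have kJ : k \in J by rewrite e !inE eqxx.
  by case/orP: J01 => h; [have := nk0 J|have := nk1 J]; rewrite inE h kJ => /(_ isT).
rewrite cards0 addn0; apply: subset_leq_card; apply/fintype.subsetP => J.
case/setUP=> [/setUP[]|/imsetP[J' /setIP[J0 J1] ->]].
- exact: (fintype.subsetP (shatteredS sub0)).
- exact: (fintype.subsetP (shatteredS sub1)).
rewrite inE; apply/shattersP => S; have [kS|kS] := boolP (k \in S).
  move: J1; rewrite inE => /shattersP/(_ S)[x]; rewrite inE => /andP[xP x1] h.
  exists x => // l; rewrite !inE => /orP[/eqP ->|/h//]; by rewrite kS.
move: J0; rewrite inE => /shattersP/(_ S)[x]; rewrite inE => /andP[xP x0] h.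
exists x => // l; rewrite !inE => /orP[/eqP ->|/h//]; by rewrite (negbTE kS).
Qed.

(** Average over k the number of ordered pairs of P in conflict at k, which is twice the product of
    the sizes of the two halves. *)
Lemma conflict_pigeonhole P b : 0 < #|K| ->
  (forall x y, x \in P -> y \in P -> x != y -> #|K| <= b * #|conflicts x y|) ->
  exists k, #|P|.-1 * #|P| <= 2 * b * (#|[set x in P | p0 x k]%SET| * #|[set x in P | p1 x k]%SET|).
Proof.
move=> K0 sep; apply: contrapT => /forallNP H.
pose A k := [set x in P | p0 x k]%SET; pose B k := [set x in P | p1 x k]%SET.
have lt k : 2 * b * (#|A k| * #|B k|) < #|P|.-1 * #|P|.
  by rewrite ltnNge; apply/negP; exact: H.
have [k0 _] : exists k0 : K, true by move: K0 => /card_gt0P[k0 _]; exists k0.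
have sumlt : \sum_k 2 * b * (#|A k| * #|B k|) < \sum_(k : K) #|P|.-1 * #|P|.
  rewrite (bigD1 k0)//= [ltnRHS](bigD1 k0)//= -addSn leq_add//.
  by apply: leq_sum => k _; exact: ltnW.
move: sumlt; rewrite sum_nat_const ltnNge => /negP; apply.
have cE k : \sum_(x in P) \sum_(y in P) (p0 x k && p1 y k : nat) = #|A k| * #|B k|.
  rewrite -[#|A k|]sum1_card big_distrl/= [LHS]big_mkcond [RHS]big_mkcond/=.
  apply: eq_bigr => x _; rewrite [x \in A k]inE.
  case: (x \in P) => //=; case: (p0 x k) => /=; last by rewrite big1.
  rewrite mul1n -sum1_card [LHS]big_mkcond [RHS]big_mkcond/=; apply: eq_bigr => y _.
  by rewrite inE; case: (y \in P); case: (p1 y k).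
have cE' k : \sum_(x in P) \sum_(y in P) (p1 x k && p0 y k : nat) = #|A k| * #|B k|.
  rewrite exchange_big/= -cE; apply: eq_bigr => x _; apply: eq_bigr => y _.
  by rewrite andbC.
apply: (@leq_trans (b * \sum_(x in P) \sum_(y in P) #|conflicts x y|)).
  rewrite big_distrr/=.
  apply: (@leq_trans (\sum_(x in P) #|P|.-1 * #|K|)).
    by rewrite sum_nat_const mulnCA [#|P| * (_ * _)]mulnCA leq_mul2l [#|K| * _]mulnC leqnn orbT.
  apply: leq_sum => x xP; rewrite big_distrr/= (bigD1 x)//=.
  apply: leq_trans (leq_addl _ _).
  rewrite (cardsD1 x P) xP /= -sum_nat_const.
  rewrite (eq_bigl [pred y | (y \in P) && (y != x)]); last by move=> y; rewrite !inE andbC.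
  by apply: leq_sum => y /= /andP[yP yx]; apply: sep => //; rewrite eq_sym.
have -> : \sum_k 2 * b * (#|A k| * #|B k|) =
   b * \sum_k (\sum_(x in P) \sum_(y in P) (p0 x k && p1 y k + p1 x k && p0 y k)).
  rewrite big_distrr/=; apply: eq_bigr => k _.
  under eq_bigr => x _ do rewrite big_split/=.
  by rewrite big_split/= cE cE'; lia.
rewrite leq_mul2l; apply/orP; right.
rewrite [leqRHS]exchange_big/=; apply: leq_sum => x _.
rewrite [leqRHS]exchange_big/=; apply: leq_sum => y _.
rewrite -sum1_card big_mkcond/=; apply: leq_sum => k _; rewrite unfold_in/=.
by do 2 case: (_ && _).
Qed.

(** A point may satisfy neither p0 nor p1 at k and then drops out of both halves, so the induction
    for total patterns would lose points. A coordinate given by pigeonhole keeps a fraction 1 / (4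
    b) of P in each half; the 4 is 2 doubled, from |P| - 1 >= |P| / 2. *)
Lemma shattered_large P b j : 0 < #|K| -> 0 < b ->
  (forall x y, x \in P -> y \in P -> x != y -> #|K| <= b * #|conflicts x y|) ->
  (4 * b) ^ j <= #|P| -> 2 ^ j <= #|shattered P|.
Proof.
move=> K0 b0; elim: j P => [|j IH] P sep.
  rewrite expn0 => /card_gt0P[x xP]; rewrite expn0; apply/card_gt0P; exists finset.set0.
  rewrite inE; apply/shattersP => S; exists x => //.
  by move=> k; rewrite finset.in_set0.

move=> Pj; have [k hk] := conflict_pigeonhole K0 sep.
set a0 := #|[set x in P | p0 x k]%SET| in hk; set a1 := #|[set x in P | p1 x k]%SET| in hk.
have a0P : a0 <= #|P| by apply: subset_leq_card; apply/fintype.subsetP => x; rewrite inE => /andP[].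
have a1P : a1 <= #|P| by apply: subset_leq_card; apply/fintype.subsetP => x; rewrite inE => /andP[].
have P2 : 4 * b <= #|P|.
  by apply: leq_trans Pj; rewrite expnS leq_pmulr// expn_gt0 muln_gt0 b0.
have P0 : 0 < #|P| by lia.
have ge (x y : nat) : x <= #|P| -> #|P|.-1 * #|P| <= 2 * b * (y * x) -> (4 * b) ^ j <= y.
  move=> xP h; have : #|P|.-1 <= 2 * b * y.
    rewrite -(leq_pmul2r P0); apply: (leq_trans h); rewrite mulnA leq_mul2l xP orbT//.
  move=> h'; have : (4 * b) * (4 * b) ^ j <= 4 * b * y by rewrite -expnS; lia.
  by rewrite leq_pmul2l// muln_gt0 b0.
apply: leq_trans (shattered_split P k); rewrite expnS mul2n -addnn.
apply: leq_add; apply: IH.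
- by move=> x y; rewrite !inE => /andP[xP _] /andP[yP _]; exact: sep.
- exact: (ge a1).
- by move=> x y; rewrite !inE => /andP[xP _] /andP[yP _]; exact: sep.
- by apply: (ge a0) => //; rewrite [a1 * _]mulnC.
Qed.

End Shattering.

Section Independence.
Context (R : realType) (G : groupType) (X : pmetricType R) (a : contAction G X).
Hypothesis cX : compact [set: X].

Lemma continuous_mdist (z : X) : continuous (fun x => mdist x z : R).
Proof.
move=> x; apply/cvgrPdist_lt => e e0; near=> y.
have xy : mdist x y < e by near: y; have := nbhsx_ballx x e e0; rewrite ballEmdist.
have := metric_triangle x y z; have := metric_triangle y x z.
by rewrite (metric_sym y x) ltr_norml => *; apply/andP; split; lra.
Unshelve. all: by end_near.
Qed.

Lemma separating_functions (e : R) : 0 < e -> exists (r : nat) (f : nat -> X -> R),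
  [/\ (0 < r)%N, forall k, continuous (f k), forall k x, 0 <= f k x <= 1 &
   forall u v, e <= mdist u v -> exists2 i, (i < r)%N & f i u = 0 /\ f i v = 1].
Proof.
move=> e0; have e4 : 0 < e / 4 by rewrite divr_gt0.
have := cX; rewrite compact_cover => /(_ X setT (fun z => [set x | mdist x z < e / 4])).
case=> [z _|x _|D _ cD].
- have /continuousP := @continuous_mdist z => /(_ [set t | t < e / 4]); apply; exact: open_lt.
- by exists x => //=; rewrite mdistxx.
have [z /= zD _] := cD point Logic.I.
(* The value is 0 within e / 4 of the centre and 1 from distance 3 e / 4 on; if u is within e / 4
   and v at distance at least e from u, then v is in the second range. *)
pose f k x := clamp (2 / e * mdist x (nth z (enum_fset D) k) - 2^-1).
exists #|` D|, f; split.
- by rewrite cardfs_gt0; apply/fset0Pn; exists z.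
- move=> k; apply: continuous_minr; first exact: continuous_const.
  apply: continuous_maxr; first exact: continuous_const.
  apply: continuous_subr; last exact: continuous_const.
  by apply: continuous_mulr; [exact: continuous_const|exact: continuous_mdist].
- by move=> k x; rewrite /f /clamp le_min ler01 le_max lexx ge_min lexx.
move=> u v uv; have [w /= wD uw] := cD u Logic.I.
exists (index w (enum_fset D)); first by rewrite index_mem.
rewrite /f nth_index//; split.
  have : 2 / e * mdist u w <= 2^-1.
    by rewrite mulrAC ler_pdivrMr//; lra.
  by move=> h; rewrite /clamp (max_idPl _) ?(min_idPr _) ?subr_le0.
have vw : e * 3 / 4 <= mdist v w.
  by have := metric_triangle u w v; rewrite (metric_sym w v); lra.
have : 3 / 2 <= 2 / e * mdist v w.
  by rewrite mulrAC ler_pdivlMr//; lra.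
by move=> h; rewrite /clamp (max_idPr _) ?(min_idPl _); lra.
Qed.

Section Separated.
Variables (A : {fset set X}) (oA : open_cover A) (e : R).
Hypothesis HA : forall x, exists2 U, U \in A & ball x e `<=` U.

Definition far (E : {fset G}) x y := [pred g : E | e <= mdist (a (val g) x) (a (val g) y)].

(** Itineraries relative to a reference orbit: [None] where the orbit stays e-close to it, [Some U]
    with a visited member of A at the few other places. *)
Definition sparse_maps (E : {fset G}) (c : nat) :=
  [set w : {ffun E -> option A} | (#|[pred g | isSome (w g)]| <= c)%N]%SET.

(** Greedy choice: if every point were close to one of the first M, the sets [V], one per earlier
    point and sparse itinerary, would refine the cover along E and be fewer than [ncover]. *)
Lemma separated_sequence (E : {fset G}) c M :
  (M * #|sparse_maps E c| < ncover (cover_along a E A))%N ->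
  exists x : nat -> X, forall i j, (i < j)%N -> (j < M)%N -> (c < #|far E (x i) (x j)|)%N.
Proof.
elim: M => [|M IH] lt; first by exists (fun=> point).
have [|x hx] := IH; first by apply: leq_ltn_trans lt; rewrite mulSn leq_addl.
have [y hy] : exists y, forall i, (i < M)%N -> (c < #|far E (x i) y|)%N.
  apply: contrapT => /forallNP H; move: lt; rewrite ltnNge => /negP; apply.
  apply: leq_trans (_ : M * #|sparse_maps E c| <= _)%N; last by rewrite mulSn leq_addl.
  pose V (p : 'I_M * {ffun E -> option A}) : set X := [set y | forall g : E,
    if p.2 g is Some U then (val U) (a (val g) y) else mdist (a (val g) (x p.1)) (a (val g) y) < e].
  pose B := [fset V p | p in finset.setX [set: 'I_M]%SET (sparse_maps E c)]%fset.
  apply: (@leq_trans #|` B|); last first.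
    apply: leq_trans (leq_imfset_card _ _ _) _.
    by rewrite -cardE cardsX cardsT card_ord.
  apply: ncover_finer; last first.
    apply/finer_along => _ /imfsetP[p _ ->] g gE.
    case pg : (p.2 [` gE]%fset) => [U|]; last first.
      have [U UA bU] := HA (a g (x p.1)); exists U => // y /= /(_ [` gE]%fset); rewrite pg.
      by move=> h; apply: bU; rewrite ballEmdist.
    by exists (val U); [exact: valP|move=> y /= /(_ [` gE]%fset); rewrite pg].
  apply/is_coverP => y; have /existsNP[i /not_implyP[iM /negP]] := H y.
  rewrite -leqNgt => ci.
  have /choice[u hu] : forall g : E, exists U : A, (val U) (a (val g) y).
    move=> g; have [U UA Uy] := (is_coverP A).1 oA.2 (a (val g) y).
    by exists [` UA]%fset.
  pose w : {ffun E -> option A} := [ffun g => if g \in far E (x i) y then Some (u g) else None].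
  exists (V (Ordinal iM, w)).
    apply/imfsetP; exists (Ordinal iM, w) => //=.
    rewrite !inE/=; apply: leq_trans ci; apply: subset_leq_card.
    by apply/fintype.subsetP => g; rewrite unfold_in/= ffunE; case: ifP.
  move=> g; rewrite ffunE; case: ifPn => [_|]; first exact: hu.
  by rewrite unfold_in/= -ltNge.
exists (fun k => if (k < M)%N then x k else y) => i j ij jM.
have iM : (i < M)%N by lia.
rewrite iM; case: ifP => [jM'|_]; [exact: hx|exact: hy].
Qed.

End Separated.

Lemma fiber_pigeonhole (K : finType) (r : nat) (J : {set K * 'I_r}) : (0 < r)%N ->
  exists i, (#|J| <= r * #|[set k | (k, i) \in J]%SET|)%N.
Proof.
move=> r0; apply: contrapT => /forallNP H.
have lt i : (r * #|[set k | (k, i) \in J]%SET| < #|J|)%N by rewrite ltnNge; apply/negP; exact: H.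
have cJ : #|J| = (\sum_(i < r) #|[set k | (k, i) \in J]%SET|)%N.
  rewrite -sum1_card big_mkcond/=.
  transitivity (\sum_(k : K) \sum_(i < r) if (k, i) \in J then 1 else 0)%N.
    by rewrite pair_bigA; apply: eq_bigr => -[].
  rewrite exchange_big/=; apply: eq_bigr => i _.
  by rewrite -big_mkcond -sum1dep_card.
have : (r * #|J| < r * #|J|)%N; last by rewrite ltnn.
rewrite {1}cJ big_distrr/=.
have -> : (r * #|J|)%N = (\sum_(i < r) #|J|)%N by rewrite sum_nat_const card_ord.
rewrite (bigD1 (Ordinal r0))//= [ltnRHS](bigD1 (Ordinal r0))//= -addSn leq_add//.
by apply: leq_sum => i _; exact: ltnW.
Qed.

Variables (F : nat -> {fset G}) (FF : folner R F).

(** In a small F n a relative boundary below 1 / (N + 1) amounts to less than one pair, hence to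
    none; then F n contains S x for any of its points x. *)
Lemma folner_card_infty : infinite_set [set: G] -> forall N, \forall n \near \oo, (N <= #|` F n|)%N.
Proof.
move=> infG N; have [S _ SN] := infinite_set_fset N infG.
have d0 : 0 < (N.+1%:R)^-1 :> R by rewrite invr_gt0.
apply: filterS (folner_bdry (enum_fset S) FF d0) => n hn.
rewrite leqNgt; apply/negP => small.
have b0 : bdry (enum_fset S) (F n) = 0%N.
  apply/eqP; rewrite -leqn0 -ltnS -(ltr_nat R); apply: le_lt_trans hn _.
  by rewrite ltr_pdivrMl// mulr1 ltr_nat ltnW.
have /fset0Pn[x xF] : F n != fset0 by exact: FF.1.
move: small; rewrite ltnNge => /negP; apply; apply: (leq_trans SN).
rewrite -(card_rtransl S x); apply: fsubset_leq_card; apply/fsubsetP => y.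
rewrite in_rtransl => yS.
have : #|` (F n `\` ltransl ((y * x^-1)^-1)%g (F n))%fset| = 0%N.
  move: b0; rewrite /bdry (big_rem (y * x^-1)%g)//= => /eqP.
  by rewrite addn_eq0 => /andP[/eqP].
move=> /eqP; rewrite cardfs_eq0 => /eqP/fsetP/(_ x).
by rewrite !inE in_ltransl invgK mulgVK xF andbT => /negbFE.
Qed.

Lemma ler_ln_nat (x y : nat) : (0 < x)%N -> (x <= y)%N -> ln x%:R <= ln y%:R :> R.
Proof. by move=> x0 xy; rewrite ler_ln ?posrE ?ltr0n ?ler_nat// (leq_trans x0). Qed.

(* The points that stay close to a given one except at few g in F n are covered
   by as many sets as there are sparse maps, so exponentially many points are
   pairwise far apart along a positive proportion of F n. They shatter many, hence
   some large, subsets of F n times 'I_r. *)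
Lemma independence (A : {fset set X}) (oA : open_cover A) : infinite_set [set: G] ->
  0 < limn (fun n => logcov R a A (F n) / #|` F n|%:R) ->
  exists (r : nat) (f : nat -> X -> R) (c : R),
  [/\ forall k, continuous (f k), forall k x, 0 <= f k x <= 1, 0 < c &
   \forall n \near \oo, exists i (J : {fset G}), [/\ (i < r)%N, (J `<=` F n)%fset,
     c * #|` F n|%:R <= #|` J|%:R &
     forall sigma : G -> bool, exists x, forall g, g \in J -> f i (a g x) = (sigma g)%:R]].
Proof.
move=> infG; set l := limn _ => l0.
have cvl : (fun n => logcov R a A (F n) / #|` F n|%:R) @ \oo --> l.
  exact: (@logcov_cvg R G X a (ex_intro _ point Logic.I) A oA F FF).
pose h := l / 2; have h0 : 0 < h by rewrite divr_gt0.
have [e e0 HA] : exists2 e : R, 0 < e & forall x, exists2 U, U \in A & ball x e `<=` U.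
  have nc := (compact_near_coveringP [set: X]).1 cX.
  have H x : [set: X] x -> \forall x' \near x & n \near \oo,
      exists2 U, U \in A & ball x' n.+1%:R^-1 `<=` U.
    move=> _; have [U UA Ux] := (is_coverP A).1 oA.2 x.
    have /nbhs_ballP[d /= d0 bd] : nbhs x U by apply: open_nbhs_nbhs; split=> //; exact: oA.1.
    have d20 : 0 < d / 2 by rewrite divr_gt0.
    exists (ball x (d / 2), [set n | n.+1%:R^-1 < d / 2]); first split => /=.
    - exact: nbhsx_ballx.
    - exact: (near_infty_natSinv_lt (PosNum d20)).
    move=> [x' n] [/= xx' nn]; exists U => // s xs; apply: bd.
    rewrite [d]splitr; apply: (ball_triangle xx').
    by apply: le_ball xs; exact: ltW.
  have [n _ /(_ n (leqnn n)) hn] := nc _ _ _ _ H.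
  by exists n.+1%:R^-1; [rewrite invr_gt0|move=> x; exact: hn].
have [r [f [r0 cf f01 sepf]]] := separating_functions e0.
have rR : 0 < r%:R :> R by rewrite ltr0n.
pose rA := #|` A|.
(* Write m for |F_n|. L1 and t keep the two terms of [sparse_count], m |A| / L1 and (m / t) ln L1,
   below h m / 4 each, so sparse maps number at most exp(h m / 2). *)
pose L1 := (Num.truncn (4 * rA%:R / h)).+1.
have L1R : 0 < L1%:R :> R by rewrite ltr0n.
have hL1 : rA%:R / L1%:R <= h / 4.
  have : 4 * rA%:R / h <= L1%:R by exact/ltW/truncnS_gt.
  by rewrite !ler_pdivrMr// => hh; lra.
have lnL1 : 0 <= ln L1%:R :> R by rewrite ln_ge0// ler1n.
pose t := (Num.truncn (4 * ln L1%:R / h)).+1.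
have tR : 0 < t%:R :> R by rewrite ltr0n.
have ht : ln L1%:R / t%:R <= h / 4.
  have : 4 * ln L1%:R / h <= t%:R by exact/ltW/truncnS_gt.
  by rewrite !ler_pdivrMr// => hh; lra.
(* Points far apart along a proportion 1 / t of F_n conflict along a proportion 1 / (r t) of the
   pairs (g, i), as each far g has at least one separating i. *)
pose b := (r * t)%N; have b0 : (0 < b)%N by rewrite muln_gt0 r0.
pose lb : R := ln (4 * b)%:R; have lb0 : 0 < lb by rewrite ln_gt0// ltr1n; lia.
have ln2 : 0 < ln 2%:R :> R by rewrite ln_gt0// ltr1n.
(* With j of order h m / (2 lb), the (4 b)^j points still fit below exp(h m / 2), and 2^j is exp(c0
   m) up to rounding. *)
pose c0 := h * ln 2%:R / (2 * lb).
have c00 : 0 < c0 by rewrite divr_gt0// mulr_gt0.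
(* L2 and c1 bound by exp(c0 m / 2) the number of subsets with at most c1 m elements, so one of the
   2^j shattered sets is larger. The 1 added to ln L2 avoids a zero denominator. *)
pose L2 := (Num.truncn (4 * r%:R / c0)).+1.
have L2R : 0 < L2%:R :> R by rewrite ltr0n.
have hL2 : r%:R / L2%:R <= c0 / 4.
  have : 4 * r%:R / c0 <= L2%:R by exact/ltW/truncnS_gt.
  by rewrite !ler_pdivrMr// => hh; lra.
have lnL2 : 0 <= ln L2%:R :> R by rewrite ln_ge0// ler1n.
pose c1 := c0 / (4 * (ln L2%:R + 1)).
have c10 : 0 < c1 by rewrite divr_gt0// mulr_gt0// ltr_wpDl.
have hc1 : c1 * ln L2%:R <= c0 / 4.
  rewrite /c1 mulrAC ler_pdivrMr ?mulr_gt0 ?ltr_wpDl//.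
  have : 0 <= c0 * ln L2%:R by rewrite mulr_ge0// ltW.
  lra.
exists r, f, (c1 / r%:R); split=> //; first by rewrite divr_gt0.
have hl : h < l by rewrite /h; lra.
have big : \forall n \near \oo, h < logcov R a A (F n) / #|` F n|%:R.
  exact: (cvgr_gt l cvl _ hl).
(* For m >= N the loss of ln 2 from rounding j down is at most c0 m / 2. *)
have [N hN] : exists N : nat, 2 * ln 2%:R / c0 <= N%:R.
  by exists (Num.truncn (2 * ln 2%:R / c0)).+1; exact/ltW/truncnS_gt.
apply: filterS2 big (folner_card_infty infG N) => n hn Nn.
set E := F n in hn Nn *; set m := #|` E|.
have m0 : (0 < m)%N by rewrite cardfs_gt0; exact: FF.1.
have mR : 0 < m%:R :> R by rewrite ltr0n.
set nc := ncover (cover_along a E A) in hn *.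
have nc0 : (0 < nc)%N by apply: ncover_gt0; [exists point|exact: (open_cover_along _ _ oA).2].
have hn' : h * m%:R < ln nc%:R by move: hn; rewrite /logcov -/nc ltr_pdivlMr.
pose cc := (m %/ t)%N.
pose j := Num.truncn (h * m%:R / (2 * lb)).
have j_le : j%:R * lb <= h * m%:R / 2.
  have : j%:R <= h * m%:R / (2 * lb).
    by rewrite -truncn_ge_nat// divr_ge0// mulr_ge0// ltW.
  by rewrite ler_pdivlMr ?mulr_gt0// => ?; lra.
pose M := ((4 * b) ^ j)%N.
have M0 : (0 < M)%N by rewrite expn_gt0 muln_gt0 b0.
set Z := #|sparse_maps A E cc|.
have Z0 : (0 < Z)%N.
  apply/card_gt0P; exists [ffun=> None]; rewrite inE.
  by rewrite eq_card0// => g; rewrite unfold_in/= ffunE.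
have cE : #|{: E}| = m by rewrite /m cardfE.
have cA : #|{: A}| = rA by rewrite /rA cardfE.
have hZ : ln Z%:R <= h * m%:R / 2.
  have : (Z * L1 ^ m <= L1 ^ cc * (L1 + rA) ^ m)%N.
    by rewrite -cE -cA; exact: sparse_count.
  move=> /(ler_ln_nat (_ : 0 < Z * L1 ^ m)%N); rewrite muln_gt0 Z0 expn_gt0 => /(_ isT).
  rewrite !natrM !natrX !lnM ?posrE ?exprn_gt0 ?ltr0n ?addn_gt0// !lnXn ?ltr0n ?addn_gt0//.
  have -> : ln ((L1 + rA)%:R : R) = ln L1%:R + ln (1 + rA%:R / L1%:R).
    rewrite -lnM ?posrE ?ltr_wpDr// ?divr_ge0//.
    by rewrite mulrDr mulr1 mulrCA divff ?mulr1 ?gt_eqF// natrD.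
  have h1 : ln (1 + rA%:R / L1%:R : R) <= h / 4.
    apply: le_trans hL1; apply: le_ln1Dx; apply: (lt_le_trans (ltrN10 R)).
    by rewrite divr_ge0.
  have h2 : cc%:R * t%:R <= m%:R :> R by rewrite -natrM ler_nat leq_trunc_div.
  rewrite -![ln L1%:R *+ _]mulr_natr -[(_ + _) *+ m]mulr_natr mulrDl.
  have h3 : ln L1%:R * cc%:R <= h / 4 * m%:R.
    have : ln L1%:R <= h / 4 * t%:R by rewrite -ler_pdivrMr.
    move=> h3; apply: (le_trans (ler_wpM2r _ h3)) => //.
    have h40 : 0 <= h / 4 by rewrite divr_ge0// ltW.
    by have := ler_wpM2l h40 h2; rewrite mulrA mulrAC.
  have h4 : ln (1 + rA%:R / L1%:R : R) * m%:R <= h / 4 * m%:R by rewrite ler_wpM2r.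
  move: h3 h4; lra.
have [xs hxs] : exists x : nat -> X,
    forall i j, (i < j)%N -> (j < M)%N -> (cc < #|far e E (x i) (x j)|)%N.
  apply: (@separated_sequence A oA e HA).
  rewrite -/Z -(ltr_nat R) -ltr_ln ?posrE ?ltr0n ?muln_gt0 ?M0//.
  rewrite natrM lnM ?posrE ?ltr0n// /M natrX lnXn ?ltr0n ?muln_gt0 ?b0//; last first.
    by move: b0; rewrite /b muln_gt0.
  rewrite -/lb -[lb *+ j]mulr_natl; apply: le_lt_trans hn'.
  by move: hZ j_le; lra.
pose K := (E * 'I_r)%type.
pose p0 (u : 'I_M) (k : K) := f k.2 (a (val k.1) (xs u)) == 0.
pose p1 (u : 'I_M) (k : K) := f k.2 (a (val k.1) (xs u)) == 1.
have excl u k : ~~ (p0 u k && p1 u k).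
  by apply/negP => /andP[/eqP h1 /eqP]; rewrite h1 => /esym/eqP; rewrite oner_eq0.
have cK : #|{: K}| = (m * r)%N by rewrite card_prod card_ord cE.
have K0 : (0 < #|{: K}|)%N by rewrite cK muln_gt0 m0.
have sep_lt (u v : 'I_M) : (u < v)%N -> (#|{: K}| <= b * #|conflicts p0 p1 u v|)%N.
  move=> uv; have fuv := hxs u v uv (ltn_ord v).
  have : (#|far e E (xs u) (xs v)| <= #|conflicts p0 p1 u v|)%N.
    have /choice[ix hix] : forall g : E, exists i : 'I_r, g \in far e E (xs u) (xs v) ->
        p0 u (g, i) && p1 v (g, i).
      move=> g; have [|nf] := boolP (g \in far e E (xs u) (xs v)); last by exists (Ordinal r0).
      rewrite unfold_in/= => /sepf[i ir [h1 h2]]; exists (Ordinal ir) => _.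
      by rewrite /p0 /p1/= h1 h2 !eqxx.
    have inj : injective (fun g => (g, ix g) : K) by move=> g g' [].
    rewrite -(fintype.card_image inj); apply: subset_leq_card.
    apply/fintype.subsetP => k /fintype.imageP[g gf ->].
    by rewrite unfold_in/= (hix g gf).
  rewrite cK /b; have := ltn_ceil m (isT : 0 < t)%N; rewrite -/cc => h1 h2.
  have h3 : (m <= t * #|conflicts p0 p1 u v|)%N.
    apply: leq_trans (ltnW h1) _; rewrite mulnC leq_mul2l; apply/orP; right.
    exact: leq_trans fuv h2.
  by rewrite mulnC -mulnA leq_mul2l h3 orbT.
have sep (u v : 'I_M) : u \in [set: 'I_M]%SET -> v \in [set: 'I_M]%SET -> u != v ->
    (#|{: K}| <= b * #|conflicts p0 p1 u v|)%N.
  move=> _ _; rewrite -(inj_eq val_inj)/= neq_ltn => /orP[/sep_lt//|/sep_lt].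
  rewrite (eq_card (A := conflicts p0 p1 v u) (B := conflicts p0 p1 u v))// => k.
  rewrite /conflicts !inE/=.
  by move: (p0 u k) (p1 u k) (p0 v k) (p1 v k) => [] [] [] [].
have := shattered_large (j := j) excl K0 b0 sep.
rewrite cardsT card_ord => /(_ (leqnn _)) many.
pose s := Num.truncn (c1 * m%:R).
have c1m : 0 <= c1 * m%:R by rewrite mulr_ge0// ltW.
have [J Jsh sJ] : exists2 J : {set K}, shatters p0 p1 [set: 'I_M]%SET J & (s < #|J|)%N.
  apply: contrapT => /forall2NP H.
  have sub : (#|shattered p0 p1 [set: 'I_M]%SET| <= #|[set J : {set K} | #|J| <= s]%SET|)%N.
    apply: subset_leq_card; apply/fintype.subsetP => J; rewrite !inE => Jsh.
    by rewrite leqNgt; apply/negP => sJ; have [] := H J.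
  have : (2 ^ j * L2 ^ #|{: K}| <= L2 ^ s * L2.+1 ^ #|{: K}|)%N.
    apply: leq_trans (sparse_count_set K s (isT : 0 < L2)%N).
    by rewrite leq_mul2r (leq_trans many sub) orbT.
  move=> /(ler_ln_nat (_ : 0 < 2 ^ j * L2 ^ #|{: K}|)%N).
  rewrite muln_gt0 !expn_gt0 => /(_ isT).
  rewrite !natrM !natrX !lnM ?posrE ?exprn_gt0 ?ltr0n// !lnXn ?ltr0n//.
  have -> : ln (L2.+1%:R : R) = ln L2%:R + ln (1 + 1 / L2%:R).
    rewrite -lnM ?posrE ?ltr_wpDr// ?divr_ge0//.
    by rewrite mulrDr mulr1 mulrCA divff ?mulr1 ?gt_eqF// natr1.
  have h1 : ln (1 + 1 / L2%:R : R) <= 1 / L2%:R.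
    by apply: le_ln1Dx; apply: (lt_le_trans (ltrN10 R)); rewrite divr_ge0.
  rewrite -![ln _%:R *+ _]mulr_natr -[(_ + _) *+ #|{: K}|]mulr_natr mulrDl.
  have h2 : ln (1 + 1 / L2%:R : R) * #|{: K}|%:R <= c0 / 4 * m%:R.
    apply: (le_trans (ler_wpM2r _ h1)) => //; rewrite cK natrM div1r mulrCA mulrC ler_wpM2r//.
    by rewrite mulrC.
  have h3 : ln L2%:R * s%:R <= c0 / 4 * m%:R.
    have s_le : s%:R <= c1 * m%:R by rewrite -truncn_ge_nat.
    apply: (le_trans (ler_wpM2l lnL2 s_le)); rewrite mulrA ler_wpM2r// mulrC//.
  have h4 : c0 * m%:R < (j%:R + 1) * ln 2%:R.
    have : h * m%:R / (2 * lb) < j%:R + 1 by rewrite natr1; exact: truncnS_gt.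
    by move=> hj; rewrite /c0 mulrAC [h * _ * _]mulrAC mulrAC ltr_pM2r// ; lra.
  have h5 : 2 * ln 2%:R <= c0 * m%:R.
    rewrite -ler_pdivrMl// mulrC; apply: (le_trans hN); by rewrite ler_nat.
  move: h2 h3 h4 h5; lra.
have [i hi] := fiber_pigeonhole J r0.
pose Ji := [fset val g | g in [set g : E | (g, i) \in J]%SET]%fset.
have cJi : #|` Ji| = #|[set g : E | (g, i) \in J]%SET|.
  by rewrite card_imfset; [rewrite -cardE|exact: val_inj].
exists i, Ji; split=> //.
- by apply/fsubsetP => _ /imfsetP[g _ ->]; exact: valP.
- rewrite cJi mulrAC ler_pdivrMr//.
  apply: (@le_trans _ _ #|J|%:R); last by rewrite mulrC -natrM ler_nat.
  apply: (@le_trans _ _ s.+1%:R); first exact/ltW/truncnS_gt.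
  by rewrite ler_nat.
move=> sigma; have /shattersP/(_ [set k : K | sigma (val k.1)]%SET)[u _ hu] := Jsh.
exists (xs u) => g /imfsetP[g' /= g'J ->].
have := hu (g', i); rewrite inE in g'J; rewrite inE /= => /(_ g'J).
by case: (sigma _) => /eqP.
Qed.

End Independence.

(** * Infinite mean dimension of measures *)

Lemma continuous_bigprod (R : realType) (Y : topologicalType) (K : Type) (s : seq K)
    (F : K -> Y -> R) :
  (forall i, continuous (F i)) -> continuous (fun y => \prod_(i <- s) F i y).
Proof.
move=> cF; elim: s => [|i s IH].
  by under eq_fun do rewrite big_nil; exact: continuous_const.
by under eq_fun do rewrite big_cons; exact: continuous_mulr.
Qed.

Section ProductMeasures.
Context (R : realType) (X : pmetricType R).
Hypothesis cX : compact [set: X].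
Variables (I : finType) (q : nat) (x : {ffun I -> option 'I_q} -> X).
Local Notation N := #|{: I * 'I_q}|.
Implicit Types t : 'rV[R]_N.

(** Clamping extends the parametrisation from the cube to the whole space, where [lebesgue_covering]
    takes its open sets. *)
Definition coord t g b : R := clamp (t ord0 (enum_rank (g, b))).

(* A cube coordinate is the probability, scaled by q + 1, of a pattern; the
   option None collects the remaining mass. *)
Definition weight t g (o : option 'I_q) : R :=
  if o is Some b then coord t g b / q.+1%:R else 1 - (\sum_b coord t g b) / q.+1%:R.

Lemma clamp01 (y : R) : 0 <= clamp y <= 1.
Proof. by rewrite /clamp ge_min lexx le_min ler01 le_max lexx. Qed.

Lemma clamp_id (y : R) : 0 <= y <= 1 -> clamp y = y.
Proof. by move=> /andP[y0 y1]; rewrite /clamp (max_idPr _)// (min_idPr _). Qed.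

Lemma weight_ge0 t g o : 0 <= weight t g o.
Proof.
case: o => [b|] /=; first by rewrite divr_ge0//; case/andP: (clamp01 (t ord0 (enum_rank (g, b)))).
rewrite subr_ge0 ler_pdivrMr ?ltr0n// mul1r.
apply: (@le_trans _ _ (\sum_(b < q) 1)).
  by apply: ler_sum => b _; case/andP: (clamp01 (t ord0 (enum_rank (g, b)))).
by rewrite sumr_const card_ord ler_nat.
Qed.

Lemma sum_option (V : finType) (h : option V -> R) : \sum_o h o = h None + \sum_v h (Some v).
Proof.
rewrite (bigD1 None)//=; congr (_ + _).
rewrite (reindex_omap Some id); last by case.
by apply: eq_bigl => v; rewrite /= eqxx.
Qed.

Lemma sum_weight t g : \sum_o weight t g o = 1.
Proof. by rewrite sum_option/= mulr_suml subrK. Qed.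

Lemma continuous_weight g o : continuous (fun t => weight t g o).
Proof.
have cc b : continuous (fun t => coord t g b).
  apply: continuous_minr; first exact: continuous_const.
  apply: continuous_maxr; first exact: continuous_const.
  exact: coord_continuous.
case: o => [b|] /=.
  by apply: continuous_mulr => //; exact: continuous_const.
apply: continuous_subr; first exact: continuous_const.
by apply: continuous_mulr; [exact: continuous_bigsum|exact: continuous_const].
Qed.

Definition config_weight t (w : {ffun I -> option 'I_q}) := \prod_g weight t g (w g).

Lemma continuous_config_weight w : continuous (config_weight ^~ w).
Proof.
by apply: continuous_bigprod => g; exact: continuous_weight.
Qed.

Definition config_mean t (h : X -> R) := \sum_w config_weight t w * h (x w).

Lemma pos_linear_config_mean t : pos_linear (config_mean t).
Proof.
have w0 w : 0 <= config_weight t w by apply: prodr_ge0 => g _; exact: weight_ge0.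
split=> [f g _ _|r f _|f g _ _ fg|].
- by rewrite -big_split/=; apply: eq_bigr => w _; rewrite mulrDr.
- by rewrite mulr_sumr; apply: eq_bigr => w _; rewrite mulrCA.
- by apply: ler_sum => w _; rewrite ler_wpM2l.
rewrite /config_mean; under eq_bigr do rewrite mulr1.
rewrite /config_weight -(bigA_distr_bigA (fun g o => weight t g o)).
by rewrite big1// => g _; exact: sum_weight.
Qed.

Lemma config_mean_marginal t (f : X -> R) g b :
  (forall w, f (x w) = (w g == Some b)%:R) -> config_mean t f = coord t g b / q.+1%:R.
Proof.
move=> fx; pose W h o := weight t h o * (if h == g then (o == Some b)%:R else 1).
transitivity (\sum_(w : {ffun I -> option 'I_q}) \prod_h W h (w h)).
  apply: eq_bigr => w _; rewrite big_split/= fx; congr (_ * _).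
  rewrite (bigD1 g)//= eqxx big1 ?mulr1// => h /negbTE hg.
  by rewrite hg.
rewrite -(bigA_distr_bigA W) (bigD1 g)//= [X in _ * X]big1 ?mulr1; last first.
  by move=> h nh; rewrite -[RHS](sum_weight t h); apply: eq_bigr => o _; rewrite /W (negbTE nh) mulr1.
rewrite (bigD1 (Some b))//= /W !eqxx mulr1 big1 ?addr0// => o /negbTE ->.
by rewrite mulr0.
Qed.

Lemma product_measures : exists mu : 'rV[R]_N -> borelProb X, continuous mu /\
  forall t f, continuous f -> bexpect f (mu t) = config_mean t f.
Proof.
have /choice[mu hmu] : forall t, exists m : borelProb X, forall f, continuous f ->
    expect (sval m) f = config_mean t f.
  by move=> t; exact: riesz_representation (pos_linear_config_mean t).
exists mu; split=> [t|t f cf]; last exact: hmu.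
apply: (borelProb_cvg (fmap_filter mu (nbhs_filter t))) => f cf.
have cm : continuous (config_mean ^~ f).
  apply: continuous_bigsum => w; apply: continuous_mulr; last exact: continuous_const.
  exact: continuous_config_weight.
have bE : config_mean ^~ f = bexpect f \o mu by apply/funext => s; rewrite /= -hmu.
by move: cm; rewrite bE; exact.
Qed.

(** On two opposite faces the mean of f g b is 0 and 1 / (q + 1), so the oscillation bound keeps
    each member away from one of them, as Lebesgue's theorem requires. *)
Lemma product_cover_mult (J : finType) (U : J -> set (borelProb X)) (f : I -> 'I_q -> X -> R) :
  (forall j, open (U j)) -> (forall mu, exists j, U j mu) ->
  (forall g b, continuous (f g b)) ->
  (forall g b w, f g b (x w) = (w g == Some b)%:R) ->
  (forall j g b mu nu, U j mu -> U j nu ->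
     `|bexpect (f g b) mu - bexpect (f g b) nu| < q.+1%:R^-1) ->
  exists mu, (N < #|[pred j | `[< U j mu >]]|)%N.
Proof.
move=> oU cU cf fx osc; have [mu [cmu mean]] := product_measures.
have [|t _ ht] := @lebesgue_covering R N J (fun j => mu @^-1` U j) (fun j => (continuousP mu).1 cmu _ (oU j))
  (fun t _ => cU (mu t)); last by exists (mu t).
move=> j k t t' tc tc' Ut Ut'; rewrite -(enum_valK k); case: (enum_val k) => g b t0 t1.
have := osc j g b _ _ Ut Ut'.
rewrite !mean// !(config_mean_marginal _ (fx g b)) /coord !clamp_id ?t0 ?t1 ?lexx ?ler01//.
by rewrite mul0r sub0r normrN mul1r ger0_norm ?ltxx.
Qed.

End ProductMeasures.

(** * Disjoint dense blocks in a Folner set *)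

Section Blocks.
Context (G : groupType).
Implicit Types (E J S W C : {fset G}).
Local Open Scope nat_scope.

Definition block_trace S J (g : G) : {fset G} := [fset s in S | (s * g)%g \in J]%fset.

(* Double counting of the pairs (s, g) with s g in J. *)
Lemma dense_blocks S E J l : (J `<=` E)%fset ->
  #|` S| * #|` J| <= #|` S| * #|` [fset g in E | l <= #|` block_trace S J g|]%fset|
    + l * #|` E| + bdry [seq s^-1%g | s <- S] E.
Proof.
move=> JE.
have step s : #|` J| <= #|` [fset g in E | (s * g)%g \in J]%fset| + #|` (E `\` ltransl s E)%fset|.
  rewrite -(card_ltransl s [fset g in E | (s * g)%g \in J]%fset).
  apply: card_fsetD_le; apply/fsubsetP => x xJ; have xE := fsubsetP JE x xJ.
  by rewrite in_fsetU in_fsetD xE andbT !in_ltransl !inE/= mulKVg xJ andbT orbN.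
apply: (@leq_trans (\sum_(s <- S) (#|` [fset g in E | (s * g)%g \in J]%fset|
                     + #|` (E `\` ltransl s E)%fset|))).
  by rewrite -[#|` S|]sum1_size big_distrl/=; apply: leq_sum => s _; rewrite mul1n.
rewrite big_split/= /bdry big_map; apply: leq_add; last first.
  by apply: leq_sum => s _; rewrite invgK.
rewrite (eq_bigr (fun s => \sum_(g <- E) ((s * g)%g \in J))); last first.
  by move=> s _; rewrite card_fset_sep count_sum.
rewrite exchange_big/= card_fset_sep count_sum big_distrr/= -[#|` E|]sum1_size big_distrr/=.
rewrite -big_split/=; apply: leq_sum => g _.
rewrite -count_sum -card_fset_sep -/(block_trace S J g) muln1.
have [_|lt] := leqP l; last by rewrite muln0 add0n ltnW.
by rewrite muln1; apply: leq_trans (leq_addr _ _); apply: fsubset_leq_card; apply/fsubsetP => s /imfsetP[/= s' /andP[s'S _] ->].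
Qed.

(** Greedy choice: S h meets S g only for h in S^-1 S g, a set of at most |S|^2 elements, which is
    removed from W once g is chosen. *)
Lemma disjoint_blocks S W : S != fset0 -> exists C, [/\ (C `<=` W)%fset,
  #|` W| <= #|` S| ^ 2 * #|` C| &
  forall g h s t, g \in C -> h \in C -> s \in S -> t \in S -> (s * g = t * h)%g -> g = h].
Proof.
move=> /fset0Pn[s0 s0S]; have [n] := ubnP #|` W|; elim: n W => // n IH W; rewrite ltnS => Wn.
have [->|/fset0Pn[g gW]] := eqVneq W fset0.
  by exists fset0; split=> //; rewrite cardfs0.
pose near := [fset x in [seq (t^-1 * s * g)%g | s <- S, t <- S]]%fset.
have near_card : #|` near| <= #|` S| ^ 2.
  by rewrite card_fseq (leq_trans (size_undup _))// size_allpairs mulnn.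
have nearP s t : s \in S -> t \in S -> (t^-1 * s * g)%g \in near.
  by move=> sS tS; rewrite inE; apply/allpairsP; exists (s, t).
have gnear : g \in near by have := nearP _ _ s0S s0S; rewrite mulVg mul1g.
have [|C [CW cC dC]] := IH (W `\` near)%fset.
  apply: leq_trans Wn; rewrite -(cardfsID near W) addnC -addn1 leq_add2l cardfs_gt0.
  by apply/fset0Pn; exists g; rewrite inE gW gnear.
have gC : g \notin C by apply/negP => /(fsubsetP CW); rewrite inE gnear.
have far h s t : h \in C -> s \in S -> t \in S -> (s * g = t * h)%g -> g = h.
  move=> hC sS tS e; have /(fsubsetP CW) := hC; rewrite inE => /andP[/negP[]].
  by have := nearP s t sS tS; rewrite -mulgA e mulKg.
exists (g |` C)%fset; split.
- by apply/fsubsetP => x; rewrite !inE => /orP[/eqP ->//|/(fsubsetP CW)]; rewrite inE => /andP[].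
- rewrite cardfsU1 gC mulnDr muln1.
  rewrite -(cardfsID near W); apply: leq_add cC.
  by apply: leq_trans near_card; apply: fsubset_leq_card; exact: fsubsetIr.
move=> h h' s t; rewrite !inE => /orP[/eqP ->|hC] /orP[/eqP ->|h'C] sS tS e //.
- exact: far e.
- by apply/esym; apply: (far _ t s) => //; rewrite e.
- exact: dC e.
Qed.

Lemma exponential_beats_square A : exists2 l : nat, 0 < l & A * l ^ 2 < 2 ^ l.
Proof.
(* With k = 4 (A + 1) and l = 4 k: 2^l = (2^k)^4 > k^4 >= 16 A k^2 = A l^2. *)
exists (16 * A.+1) => //.
rewrite (_ : 16 * A.+1 = 4 * (4 * A.+1))%N; last by lia.
rewrite expnM; set k := 4 * A.+1.
have k2 : k < 2 ^ k by exact: ltn_expl.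
apply: (@leq_ltn_trans (k ^ 4)).
  rewrite expnMn (expnD k 2 2) mulnA leq_mul2r; apply/orP; right.
  by rewrite /k -!mulnn; nia.
by rewrite (expnAC 2 4 k) ltn_exp2r.
Qed.

Lemma infinite_fset_card m : infinite_set [set: G] -> exists S, #|` S| = m.
Proof.
move=> infG; have [B _ mB] := infinite_set_fset m infG.
exists [fset x in take m B]%fset.
rewrite card_fseq undup_id ?size_takel//.
exact/take_uniq/fset_uniq.
Qed.

End Blocks.

(** [None] consumes a pattern too, hence the strict inequality. *)
Lemma subset_patterns (S : finType) (T : {set S}) q : (q < 2 ^ #|T|)%N ->
  exists pat : option 'I_q -> {set S}, injective pat /\ forall o, pat o \subset T.
Proof.
rewrite -card_powerset => qT.
have le : (#|{: option 'I_q}| <= #|powerset T|)%N by rewrite card_option card_ord.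
exists (fun o => enum_val (widen_ord le (enum_rank o))); split.
  by move=> o o' /enum_val_inj/(congr1 val)/= /ord_inj/enum_rank_inj.
by move=> o; have := enum_valP (widen_ord le (enum_rank o)); rewrite powersetE.
Qed.

Section InfiniteMeanDimension.
Context (R : realType) (G : groupType) (X : pmetricType R) (a : contAction G X).
Hypothesis cX : compact [set: X].
Local Notation M := (borelProb X).
Local Notation along_dim_push := (along_dim (pushAction a) (borelProb_inhabited cX) (subordinate_functions cX)).

Section Patterns.
Variables (r : nat) (f : nat -> X -> R) (S : {fset G}).
Hypothesis cf : forall k, continuous (f k).
Hypothesis f01 : forall k x, 0 <= f k x <= 1.

(** A continuous function which, where f is 0 or 1 on T = [k.2.1], indicates that f is 1 exactly on
    P = [k.2.2]. The index set depends on S and r only; translates are reached by composing with the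
    action. *)
Definition pattern (k : 'I_r * ({set S} * {set S})) (x : X) : R :=
  \prod_(s in k.2.1) (if s \in k.2.2 then f k.1 (a (val s) x) else 1 - f k.1 (a (val s) x)).

Lemma continuous_pattern k : continuous (pattern k).
Proof.
rewrite (_ : pattern k = fun x => \prod_(s <- enum k.2.1)
    (if s \in k.2.2 then f k.1 (a (val s) x) else 1 - f k.1 (a (val s) x))); last first.
  by apply/funext => x; rewrite /pattern big_enum.
apply: continuous_bigprod => s.
have cfs : continuous (fun x => f k.1 (a (val s) x)).
  by move=> x; apply: continuous_comp; [exact: act_continuous|exact: cf].
case: (s \in _) => //; apply: continuous_subr => //; exact: continuous_const.
Qed.

Lemma pattern01 k x : 0 <= pattern k x <= 1.
Proof.
apply/andP; rewrite /pattern; elim/big_rec: _ => [|s y _ [y0 y1]]; first by rewrite ler01 lexx.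
have /andP[u0 u1] := f01 k.1 (a (val s) x).
by case: ifP => _; split; nra.
Qed.

Lemma pattern_eq (i : 'I_r) (T P Q : {set S}) x : P \subset T -> Q \subset T ->
  (forall s, s \in T -> f i (a (val s) x) = (s \in Q)%:R) ->
  pattern (i, (T, P)) x = (Q == P)%:R.
Proof.
move=> PT QT fx; rewrite /pattern/=.
rewrite (eq_bigr (fun s => ((s \in P) == (s \in Q))%:R)); last first.
  by move=> s sT; rewrite fx//; case: (s \in P) (s \in Q) => [] []; rewrite /= ?subrr ?subr0.
have [->|/eqP QP] := eqVneq Q P; first by rewrite big1// => s _; rewrite eqxx.
have [s sT sPQ] : exists2 s, s \in T & (s \in P) != (s \in Q).
  apply: contrapT => /forall2NP H; apply: QP; apply/setP => s.
  have [nT|/negP] := H s.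
    have out (D : {set S}) : D \subset T -> s \in D = false.
      by move=> DT; apply/negP => /(fintype.subsetP DT).
    by rewrite !out.
  by rewrite negbK => /eqP.
by rewrite (bigD1 s)//= (negbTE sPQ) mul0r.
Qed.

Lemma pattern_cover (e : R) : 0 < e -> exists A : {fset set M}, open_cover A /\
  forall V, V \in A -> forall mu nu, V mu -> V nu ->
    forall k, `|bexpect (pattern k) mu - bexpect (pattern k) nu| < e.
Proof.
move=> e0; apply: small_oscillation_cover01 => // k; first exact/bexpect_continuous/continuous_pattern.
move=> mu; exact: (expect01 cX (sval mu) continuous_pattern pattern01 k).
Qed.

(** A set small along E has small oscillation for [pattern \o a g] with g in C, because g pushes it
    into a member of A. The product measures over the blocks form a cube with |C| q coordinates,
    read off by these functions. *)
Lemma along_dim_ge q (A : {fset set M}) (oA : open_cover A) (E C : {fset G})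
    (T : G -> {set S}) (i : 'I_r) :
  (forall V, V \in A -> forall mu nu, V mu -> V nu ->
    forall k, `|bexpect (pattern k) mu - bexpect (pattern k) nu| < q.+1%:R^-1) ->
  (C `<=` E)%fset -> (forall g, g \in C -> (q < 2 ^ #|T g|)%N) ->
  (forall g h (s t : S), g \in C -> h \in C -> (val s * g = val t * h)%g -> g = h) ->
  (forall sigma : G -> bool, exists x, forall g s, g \in C -> s \in T g ->
     f i (a (val s * g)%g x) = (sigma (val s * g)%g)%:R) ->
  (#|` C| * q <= along_dim_push oA E)%N.
Proof.
move=> osc CE Tq disj interp.
have /choice[pat hpat] : forall g : C, exists p : option 'I_q -> {set S},
    injective p /\ forall o, p o \subset T (val g).
  by move=> g; apply: subset_patterns; exact/Tq/valP.
have /choice[x hx] : forall w : {ffun C -> option 'I_q}, exists x, forall (g : C) s,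
    s \in T (val g) -> f i (a (val s) (a (val g) x)) = (s \in pat g (w g))%:R.
  (* By disjointness a point s g determines its block g, so patterns chosen separately on the blocks
     combine into one function on G. *)
  move=> w; pose sigma y := [exists g : C, [exists s in pat g (w g), val s * val g == y]%g].
  have [x hx] := interp sigma; exists x => g s sT.
  rewrite -actM (hx _ _ (valP g) sT); congr (_%:R); congr nat_of_bool.
  apply/idP/idP => [/existsP[h /existsP[t /andP[tP /eqP e]]]|sP].
    have gh : h = g by apply/val_inj/(disj _ _ t s) => //; exact: valP.
    by move: tP e; rewrite gh => tP /mulIg/val_inj <-.
  by apply/existsP; exists g; apply/existsP; exists s; rewrite sP eqxx.
have [I [phi [[cphi phi0] small mult]]] := along_dim_le_dim (pushAction a)
  (borelProb_inhabited cX) (subordinate_functions cX) oA E.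
pose psi (g : C) (b : 'I_q) := pattern (i, (T (val g), pat g (Some b))) \o a (val g).
have cpsi g b : continuous (psi g b).
  by move=> y; apply: continuous_comp; [exact: act_continuous|exact: continuous_pattern].
have [|||g b w||mu hmu] := @product_cover_mult R X cX C q x I (fun j => [set mu | 0 < phi j mu]) psi.
- move=> j; have /continuousP := cphi j => /(_ [set t | 0 < t]); apply; exact: open_gt.
- exact: phi0.
- exact: cpsi.
- rewrite /psi /= (pattern_eq (Q := pat g (w g))); first by rewrite (inj_eq (hpat g).1).
  + exact: (hpat g).2.
  + exact: (hpat g).2.
  + by move=> s sT; rewrite hx.
- move=> j g b mu nu; have gE := fsubsetP CE _ (valP g).
  have [V VA sV] := small j _ gE; move=> /sV Vmu /sV Vnu.
  have := osc V VA _ _ Vmu Vnu (i, (T (val g), pat g (Some b))).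
  by rewrite !bexpect_push//; exact: continuous_pattern.
have := leq_trans hmu _; rewrite card_prod card_ord cardfE => lt.
rewrite -ltnS; apply: lt; apply: leq_trans (mult mu).
by rewrite /fmult; apply/eq_leq/eq_card => j; rewrite !unfold_in/= asboolb.
Qed.

End Patterns.

Hypothesis infG : infinite_set [set: G].
Variables (F : nat -> {fset G}) (FF : folner R F).

Lemma independence_mdim (r : nat) (f : nat -> X -> R) (c : R) :
  (forall k, continuous (f k)) -> (forall k x, 0 <= f k x <= 1) -> 0 < c ->
  (\forall n \near \oo, exists i (J : {fset G}), [/\ (i < r)%N, (J `<=` F n)%fset,
     c * #|` F n|%:R <= #|` J|%:R &
     forall sigma : G -> bool, exists x, forall g, g \in J -> f i (a g x) = (sigma g)%:R]) ->
  forall K : R, 0 <= K -> exists (A : {fset set M}) (oA : open_cover A),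
    \forall n \near \oo, K * #|` F n|%:R <= (along_dim_push oA (F n))%:R.
Proof.
move=> cf f01 c0 indep K K0.
(* The good centres W will have density c / 2 in F_n; K' compensates for it. *)
pose K' := (Num.truncn (2 * K / c)).+1.
have hK' : K <= c / 2 * K'%:R.
  have : 2 * K / c <= K'%:R by exact/ltW/truncnS_gt.
  by rewrite ler_pdivrMr// => h; lra.
(* B bounds m / l whatever l is; this allows l to be chosen first with K' B^2 l^2 < 2^l, which gives
   q < 2^l. *)
pose B := (Num.truncn (4 / c)).+2.
have [l l0 hl] := exponential_beats_square (K' * B ^ 2).
have [m m_ge m_le] : exists2 m : nat, 4 * l%:R <= m%:R * c & (m <= B * l)%N.
  pose m := (Num.truncn (4 * l%:R / c)).+1; exists m.
    have : 4 * l%:R / c <= m%:R by exact/ltW/truncnS_gt.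
    by rewrite ler_pdivrMr.
  rewrite -(ler_nat R) natrM.
  have h1 : m%:R <= 4 * l%:R / c + 1.
    by rewrite /m -[leLHS]natr1 lerD2r -truncn_ge_nat// mulr_ge0// ?invr_ge0 ?mulr_ge0// ltW.
  have h2 : 4 / c + 1 <= B%:R.
    by rewrite /B -[leRHS]natr1 lerD2r; exact/ltW/truncnS_gt.
  have lR : 1 <= l%:R :> R by rewrite ler1n.
  have h3 : 4 * l%:R / c = 4 / c * l%:R by ring.
  rewrite h3 in h1; apply: (le_trans h1); nra.
(* The factor m^2 pays for the passage from W to disjoint blocks, |W| <= m^2 |C|. *)
pose q := (K' * m ^ 2)%N.
have ql : (q < 2 ^ l)%N.
  apply: leq_ltn_trans hl; rewrite -mulnA leq_mul2l -expnMn leq_exp2r// m_le orbT//.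
have [S Sm] := infinite_fset_card m infG.
have mR : 0 < m%:R :> R.
  by rewrite -(pmulr_lgt0 _ c0); apply: lt_le_trans m_ge; rewrite mulr_gt0// ltr0n.
have S0 : S != fset0 by rewrite -cardfs_gt0 Sm -(ltr0n R).
have [|A [oA osc]] := @pattern_cover r f S cf f01 q.+1%:R^-1.
  by rewrite invr_gt0.
exists A, oA.
(* In [dense_blocks] the boundary and the term l |F_n| each take at most a quarter of m c |F_n|;
   half is left for m |W|. *)
have d0 : 0 < m%:R * c / 4 by rewrite divr_gt0// mulr_gt0.
apply: filterS2 indep (folner_bdry [seq s^-1%g | s <- S] FF d0) => n [i [J [ir JE cJ interp]]] bd.
set E := F n in JE cJ bd *.
pose W := [fset g in E | (l <= #|` block_trace S J g|)%N]%fset.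
have [C [CW cC disj]] := disjoint_blocks W S0.
have WE x : x \in W -> x \in E /\ (l <= #|` block_trace S J x|)%N.
  by rewrite !inE => /andP[].
have cW : c / 2 * #|` E|%:R <= #|` W|%:R.
  have := dense_blocks S l JE; rewrite -/W Sm -(ler_nat R) !natrD !natrM => dense.
  have E0 : 0 <= #|` E|%:R :> R by [].
  have h1 : m%:R * (c * #|` E|%:R) <= m%:R * #|` J|%:R by rewrite ler_wpM2l// ltW.
  have h2 : l%:R * #|` E|%:R <= m%:R * c / 4 * #|` E|%:R by rewrite ler_wpM2r// ler_pdivlMr// mulrC.
  rewrite -(ler_pM2l mR); move: dense h1 h2 bd; clear.
  move: (#|` E|%:R : R) (#|` J|%:R : R) (#|` W|%:R : R) (bdry _ _)%:R => x y z t; lra.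
pose T g : {set S} := [set s : S | (val s * g)%g \in J]%SET.
have cT g : #|` block_trace S J g| = #|T g|.
  rewrite /block_trace card_fset_sep.
  rewrite count_sum big_seq_fsetE/= -sum1_card [RHS]big_mkcond/=.
  by apply: eq_bigr => s _; rewrite inE; case: (_ \in J).
have key : (#|` C| * q <= along_dim_push oA E)%N.
  apply: (@along_dim_ge r f S cf q A oA E C T (Ordinal ir)) => //.
  - by apply/fsubsetP => x /(fsubsetP CW)/WE[].
  - move=> g /(fsubsetP CW)/WE[_]; rewrite cT => lg; apply: leq_trans ql _.
    by rewrite leq_exp2l.
  - by move=> g h s t gC hC; apply: disj => //; exact: valP.
  move=> sigma; have [x hx] := interp sigma; exists x => g s gC; rewrite inE => sgJ.
  exact: hx.
apply: (@le_trans _ _ (#|` C| * q)%:R); last by rewrite ler_nat.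
rewrite /q mulnCA natrM [(#|` C| * _)%N]mulnC.
apply: (@le_trans _ _ (K'%:R * #|` W|%:R)); last by rewrite ler_wpM2l// ler_nat -Sm.
apply: (@le_trans _ _ (K'%:R * (c / 2 * #|` E|%:R))); last by rewrite ler_wpM2l.
by rewrite mulrA [K'%:R * _]mulrC ler_wpM2r.
Qed.

Lemma positive_entropy_mdim (A : {fset set X}) (oA : open_cover A) :
  0 < limn (fun n => logcov R a A (F n) / #|` F n|%:R) ->
  mdim R (pushAction a) F = +oo%E.
Proof.
move=> h; have [r [f [c [cf f01 c0 indep]]]] := independence cX FF oA infG h.
have ge K : 0 <= K -> (K%:E <= mdim R (pushAction a) F)%E.
  move=> K0; have [B [oB hB]] := independence_mdim cf f01 c0 indep K0.
  have := @mdim_ge R G M (pushAction a) (borelProb_inhabited cX) F FF (subordinate_functions cX) B oB.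
  apply: le_trans.
  rewrite lee_fin; apply: limr_ge; first exact: along_dim_cvg.
  apply: filterS hB => n; rewrite ler_pdivlMr// ltr0n cardfs_gt0; exact: FF.1.
apply/eqyP => K K0; apply: ge; exact: ltW.
Qed.

End InfiniteMeanDimension.

Local Open Scope ereal_scope.

Theorem mainTheorem1 (R : realType) (G : groupType) (X : pmetricType R)
    (a : contAction G X) :
  countable [set: G] -> infinite_set [set: G] -> amenable R G ->
  compact [set: X] ->
  forall F : nat -> {fset G}, folner R F ->
    (0 < htop R a F <-> 0 < mdim R (pushAction a) F) /\
    (0 < mdim R (pushAction a) F <-> mdim R (pushAction a) F = +oo).
Proof.
move=> _ infG _ cX F FF.
have X0 : exists x : X, True by exists point.
have inf : 0 < htop R a F -> mdim R (pushAction a) F = +oo.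
  by move=> /(htop_gt0 X0 FF)[A [oA]]; exact: positive_entropy_mdim.
have pos : 0 < mdim R (pushAction a) F -> 0 < htop R a F.
  move=> /(mdim_gt0 (borelProb_inhabited cX) FF (subordinate_functions cX))[A [oA]].
  rewrite ltNge => h; rewrite ltNge; apply/negP => htop0; move/negP: h; apply.
  apply: zero_entropy_mdim => // B oB.
  by have := le_trans (htop_ge a X0 FF oB) htop0; rewrite lee_fin.
split; split=> //; first by move=> /inf ->.
  by move=> /pos/inf.
by move=> ->.
Qed.
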